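(* Let $T\in(0,+\infty)$, $\sigma\in\mathbb{R}_+$ and $c\in[1,3)$. If $u_1^*,u_2^*\in L^2(\Omega,H_+)$ are strong stationary solutions of the system $$\left\{\begin{array}{ll} du_0=-u_0u_1\,dt+\sigma\, dW(t) & \\ du_j=\left(-2^{cj}u_ju_{j+1}+2^{c(j-1)}u_{j-1}^2\right)dt & \text{for } j\ge 1 \end{array}\right.\qquad t\in[0,T],$$ then $u_1^*$ and $u_2^*$ have the same distribution; that is, their stationary distributions (the law of $u_1^*(t)$ and the law of $u_2^*(t)$, neither of which depends on $t$) coincide.
   Context: Sequences $u=(u_j)_{j\ge0}$ are real and indexed by $j\ge 0$; $\ell^2$ is the space of square-summable ones, with norm $\|\cdot\|$. $H_+=\{u\in\ell^2: u_j\ge 0 \text{ for all } j\ge1\}$ (no sign condition on $u_0$). $\mathbb{R}_+=[0,\infty)$. The first equation of the system is understood as $u_0(t)=u_0(0)-\int_0^t u_1(s)u_0(s)\,ds+\sigma W(t)$ a.s., with $W$ a one-dimensional Brownian motion. Strong solution: given a filtered probability space $(\Omega,\mathcal{F},\{\mathcal{F}_t\}_{t\in[0,T]},\mathbb{P})$, a Brownian motion $W$ with respect to $\{\mathcal{F}_t\}$ and an $\mathcal{F}_0$-measurable initial condition $\underline{u}$, a strong solution is a stochastic process $u$ on $(\Omega,\mathcal{F},\mathbb{P})$ with continuous sample paths, satisfying the system with $u(0)=\underline{u}$ and adapted to the filtration generated by $W$ and $\underline{u}$. Here the paths are as in the pathwise notion of solution: each component $t\mapsto u_j(t)$ is continuous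 on $[0,T]$ and $u(t)\in H_+$ for all $t\in[0,T]$. Strong stationary solution: a strong solution $u^*$ such that the distribution of $u^*(t)$ does not depend on $t\in[0,T]$. $u^*\in L^2(\Omega,H_+)$ means that, for every $t\in[0,T]$, $u^*(t)\in H_+$ a.s. and $\mathbb{E}\|u^*(t)\|^2<\infty$. *)

(* Defs.v *)
From HB Require Import structures.
From mathcomp Require Import all_boot all_order all_algebra.
From mathcomp Require Import all_classical all_reals all_analysis.

Set Implicit Arguments.
Unset Strict Implicit.
Unset Printing Implicit Defensive.
Import Order.TTheory GRing.Theory Num.Theory.
Import numFieldNormedType.Exports.

Local Open Scope classical_set_scope.
Local Open Scope ring_scope.

(* ||u||^2, with values in [0, +oo] *)
Definition sqnorm (R : realType) (u : nat -> R) : \bar R :=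
  (\sum_(0 <= j <oo) ((u j) ^+ 2)%:E)%E.

Definition ell2 (R : realType) : set (nat -> R) :=
  [set u | (sqnorm u < +oo)%E].

Definition ell2_norm (R : realType) (u : nat -> R) : R :=
  Num.sqrt (fine (sqnorm u)).

Definition Hplus (R : realType) : set (nat -> R) :=
  [set u | ell2 u /\ forall j, (1 <= j)%N -> 0 <= u j].

(* The open subsets of the metric space H_+, whose distance is the one
   induced by the norm of ell2. *)
Definition Hplus_open (R : realType) : set (set (nat -> R)) :=
  [set U | U `<=` @Hplus R /\
    forall u, U u -> exists2 e : R, 0 < e &
      forall v, Hplus v -> ell2_norm (fun j => v j - u j) < e -> U v].

(* A sigma-algebra on H_+ (not on all sequences): its members are subsets
   of H_+, and the complements are taken in H_+. *)
Definition Hplus_borel (R : realType) : set (set (nat -> R)) :=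
  <<s @Hplus R, @Hplus_open R >>.

(* G is a sigma-algebra on the source, S one on (a part of) the target. *)
Definition measurable_wrt (Omega E : Type) (G : set (set Omega))
    (S : set (set E)) (X : Omega -> E) : Prop :=
  preimage_set_system setT X S `<=` G.

Record filtration (R : realType) (d : measure_display)
    (Omega : measurableType d) (T : R) (F : R -> set (set Omega)) : Prop :=
  Filtration {
    filtration_sigma : forall t : R, t \in `[0, T] -> sigma_algebra setT (F t);
    filtration_sub : forall t : R, t \in `[0, T] -> F t `<=` measurable;
    filtration_homo : forall s t : R, s \in `[0, T] -> t \in `[0, T] ->
      s <= t -> F s `<=` F t }.

Definition increment (R : realType) (Omega : Type) (W : R -> Omega -> R)
    (s t : R) (w : Omega) : R := W t w - W s w.

(* normal_prob takes the standard deviation as its second parameter. *)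
Record brownian_motion (R : realType) (d : measure_display)
    (Omega : measurableType d) (P : probability Omega R) (T : R)
    (F : R -> set (set Omega)) (W : R -> Omega -> R) : Prop :=
  BrownianMotion {
    bm_adapted : forall t : R, t \in `[0, T] -> measurable_wrt (F t) measurable (W t);
    bm_start : {ae P, forall w, W 0 w = 0};
    bm_continuous :
      {ae P, forall w, {within `[0, T], continuous (fun t => W t w)}};
    bm_independent : forall (s t : R) (A : set Omega) (B : set R),
      s \in `[0, T] -> t \in `[0, T] -> s < t -> F s A -> measurable B ->
      P (A `&` increment W s t @^-1` B) =
        (P A * P (increment W s t @^-1` B))%E;
    bm_normal : forall (s t : R) (B : set R),
      s \in `[0, T] -> t \in `[0, T] -> s < t -> measurable B ->
      P (increment W s t @^-1` B) =
        normal_prob 0 (Num.sqrt (t - s)) B }.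

(* sigma (ubar, W s : 0 <= s <= t) *)
Definition generated_filtration (R : realType) (Omega : Type)
    (W : R -> Omega -> R) (ubar : Omega -> nat -> R) (t : R) :
    set (set Omega) :=
  <<s preimage_set_system setT ubar (@Hplus_borel R) `|`
      \bigcup_(s in `[0, t]) preimage_set_system setT (W s) measurable >>.

(* The system along one sample path x, with driving path w, in integral
   form. It is only used for componentwise continuous paths, so Rintegral is
   never applied to a non-integrable function. *)
Definition solves_system (R : realType) (T sigma c : R)
    (w : R -> R) (x : R -> nat -> R) : Prop :=
  forall t : R, t \in `[0, T] ->
    x t 0%N = x 0 0%N
      - \int[lebesgue_measure]_(s in `[0, t]) (x s 1%N * x s 0%N)
      + sigma * w t
    /\ forall j, (1 <= j)%N ->
      x t j = x 0 j
        + \int[lebesgue_measure]_(s in `[0, t])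
            (- (2 `^ (c * j%:R)) * x s j * x s j.+1
             + 2 `^ (c * j.-1%:R) * x s j.-1 ^+ 2).

Record strong_solution (R : realType) (d : measure_display)
    (Omega : measurableType d) (P : probability Omega R) (T sigma c : R)
    (F : R -> set (set Omega)) (W : R -> Omega -> R)
    (ubar : Omega -> nat -> R) (u : R -> Omega -> nat -> R) : Prop :=
  StrongSolution {
    sol_initial_measurable : measurable_wrt (F 0) (@Hplus_borel R) ubar;
    sol_initial : forall w, u 0 w = ubar w;
    sol_continuous : forall w j,
      {within `[0, T], continuous (fun t => u t w j)};
    sol_Hplus : forall (t : R) w, t \in `[0, T] -> Hplus (u t w);
    sol_adapted : forall t : R, t \in `[0, T] ->
      measurable_wrt (generated_filtration W ubar t) (@Hplus_borel R) (u t);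
    sol_system : {ae P, forall w,
      solves_system T sigma c (fun t => W t w) (fun t => u t w)} }.

(* X and Y have the same law on H_+. *)
Definition same_law (R : realType) (d : measure_display)
    (Omega : measurableType d) (P : probability Omega R)
    (X Y : Omega -> nat -> R) : Prop :=
  forall A, Hplus_borel A -> P (X @^-1` A) = P (Y @^-1` A).

Definition strong_stationary_solution (R : realType) (d : measure_display)
    (Omega : measurableType d) (P : probability Omega R) (T sigma c : R)
    (F : R -> set (set Omega)) (W : R -> Omega -> R)
    (u : R -> Omega -> nat -> R) : Prop :=
  (exists ubar, strong_solution P T sigma c F W ubar u) /\
  forall s t : R, s \in `[0, T] -> t \in `[0, T] -> same_law P (u s) (u t).

Definition in_L2_Hplus (R : realType) (d : measure_display)
    (Omega : measurableType d) (P : probability Omega R) (T : R)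
    (u : R -> Omega -> nat -> R) : Prop :=
  forall t : R, t \in `[0, T] ->
    {ae P, forall w, Hplus (u t w)} /\
    (\int[P]_w sqnorm (u t w) < +oo)%E.

(* Main.v *)
Require Import Defs.
From mathcomp Require Import all_boot all_order all_algebra.
From mathcomp Require Import all_classical all_reals all_analysis measurable_realfun.
From mathcomp Require Import ring lra zify.

(** Two solutions u and v along the same driving path are compared in the
    weighted distance whose square is the sum of 2^-j (u_j - v_j)^2. With these
    weights the fluxes of the two solutions combine, and the time derivative of
    the squared distance is minus the sum of
    (2^c/2)^j (u_j - v_j)^2 (u_(j+1) + v_(j+1)), up to the flux through the
    last index of a finite truncation. Energy estimates bound the time integral
    of that flux by a multiple of (gamma/2)^n, where gamma = 2^(c/4) < 2, so
    that it disappears in the limit. Hence the distance does not increase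
    ([contraction]), and it decreases strictly unless u and v start from the
    same point ([contraction_strict]). The same estimate with two different
    drivers shows that limits of solutions are solutions ([sol_closed]).

    The state at time 0 of a stationary solution is measurable with respect to
    F 0, hence independent of the increments of W, and the state at time T has
    the same law. So the stationary law is invariant under the random map that
    sends a state to the endpoint of the solution starting there. This map is
    defined on the supports of the two stationary laws: by independence a point
    of the support and a typical driver are simultaneous limits of initial
    states and drivers of sample paths, so that [sol_closed] provides a solution
    ([flow_exists]), and the endpoint lies in the support again.

    Both laws are moved by the same random map, started from the two initial
    states jointly. The mean of a bounded function of the distance does not
    increase; it tends to 0, by strict contraction, because the laws are tight
    and the norm balls are compact for the weighted distance
    ([ball_seq_compact]). The marginals do not change, so the two laws agree on
    bounded Lipschitz functions ([stationary_unique]). These functions determine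
    the law on the Borel sets of the norm, since norm balls are closed for the
    weighted distance and the norm topology of H_+ has a countable base
    ([same_law_lip]). *)

Import Order.TTheory GRing.Theory Num.Theory.
Import numFieldNormedType.Exports.
Local Open Scope classical_set_scope.
Local Open Scope ring_scope.

Set Implicit Arguments.
Unset Strict Implicit.
Unset Printing Implicit Defensive.

(** * Primitives on a compact interval *)

Section Primitive.
Variables (R : realType) (T : R).
Hypothesis T0 : 0 < T.
Implicit Types (x y f g : R -> R) (r s t L : R).

Definition cont f := {within `[0, T], continuous f}.

Lemma contD f g : cont f -> cont g -> cont (fun t => f t + g t).
Proof. by move=> cf cg t; exact: (cvgD (cf t) (cg t)). Qed.

Lemma contM f g : cont f -> cont g -> cont (fun t => f t * g t).
Proof. by move=> cf cg t; exact: (cvgM (cf t) (cg t)). Qed.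

Lemma contN f : cont f -> cont (fun t => - f t).
Proof. by move=> cf t; exact: (cvgN (cf t)). Qed.

Lemma cont_cst a : cont (fun=> a).
Proof. by move=> t; exact: cvg_cst. Qed.

Lemma contZ a f : cont f -> cont (fun t => a * f t).
Proof. by move=> cf; apply: contM => //; exact: cont_cst. Qed.

Lemma contB f g : cont f -> cont g -> cont (fun t => f t - g t).
Proof. by move=> cf cg; apply: contD => //; exact: contN. Qed.

Lemma contX f n : cont f -> cont (fun t => f t ^+ n).
Proof.
move=> cf; elim: n => [|n IH]; first exact: cont_cst.
under eq_fun do rewrite exprS; exact: contM.
Qed.

Lemma cont_sum n (F : nat -> R -> R) :
  (forall i, cont (F i)) -> cont (fun t => \sum_(i < n) F i t).
Proof.
move=> cF; elim: n => [|n IH].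
  under eq_fun do rewrite big_ord0; exact: cont_cst.
under eq_fun do rewrite big_ord_recr/=; exact: contD.
Qed.

Lemma in0T t : (t \in `[0, T]) = (0 <= t <= T).
Proof. by rewrite in_itv. Qed.

Lemma mem0 : 0 \in `[0, T].
Proof. by rewrite in0T lexx ltW. Qed.

Lemma memT : T \in `[0, T].
Proof. by rewrite in0T lexx ltW. Qed.

Lemma cont_bounded f : cont f ->
  exists2 M : R, 0 <= M & forall t : R, t \in `[0, T] -> `|f t| <= M.
Proof.
move=> cf.
have [c1 c1T H1] := EVT_max (ltW T0) cf.
have [c2 c2T H2] := EVT_min (ltW T0) cf.
exists (`|f c1| + `|f c2|); first by rewrite addr_ge0.
move=> t tT; rewrite ler_norml; apply/andP; split.
  apply: le_trans (H2 t tT); rewrite lerNl.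
  by apply: le_trans (ler_norm _) _; rewrite normrN lerDr.
by apply: le_trans (H1 t tT) _; apply: le_trans (ler_norm _) _; rewrite lerDl.
Qed.

Lemma cont_continuous_at f t : t \in `]0, T[ -> cont f -> {for t, continuous f}.
Proof.
move=> tT /(continuous_within_itvP _ T0)[+ _ _]; exact.
Qed.

Lemma cont_integrable f t : t \in `[0, T] -> cont f ->
  lebesgue_measure.-integrable `[0, t] (EFin \o f).
Proof.
rewrite in0T => /andP[t0 tT] cf.
apply: continuous_compact_integrable; first exact: segment_compact.
by apply: continuous_subspaceW cf; apply: subset_itvl; rewrite bnd_simp.
Qed.

(** Time integrals are estimated by comparing primitives; this asks for
    derivatives in the open interval only. *)
Record prim x f : Prop := Prim {
  prim_cont : cont x;
  prim_contd : cont f;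
  prim_derive : forall t : R, t \in `]0, T[ -> is_derive t 1 x (f t) }.

(** The integral form of an equation gives its differential form. *)
Lemma prim_int x f : cont x -> cont f ->
  (forall t : R, t \in `[0, T] ->
     x t = x 0 + \int[lebesgue_measure]_(s in `[0, t]) f s) -> prim x f.
Proof.
move=> cx cf H; split=> // t tT.
have [t0 t1] : 0 < t /\ t < T by move: tT; rewrite in_itv/= => /andP[].
have [/= d0 state_dist] := @continuous_FTC1_closed R f 0 t T t1
  (cont_integrable memT cf) t0 (cont_continuous_at tT cf).
set F := (F in derivable F _ _) in d0 state_dist.
have dF : is_derive t 1 (fun s => x 0 + F s) (f t).
  have : is_derive t 1 F (f t).
    by apply: (DeriveDef d0); rewrite derive1E in state_dist; exact: state_dist.
  move=> hF; have := is_deriveD (is_derive_cst (x 0) t 1) hF.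
  by rewrite add0r.
apply: near_eq_is_derive dF.
near=> s; apply/esym/H; rewrite in0T.
have : s \in `]0, T[ by near: s; exact: near_in_itvoo.
by rewrite in_itv/= => /andP[/ltW-> /ltW->].
Unshelve. all: by end_near. Qed.

Lemma prim_sub x f t : t \in `[0, T] -> 0 < t ->
  prim x f -> derivable_oo_LRcontinuous x 0 t.
Proof.
rewrite in0T => /andP[t0 tT] t0' [cx _ dx].
have : {within `[0, t], continuous x}.
  by apply: continuous_subspaceW cx; apply: subset_itvl; rewrite bnd_simp.
move=> /(continuous_within_itvP _ t0')[_ c1 c2]; split=> // s st.
have [|//] := dx s; move: st; rewrite !in_itv/= => /andP[->/=].
by move/lt_le_trans; apply.
Qed.

Lemma int_prim x f t : prim x f -> t \in `[0, T] ->
  x t = x 0 + \int[lebesgue_measure]_(s in `[0, t]) f s.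
Proof.
move=> p tT; have [cx cf dx] := p.
have := tT; rewrite in0T => /andP[t0 t1].
have [t00|t0'] := eqVneq t 0; first by rewrite t00 set_itv1 Rintegral_set1 addr0.
have {}t0' : 0 < t by rewrite lt0r t0' t0.
rewrite /Rintegral (@continuous_FTC2 _ f x) //=.
- by rewrite addrCA subrr addr0.
- by apply: continuous_subspaceW cf; apply: subset_itvl; rewrite bnd_simp.
- exact: (prim_sub tT t0' p).
- move=> s st; rewrite derive1E; have [|_ ->//] := dx s.
  move: st; rewrite !in_itv/= => /andP[->/=].
  by move/lt_le_trans; apply.
Qed.

Lemma prim_cst a : prim (fun=> a) (fun=> 0).
Proof.
by split; [exact: cont_cst|exact: cont_cst|move=> t _; exact: is_derive_cst].
Qed.

Lemma primD x y f g : prim x f -> prim y g ->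
  prim (fun t => x t + y t) (fun t => f t + g t).
Proof.
move=> [cx cf dx] [cy cg dy]; split; [exact: contD|exact: contD|].
by move=> t tT; have := is_deriveD (dx t tT) (dy t tT).
Qed.

Lemma primM x y f g : prim x f -> prim y g ->
  prim (fun t => x t * y t) (fun t => f t * y t + x t * g t).
Proof.
move=> [cx cf dx] [cy cg dy]; split; first exact: contM.
  by apply: contD; exact: contM.
move=> t tT; have := is_deriveM (dx t tT) (dy t tT).
by move/is_derive_eq; apply; rewrite /GRing.scale/= addrC [f t * _]mulrC.
Qed.

Lemma prim_ext x y f g : prim x f -> (forall t, x t = y t) ->
  (forall t, f t = g t) -> prim y g.
Proof. by move=> h /funext <- /funext <-. Qed.

Lemma primZ a x f : prim x f -> prim (fun t => a * x t) (fun t => a * f t).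
Proof.
move=> px; apply: prim_ext (primM (prim_cst a) px) _ _ => t //.
by rewrite mul0r add0r.
Qed.

Lemma primB x y f g : prim x f -> prim y g ->
  prim (fun t => x t - y t) (fun t => f t - g t).
Proof.
move=> px py; apply: prim_ext (primD px (primZ (-1) py)) _ _ => t;
  by rewrite mulN1r.
Qed.

Lemma prim_sqr x f : prim x f ->
  prim (fun t => x t ^+ 2) (fun t => 2 * x t * f t).
Proof. by move=> px; apply: prim_ext (primM px px) _ _ => t; ring. Qed.

Lemma prim_sum n (x f : nat -> R -> R) : (forall i, prim (x i) (f i)) ->
  prim (fun t => \sum_(i < n) x i t) (fun t => \sum_(i < n) f i t).
Proof.
move=> px; elim: n => [|n IH].
  by apply: prim_ext (prim_cst 0) _ _ => t; rewrite big_ord0.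
by apply: prim_ext (primD IH (px n)) _ _ => t; rewrite big_ord_recr.
Qed.

Lemma prim_id : prim id (fun=> 1).
Proof.
split; [apply: continuous_subspaceT => t; exact: cvg_id|exact: cont_cst|].
by move=> t _; exact: is_derive_id.
Qed.

Lemma prim_mono x f s t : prim x f ->
  (forall r : R, r \in `]0, T[ -> 0 <= f r) ->
  s \in `[0, T] -> t \in `[0, T] -> s <= t -> x s <= x t.
Proof.
move=> [cx cf dx] f0; apply: (ger0_derive1_le_cc _ _ cx) => r rT.
  by have [] := dx r rT.
by rewrite derive1E; have [_ ->] := dx r rT; exact: f0.
Qed.

Lemma oo_cc r : r \in `]0, T[ -> r \in `[0, T].
Proof. by rewrite !in_itv/= => /andP[/ltW-> /ltW->]. Qed.

Lemma prim_le x y f g t : prim x f -> prim y g ->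
  (forall r : R, r \in `[0, T] -> f r <= g r) ->
  t \in `[0, T] -> x t - x 0 <= y t - y 0.
Proof.
move=> px py fg tT.
have : y 0 - x 0 <= y t - x t.
  apply: (prim_mono (primB py px)) => //; last first.
  - by move: tT; rewrite in0T => /andP[].
  - exact: mem0.
  by move=> r /oo_cc rT; rewrite subr_ge0 fg.
by rewrite !lerBlDr => h; rewrite -addrA (addrC _ (x 0)); lra.
Qed.

Lemma prim_exists f : cont f -> exists2 x, prim x f & x 0 = 0.
Proof.
move=> cf; exists (fun t => \int[lebesgue_measure]_(s in `[0, t]) f s); last first.
  by rewrite set_itv1 Rintegral_set1.
apply: prim_int => //.
  exact: (parameterized_integral_continuous (ltW T0) (cont_integrable memT cf)).
by move=> t _; rewrite set_itv1 Rintegral_set1 add0r.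
Qed.

Lemma cont_le_closed y L : cont y -> (forall t : R, t \in `]0, T[ -> y t <= L) ->
  forall t : R, t \in `[0, T] -> y t <= L.
Proof.
move=> /(continuous_within_itvP _ T0)[_ c0 c1] yL t.
rewrite in0T => /andP[]; rewrite le_eqVlt => /predU1P[<- _|t0].
  apply: (cvgr_to_le c0).
  near=> s; apply: yL; rewrite in_itv/=; apply/andP; split.
    by near: s; exact: nbhs_right_gt.
  by near: s; exact: nbhs_right_lt.
rewrite le_eqVlt => /predU1P[->|tT]; last by apply: yL; rewrite in_itv/= t0.
apply: (cvgr_to_le c1).
near=> s; apply: yL; rewrite in_itv/=; apply/andP; split.
  by near: s; exact: nbhs_left_gt.
by near: s; exact: nbhs_left_lt.
Unshelve. all: by end_near. Qed.

(** Otherwise (y - L) (T - t) has a positive maximum at some interior c, and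
    there g c = (y c - L) / (T - c) > 0 although L < y c. *)
Lemma barrier y g L : prim y g -> y 0 <= L ->
  (forall t : R, t \in `]0, T[ -> L < y t -> g t <= 0) ->
  forall t : R, t \in `[0, T] -> y t <= L.
Proof.
move=> py y0 hg; apply: cont_le_closed; first by case: py.
move=> t tT; rewrite leNgt; apply/negP => Lt.
pose q s := (y s - L) * (T - s).
have pq : prim q (fun s => g s * (T - s) + (y s - L) * -1).
  apply: prim_ext (primM (primB py (prim_cst L)) (primB (prim_cst T) prim_id)) _ _.
    by [].
  by move=> s; rewrite subr0 sub0r.
have [c cT cmax] := EVT_max (ltW T0) (prim_cont pq).
have qc : 0 < q c.
  apply: lt_le_trans (cmax t (oo_cc tT)); rewrite mulr_gt0 ?subr_gt0//.
  by move: tT; rewrite in_itv/= => /andP[].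
have cT' : c \in `]0, T[.
  move: cT; rewrite in0T in_itv/= => /andP[c0 c1]; apply/andP; split.
    rewrite lt0r c0 andbT; apply/eqP => c00.
    move: qc; rewrite /q c00 subr0 ltNge => /negP; apply.
    by rewrite mulr_le0_ge0 ?subr_le0// ltW.
  rewrite lt_neqAle c1 andbT; apply/eqP => c00.
  by move: qc; rewrite /q c00 subrr mulr0 ltxx.
have [cc0 ccT] : 0 < c /\ c < T by move: cT'; rewrite in_itv/= => /andP[].
have yc : L < y c by move: qc; rewrite /q pmulr_lgt0 ?subr_gt0.
have d0 : is_derive c 1 q 0.
  apply: (@derive1_at_max _ _ 0 T); [exact: ltW| |exact: cT'|].
    by move=> s sT; have [] := prim_derive pq sT.
  by move=> s /oo_cc; exact: cmax.
have [_ e1] := prim_derive pq cT'; have [_ e2] := d0.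
move: e1; rewrite e2 => /esym/eqP; rewrite mulrN1 subr_eq0 => /eqP e.
have : g c * (T - c) <= 0 by rewrite mulr_le0_ge0 ?subr_ge0 ?hg// ltW.
by rewrite e leNgt subr_gt0 yc.
Qed.

End Primitive.

(** * Solutions along one path: energy estimates *)

Section Dyadic.
Variables (R : realType) (T sigma gamma : R).
Hypothesis T0 : 0 < T.
Hypothesis gamma1 : 1 <= gamma.
Notation beta := (gamma ^+ 4).
Implicit Types (w : R -> R) (u v : R -> nat -> R) (x y : nat -> R) (r t A B C M delta : R).

Definition square_summable x := exists C, forall n, \sum_(j < n) x j ^+ 2 <= C.

(** The system for 2^c = gamma^4: the rates in the estimates are powers of
    gamma. The equation of index 0 is stated for u_0 - sigma w, which is
    differentiable although w is not. *)
Record sol w u : Prop := Sol {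
  sol_cont : forall j, cont T (u^~ j);
  sol_ge0 : forall t j, t \in `[0, T] -> 0 <= u t j.+1;
  sol_prim0 : prim T (fun t => u t 0%N - sigma * w t)
    (fun t => - (u t 1%N * u t 0%N));
  sol_primS : forall j, prim T (u^~ j.+1)
    (fun t => - beta ^+ j.+1 * u t j.+1 * u t j.+2 + beta ^+ j * u t j ^+ 2);
  sol_init : square_summable (u 0) }.

Arguments sol_cont {w u} s j.
Arguments sol_ge0 {w u} s [t] j.
Arguments sol_primS {w u} s j.

Let gamma_gt0 : 0 < gamma. Proof. exact: lt_le_trans gamma1. Qed.
Let beta_ge0 n : 0 <= beta ^+ n. Proof. by rewrite !exprn_ge0// ltW. Qed.

(** The derivative - u_1 u_0 of u_0 - sigma w has the sign opposite to u_0, so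
    this difference cannot leave the range allowed by its initial value and by
    the size of the noise. *)
Lemma sol_bound0 w u M0 M : sol w u -> `|u 0 0%N| <= M0 -> 
  (forall t, t \in `[0, T] -> `|sigma * w t| <= M) ->
  forall t, t \in `[0, T] -> `|u t 0%N| <= M0 + M + M.
Proof.
move=> s u0 wM t tT.
have M_ge0 : 0 <= M by apply: le_trans (wM 0 (mem0 T0)).
have := u0; have := wM 0 (mem0 T0); rewrite !ler_norml => /andP[w1 w2] /andP[u1 u2].
have H1 : u t 0%N - sigma * w t <= M0 + M.
  apply: (barrier T0 (sol_prim0 s)) tT; first by lra.
  move=> r rT h; have := wM r (oo_cc rT); rewrite ler_norml => /andP[w3 w4].
  by rewrite oppr_le0 mulr_ge0 ?(sol_ge0 s)// ?(oo_cc rT)//; lra.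
have H2 : 0 - (u t 0%N - sigma * w t) <= M0 + M.
  apply: (barrier T0 (primB (prim_cst T 0) (sol_prim0 s))) tT; first by lra.
  move=> r rT h; have := wM r (oo_cc rT); rewrite ler_norml => /andP[w3 w4].
  by rewrite sub0r opprK mulr_ge0_le0 ?(sol_ge0 s)// ?(oo_cc rT)//; lra.
have := wM t tT; rewrite ler_norml => /andP[w3 w4].
by apply/andP; split; lra.
Qed.

(** The flux out of index 1 only decreases u_1, and the flux into it is u_0^2. *)
Lemma sol_bound1 w u B : sol w u ->
  (forall t, t \in `[0, T] -> `|u t 0%N| <= B) ->
  forall t, t \in `[0, T] -> u t 1%N <= u 0 1%N + B ^+ 2 * T.
Proof.
move=> s uB t tT.
have := prim_le T0 (sol_primS s 0) (primZ (B ^+ 2) (prim_id T)) _ tT.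
rewrite /= mulr0 subr0 lerBlDl => h; apply: le_trans (h _) _; last first.
  by rewrite lerD2l ler_wpM2l ?sqr_ge0//; move: tT; rewrite in0T => /andP[].
move=> r rT; rewrite mulr1 expr0 mul1r expr1 -[leRHS]add0r lerD//.
  by rewrite !mulNr oppr_le0 !mulr_ge0 ?(sol_ge0 s)// ?exprn_ge0// ltW.
by rewrite -real_normK ?num_real// ler_pXn2r ?nnegrE// ?uB// (le_trans _ (uB r rT)).
Qed.

Lemma flux_ge0 w u n t : sol w u -> t \in `[0, T] ->
  0 <= beta ^+ n * u t n ^+ 2 * u t n.+1.
Proof.
move=> s tT; apply: mulr_ge0; last exact: (sol_ge0 s n tT).
by apply: mulr_ge0; [exact: beta_ge0|exact: sqr_ge0].
Qed.

(** The exchanges between the indices 1, ..., n cancel in pairs; the flux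
    into index 1 and the flux out of index n remain. *)
Lemma energy_prim w u n : sol w u ->
  prim T (fun t => \sum_(j < n) u t j.+1 ^+ 2)
    (fun t => 2 * u t 0%N ^+ 2 * u t 1%N
              - 2 * beta ^+ n * u t n ^+ 2 * u t n.+1).
Proof.
move=> s; apply: prim_ext (prim_sum n (fun j => prim_sqr (sol_primS s j))) _ _ => // t.
elim: n => [|n IH]; first by rewrite big_ord0 expr0; ring.
by rewrite big_ord_recr/= IH exprS; ring.
Qed.

Lemma square_summable_bound x : square_summable x ->
  exists2 C : R, 0 <= C & forall n, \sum_(j < n) x j ^+ 2 <= C.
Proof.
by move=> [C HC]; exists C => //; have := HC 0%N; rewrite big_ord0.
Qed.

(** The balance of [energy_prim], integrated in time, bounds the norm and the
    total flux out of n by a constant independent of n. *)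
Lemma sol_energy w u : sol w u -> exists2 C : R, 0 <= C &
  (forall t n, t \in `[0, T] -> \sum_(j < n) u t j ^+ 2 <= C) /\
  (forall t n I, t \in `[0, T] ->
     prim T I (fun t => beta ^+ n * u t n ^+ 2 * u t n.+1) -> I t - I 0 <= C).
Proof.
move=> s.
have [B0 B0_ge0 HB0] := cont_bounded T0 (sol_cont s 0).
have [B1 B1_ge0 HB1] := cont_bounded T0 (sol_cont s 1).
have [C0 C0_ge0 HC0] := square_summable_bound (sol_init s).
set A := B0 ^+ 2 * B1.
have A_ge0 : 0 <= A by rewrite mulr_ge0// exprn_ge0.
have HA r : r \in `[0, T] -> u r 0%N ^+ 2 * u r 1%N <= A.
  move=> rT; apply: ler_pM; rewrite ?sqr_ge0 ?(sol_ge0 s)//; last first.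
    by apply: le_trans (HB1 r rT); exact: ler_norm.
  rewrite -real_normK ?num_real// ler_pXn2r ?nnegrE// ?HB0//.
have pI n : exists2 I, prim T I (fun t => beta ^+ n * u t n ^+ 2 * u t n.+1) & I 0 = 0.
  apply: prim_exists => //; apply: contM (sol_cont s n.+1); apply: contZ.
  by apply: contX; exact: (sol_cont s n).
have H t n I : t \in `[0, T] -> 
    prim T I (fun t => beta ^+ n * u t n ^+ 2 * u t n.+1) ->
    \sum_(j < n) u t j.+1 ^+ 2 + 2 * (I t - I 0) <= C0 + 2 * A * T.
  move=> tT pIn.
  have := prim_le T0 (primD (energy_prim n s) (primZ 2 pIn))
    (primZ (2 * A) (prim_id T)) _ tT.
  rewrite mulr0 subr0 => h.
  have {}h : \sum_(j < n) u t j.+1 ^+ 2 + 2 * I t -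
      (\sum_(j < n) u 0 j.+1 ^+ 2 + 2 * I 0) <= 2 * A * t.
    apply: h => r /HA h; rewrite mulr1 addrAC.
    by rewrite -[leLHS]opprK; lra.
  have h1 : \sum_(j < n) u 0 j.+1 ^+ 2 <= C0.
    by apply: le_trans (HC0 n.+1); rewrite big_ord_recl lerDr sqr_ge0.
  have h2 : A * t <= A * T by rewrite ler_wpM2l//; move: tT; rewrite in0T => /andP[].
  by move: h h1 h2; lra.
have AT_ge0 : 0 <= A * T by rewrite mulr_ge0// ltW.
exists (B0 ^+ 2 + C0 + 2 * A * T).
  by rewrite -mulrA addr_ge0 ?addr_ge0 ?sqr_ge0 ?mulr_ge0// ltW.
have pos (t : R) n : t \in `[0, T] -> 0 <= \sum_(j < n) u t j.+1 ^+ 2.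
  by move=> _; apply: sumr_ge0 => j _; exact: sqr_ge0.
split=> [t [|n]|t n I] tT.
- by rewrite big_ord0 -mulrA addr_ge0 ?addr_ge0 ?sqr_ge0 ?mulr_ge0// ltW.
- have [I pIn I0] := pI n; have := H t n I tT pIn; rewrite I0 subr0.
  have It : 0 <= I t.
    rewrite -I0; apply: (prim_mono pIn) => //; last 2 first.
    - exact: mem0.
    - by move: tT; rewrite in0T => /andP[].
    by move=> r /oo_cc; exact: flux_ge0 s.
  rewrite big_ord_recl/= => h.
  have : u t 0%N ^+ 2 <= B0 ^+ 2.
    by rewrite -real_normK ?num_real// ler_pXn2r ?nnegrE// ?HB0.
  by move: h It; rewrite -!mulrA; lra.
- move=> pIn; have := H t n I tT pIn; have := pos t n tT.
  by have := sqr_ge0 B0; move: AT_ge0 C0_ge0; rewrite -!mulrA; lra.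
Qed.

Lemma le1D_of_sqr (a C : R) : a ^+ 2 <= C -> a <= 1 + C.
Proof. by move=> aC; have := sqr_ge0 (a - 2^-1); move: aC; lra. Qed.

Lemma sqr_le_sum x n C : (forall n, \sum_(j < n) x j ^+ 2 <= C) -> x n ^+ 2 <= C.
Proof.
move=> /(_ n.+1); apply: le_trans; rewrite big_ord_recr/= lerDr.
by apply: sumr_ge0 => j _; exact: sqr_ge0.
Qed.

Lemma eqW (a b : R) : a = b -> a <= b. Proof. by move=> ->. Qed.

Lemma amgm (a b l : R) : 0 < l -> a * b <= 2^-1 * (l * a ^+ 2 + l^-1 * b ^+ 2).
Proof.
move=> l0; have l00 : l != 0 by rewrite gt_eqF.
have : 0 <= l^-1 * (l * a - b) ^+ 2 by rewrite mulr_ge0 ?sqr_ge0// invr_ge0 ltW.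
have -> : l^-1 * (l * a - b) ^+ 2 = l * a ^+ 2 + l^-1 * b ^+ 2 - 2 * (a * b).
  by field.
by lra.
Qed.

(** The integral of beta^n u_n^2 is the growth of u_(n+1) plus the integral of
    beta^(n+1) u_(n+1) u_(n+2). The weight gamma^(2(n+1)) in the AM-GM
    inequality turns the latter into the energy flux out of n + 1, of bounded
    integral, times a factor of order gamma^(2n). *)
Lemma sol_int_sqr w u : sol w u -> exists2 C : R, 0 <= C &
  forall t n J, t \in `[0, T] -> prim T J (fun t => beta ^+ n * u t n ^+ 2) ->
    J t - J 0 <= C * gamma ^+ n ^+ 2.
Proof.
move=> s; have [C C0 [HS HI]] := sol_energy s.
have pI n : exists2 I, prim T I (fun t => beta ^+ n * u t n ^+ 2 * u t n.+1) & I 0 = 0.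
  apply: prim_exists => //; apply: contM (sol_cont s n.+1); apply: contZ.
  by apply: contX; exact: (sol_cont s n).
exists (1 + C + gamma ^+ 2 * (C + (1 + C) * T)).
  by rewrite !(addr_ge0, mulr_ge0)// ?exprn_ge0// ltW.
move=> t n J tT pJ.
have [I pIn I0] := pI n.+1.
pose g2 := gamma ^+ n.+1 ^+ 2.
have g20 : 0 < g2 by rewrite !exprn_gt0.
have hb : beta ^+ n.+1 = g2 * g2.
  by rewrite /g2 -!exprM -exprD; congr (_ ^+ _); lia.
have := prim_le T0 pJ (primD (sol_primS s n) (primZ (2^-1 * g2)
   (primD pIn (primZ (1 + C) (prim_id T))))) _ tT.
rewrite I0 !mulr0 addr0 mulr0 addr0 => h.
have {}h : J t - J 0 <= u t n.+1 + 2^-1 * g2 * (I t + (1 + C) * t) - u 0 n.+1.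
  apply: h => r rT; rewrite mulr1.
  have u1 : 0 <= u r n.+1 by exact: (sol_ge0 s).
  have u2 : 0 <= u r n.+2 by exact: (sol_ge0 s).
  have u2C : u r n.+2 <= 1 + C.
    by apply/le1D_of_sqr/sqr_le_sum => m; exact: HS.
  have := amgm (u r n.+1) 1 g20.
  rewrite mulr1 expr1n mulr1 => h.
  have : beta ^+ n.+1 * u r n.+2 * u r n.+1 <=
     beta ^+ n.+1 * u r n.+2 * (2^-1 * (g2 * u r n.+1 ^+ 2 + g2^-1)).
    by rewrite ler_wpM2l// mulr_ge0.
  have e : beta ^+ n.+1 * u r n.+2 * (2^-1 * (g2 * u r n.+1 ^+ 2 + g2^-1)) =
     2^-1 * g2 * (beta ^+ n.+1 * u r n.+1 ^+ 2 * u r n.+2 + u r n.+2).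
    by rewrite hb; field; rewrite gt_eqF.
  rewrite e => {e}h1.
  have h2 : 2^-1 * g2 * (beta ^+ n.+1 * u r n.+1 ^+ 2 * u r n.+2 + u r n.+2) <=
     2^-1 * g2 * (beta ^+ n.+1 * u r n.+1 ^+ 2 * u r n.+2 + (1 + C)).
    by rewrite ler_wpM2l ?lerD2l// mulr_ge0// ltW.
  by move: h1 h2; rewrite !mulNr (mulrAC _ (u r n.+2) (u r n.+1)); lra.
have [t0 tT'] : 0 <= t /\ t <= T by move: tT; rewrite in0T => /andP[].
have ut : u t n.+1 <= 1 + C.
  by apply/le1D_of_sqr/sqr_le_sum => m; exact: HS.
have u00 : 0 <= u 0 n.+1 by rewrite (sol_ge0 s)// mem0.
have It : I t <= C by have := HI t n.+1 I tT pIn; rewrite I0 subr0.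
have h1 : 2^-1 * g2 * (I t + (1 + C) * t) <= g2 * (C + (1 + C) * T).
  apply: ler_pM.
  - by rewrite mulr_ge0// ltW.
  - rewrite addr_ge0 ?mulr_ge0 ?addr_ge0// -I0.
    apply: (prim_mono pIn) => //; last exact: mem0.
    by move=> r /oo_cc; exact: flux_ge0 s.
  - by move: g20; lra.
  - by rewrite lerD// ler_wpM2l// addr_ge0.
have h2 : g2 = gamma ^+ 2 * gamma ^+ n ^+ 2 by rewrite /g2 (exprS gamma n) exprMn.
have h3 : 1 <= gamma ^+ n ^+ 2 by rewrite !exprn_ege1.
have h4 : 1 + C <= (1 + C) * gamma ^+ n ^+ 2 by rewrite ler_peMr// addr_ge0.
rewrite mulrDl; move: h1; rewrite h2 => h1.
have e : gamma ^+ 2 * gamma ^+ n ^+ 2 * (C + (1 + C) * T) =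
  gamma ^+ 2 * (C + (1 + C) * T) * gamma ^+ n ^+ 2 by ring.
by move: h h1 h4; rewrite e h2; lra.
Qed.

(** The weight gamma^n in the AM-GM inequality balances the energy flux of u
    against the integral of beta^n v_n^2, which is of order gamma^(2n). *)
Lemma sol_boundary w w' u v : sol w u -> sol w' v -> exists2 C : R, 0 <= C &
  forall t n K, t \in `[0, T] ->
    prim T K (fun t => (beta / 2) ^+ n * (u t n * v t n * u t n.+1)) ->
    K t - K 0 <= C * (gamma / 2) ^+ n.
Proof.
move=> su sv.
have [C C0 [HS HI]] := sol_energy su.
have [D D0 HD] := sol_int_sqr sv.
exists (C + (1 + C) * D); first by rewrite !(addr_ge0, mulr_ge0).
move=> t n K tT pK.
have pI : exists2 I, prim T I (fun t => beta ^+ n * u t n ^+ 2 * u t n.+1) & I 0 = 0.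
  apply: prim_exists => //; apply: contM (sol_cont su n.+1); apply: contZ.
  by apply: contX; exact: (sol_cont su n).
have pJ : exists2 J, prim T J (fun t => beta ^+ n * v t n ^+ 2) & J 0 = 0.
  apply: prim_exists => //; apply: contZ.
  by apply: contX; exact: (sol_cont sv n).
have [I {}pI I0] := pI; have [J {}pJ J0] := pJ.
pose g := gamma ^+ n; have g0 : 0 < g by rewrite exprn_gt0.
have := prim_le T0 pK (primZ (2^-1 ^+ n * 2^-1) (primD (primZ g pI) (primZ (g^-1 * (1 + C)) pJ))) _ tT.
rewrite I0 J0 !mulr0 addr0 mulr0 subr0 => h.
have {}h : K t - K 0 <= 2^-1 ^+ n * 2^-1 * (g * I t + g^-1 * (1 + C) * J t).
  apply: h => r rT.
  have u1 : 0 <= u r n.+1 by exact: (sol_ge0 su).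
  have u1C : u r n.+1 <= 1 + C.
    by apply/le1D_of_sqr/sqr_le_sum => m; exact: HS.
  have h1 := ler_wpM2r u1 (amgm (u r n) (v r n) g0).
  have h2 : g^-1 * v r n ^+ 2 * u r n.+1 <= g^-1 * v r n ^+ 2 * (1 + C).
    by rewrite ler_wpM2l// mulr_ge0 ?sqr_ge0// invr_ge0 ltW.
  have h3 : u r n * v r n * u r n.+1 <=
      2^-1 * (g * u r n ^+ 2 * u r n.+1 + g^-1 * v r n ^+ 2 * (1 + C)).
    by move: h1 h2; lra.
  rewrite expr_div_n -exprVn.
  have h4 := ler_wpM2l (beta_ge0 n) h3.
  have h5 : 0 <= 2^-1 ^+ n :> R by rewrite exprn_ge0// invr_ge0.
  apply: le_trans (_ : _ <= 2^-1 ^+ n * (beta ^+ n * (2^-1 *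
      (g * u r n ^+ 2 * u r n.+1 + g^-1 * v r n ^+ 2 * (1 + C))))) _.
    by have := ler_wpM2l h5 h4; apply: le_trans; apply/eqW; ring.
  by apply/eqW; ring.
have It : I t <= C by have := HI t n I tT pI; rewrite I0 subr0.
have Jt : J t <= D * g ^+ 2 by have := HD t n J tT pJ; rewrite J0 subr0.
apply: le_trans h _; rewrite [(gamma / 2) ^+ n](_ : _ = 2^-1 ^+ n * g); last first.
  by rewrite exprMn mulrC.
have h1 : g * I t <= g * C by rewrite ler_wpM2l// ltW.
have h2 : g^-1 * (1 + C) * J t <= g^-1 * (1 + C) * (D * g ^+ 2).
  by rewrite ler_wpM2l// mulr_ge0 ?addr_ge0// invr_ge0 ltW.
have h3 : g^-1 * (1 + C) * (D * g ^+ 2) = (1 + C) * D * g by field; rewrite gt_eqF.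
have h5 : 0 <= 2^-1 ^+ n :> R by rewrite exprn_ge0// invr_ge0.
have h6 : 0 <= (C + (1 + C) * D) * g by rewrite !mulr_ge0 ?addr_ge0 ?mulr_ge0 ?addr_ge0// ltW.
rewrite -mulrA [leRHS](_ : _ = 2^-1 ^+ n * ((C + (1 + C) * D) * g)); last by ring.
by rewrite ler_wpM2l//; move: h1 h2 h6; rewrite h3; lra.
Qed.

End Dyadic.
Arguments sol_cont {R T sigma gamma w u} s j.
Arguments sol_ge0 {R T sigma gamma w u} s [t] j.
Arguments sol_primS {R T sigma gamma w u} s j.

(** * The weighted distance *)

Section Distance.
Variable R : realType.
Implicit Types (x y z : nat -> R) (C : R).

Definition psum x y n : R := \sum_(j < n) 2^-1 ^+ j * (x j - y j) ^+ 2.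
(** On square-summable sequences, the sum of the series. *)
Definition dsq x y : R := sup (range (psum x y)).
(** Weaker than the norm; solutions along a common path contract it, and norm
    balls are compact for it. *)
Definition dist x y : R := Num.sqrt (dsq x y).

Lemma half_ge0 n : 0 <= 2^-1 ^+ n :> R.
Proof. by rewrite exprn_ge0// invr_ge0. Qed.

Lemma half_le1 n : 2^-1 ^+ n <= 1 :> R.
Proof. by rewrite exprn_ile1// invf_le1// ler1n. Qed.

Lemma psum_ge0 x y n : 0 <= psum x y n.
Proof. by apply: sumr_ge0 => j _; rewrite mulr_ge0 ?half_ge0 ?sqr_ge0. Qed.

Lemma psum_homo x y m n : (m <= n)%N -> psum x y m <= psum x y n.
Proof.
move=> /subnKC <-; elim: (n - m)%N => [|k IH]; first by rewrite addn0.
apply: le_trans IH _; rewrite addnS /psum big_ord_recr/= lerDl.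
by rewrite mulr_ge0 ?half_ge0 ?sqr_ge0.
Qed.

Lemma psum_bounded x y : square_summable x -> square_summable y ->
  has_ubound (range (psum x y)).
Proof.
move=> [Cx hx] [Cy hy]; exists (2 * Cx + 2 * Cy) => _ [n _ <-].
apply: le_trans (_ : _ <= 2 * (\sum_(j < n) x j ^+ 2) + 2 * (\sum_(j < n) y j ^+ 2)) _; last first.
  by rewrite lerD// ler_wpM2l.
rewrite !mulr_sumr -big_split/=; apply: ler_sum => j _.
apply: le_trans (_ : _ <= 1 * (x j - y j) ^+ 2) _.
  by rewrite ler_wpM2r ?sqr_ge0// half_le1.
by rewrite mul1r; have := sqr_ge0 (x j + y j); lra.
Qed.

Lemma psum_dsq x y n : square_summable x -> square_summable y ->
  psum x y n <= dsq x y.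
Proof.
move=> sx sy; apply: ub_le_sup; first exact: psum_bounded.
by exists n.
Qed.

Lemma dsq_le x y C : (forall n, psum x y n <= C) -> dsq x y <= C.
Proof.
move=> h; apply: ge_sup; first by exists (psum x y 0), 0%N.
by move=> _ [n _ <-].
Qed.

Lemma dsq_ge0 x y : 0 <= dsq x y.
Proof.
have [h|h] := pselect (has_ubound (range (psum x y))).
  by apply: le_trans (psum_ge0 x y 0) _; apply: ub_le_sup => //; exists 0%N.
by rewrite /dsq sup_out// => -[].
Qed.

Lemma dist_ge0 x y : 0 <= dist x y. Proof. exact: sqrtr_ge0. Qed.

Lemma sqr_dist x y : dist x y ^+ 2 = dsq x y.
Proof. by rewrite sqr_sqrtr ?dsq_ge0. Qed.

Lemma distC x y : dist x y = dist y x.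
Proof.
have e : psum x y = psum y x.
  by apply/funext => n; apply: eq_bigr => j _; rewrite -sqrrN opprB.
by rewrite /dist /dsq e.
Qed.

Lemma distxx x : dist x x = 0.
Proof.
apply/eqP; rewrite -sqrf_eq0 sqr_dist eq_le dsq_ge0 andbT; apply: dsq_le => n.
by rewrite /psum big1// => j _; rewrite subrr expr0n mulr0.
Qed.

Lemma dist_triangle x y z :
  square_summable x -> square_summable y -> square_summable z ->
  dist x z <= dist x y + dist y z.
Proof.
move=> sx sy sz.
suff H (l : R) : 0 < l -> dsq x z <= (1 + l) * dsq x y + (1 + l^-1) * dsq y z.
  set a := dist x y; set b := dist y z.
  have a0 : 0 <= a by exact: dist_ge0.
  have b0 : 0 <= b by exact: dist_ge0.
  rewrite -(ger0_norm (addr_ge0 a0 b0)) -sqrtr_sqr ler_sqrt ?sqr_ge0//.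
  apply/ler_addgt0Pr => e e0.
  (* the optimal weight is b / a, perturbed to avoid a zero denominator *)
  pose s := Num.min 1 (e / (a + b + 2)).
  have ab2 : 0 < a + b + 2 by lra.
  have s0 : 0 < s by rewrite lt_min ltr01 divr_gt0.
  have s1 : s <= 1 by rewrite ge_min lexx.
  have s2 : s * (a + b + 2) <= e.
    by rewrite -ler_pdivlMr// /s ge_min lexx orbT.
  have as0 : 0 < a + s by lra.
  have bs0 : 0 < b + s by lra.
  have := H ((b + s) / (a + s)) (divr_gt0 bs0 as0).
  rewrite -!sqr_dist -/a -/b => /le_trans; apply.
  have h1 : (b + s) / (a + s) * a ^+ 2 <= (b + s) * a.
    rewrite -mulrA ler_wpM2l ?(ltW bs0)// mulrC ler_pdivrMr// expr2.
    by rewrite ler_wpM2l//; lra.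
  have h2 : ((b + s) / (a + s))^-1 * b ^+ 2 <= (a + s) * b.
    rewrite invf_div -mulrA ler_wpM2l ?(ltW as0)// mulrC ler_pdivrMr// expr2.
    by rewrite ler_wpM2l//; lra.
  by move: h1 h2; nra.
move=> l0; apply: dsq_le => n.
apply: le_trans (_ : _ <= (1 + l) * psum x y n + (1 + l^-1) * psum y z n) _; last first.
  have li : 0 < l^-1 by rewrite invr_gt0.
  by apply: lerD; rewrite ler_wpM2l ?psum_dsq//; lra.
rewrite /psum !mulr_sumr -big_split/=; apply: ler_sum => j _.
rewrite !(mulrCA (1 + _)) -mulrDr ler_wpM2l ?half_ge0//.
have := amgm (x j - y j) (y j - z j) l0; set p := x j - y j; set q := y j - z j.
have -> : x j - z j = p + q by rewrite /p /q; ring.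
by lra.
Qed.

Lemma coord_dist x y j : square_summable x -> square_summable y ->
  (x j - y j) ^+ 2 <= 2 ^+ j * dsq x y.
Proof.
move=> sx sy; have := psum_dsq j.+1 sx sy; rewrite /psum big_ord_recr/= => h.
have : 2^-1 ^+ j * (x j - y j) ^+ 2 <= dsq x y.
  by apply: le_trans h; rewrite lerDr; exact: psum_ge0.
by rewrite exprVn mulrC ler_pdivrMr ?exprn_gt0// mulrC.
Qed.

End Distance.

(** * Contraction of the weighted distance *)

Section Stability.
Variables (R : realType) (T sigma gamma : R).
Hypothesis T0 : 0 < T.
Hypothesis gamma1 : 1 <= gamma.
Hypothesis gamma2 : gamma < 2.
Notation beta := (gamma ^+ 4).
Notation sol := (sol T sigma gamma).
Implicit Types (w : R -> R) (u v : R -> nat -> R) (x y : nat -> R) (r t A B C M e delta : R).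

(** Without the difference of the noises every component is differentiable,
    also when the two drivers are different. *)
Definition noiseless_diff w w' u v t j : R :=
  u t j - v t j - (if j is 0 then sigma * w t - sigma * w' t else 0).

Definition Lyapunov w w' u v n t : R :=
  \sum_(j < n.+1) 2^-1 ^+ j * noiseless_diff w w' u v t j ^+ 2.

Definition dissipation u v m t : R :=
  \sum_(j < m) (beta / 2) ^+ j * (u t j - v t j) ^+ 2 * (u t j.+1 + v t j.+1).

Definition noiseless_diff' u v t j : R :=
  if j is i.+1 then
    (- beta ^+ i.+1 * u t i.+1 * u t i.+2 + beta ^+ i * u t i ^+ 2) -
    (- beta ^+ i.+1 * v t i.+1 * v t i.+2 + beta ^+ i * v t i ^+ 2)
  else - (u t 1%N * u t 0%N) - - (v t 1%N * v t 0%N).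

Lemma noiseless_diff_prim w w' u v j : sol w u -> sol w' v ->
  prim T (fun t => noiseless_diff w w' u v t j) (fun t => noiseless_diff' u v t j).
Proof.
move=> su sv; case: j => [|j].
  by apply: prim_ext (primB (sol_prim0 su) (sol_prim0 sv)) _ _ => t //; rewrite /noiseless_diff; ring.
apply: prim_ext (primB (sol_primS su j) (sol_primS sv j)) _ _ => t //.
by rewrite /noiseless_diff subr0.
Qed.

(** The reason for the weights 2^-j. Write z = u - v. The flux from j to j + 1
    contributes - 2 (beta/2)^j z_j (u_j u_(j+1) - v_j v_(j+1)) through index j
    and (beta/2)^j z_j z_(j+1) (u_j + v_j) through index j + 1. Since
    2 (u_j u_(j+1) - v_j v_(j+1)) = z_j (u_(j+1) + v_(j+1)) + z_(j+1) (u_j + v_j),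
    the sum is - (beta/2)^j z_j^2 (u_(j+1) + v_(j+1)), one term of the
    dissipation. The flux out of the last index n has no partner. *)
Lemma Lyapunov_prim w w' u v n : sol w u -> sol w' v ->
  prim T (Lyapunov w w' u v n) (fun t =>
    2 * (sigma * w t - sigma * w' t) * (u t 0%N * u t 1%N - v t 0%N * v t 1%N)
    - dissipation u v n t
    - 2 * (beta / 2) ^+ n * (u t n - v t n) * (u t n * u t n.+1 - v t n * v t n.+1)).
Proof.
move=> su sv; apply: prim_ext (prim_sum n.+1 (fun j =>
  primZ (2^-1 ^+ j) (prim_sqr (noiseless_diff_prim j su sv)))) _ _ => // t.
elim: n => [|n IH].
  by rewrite big_ord_recr big_ord0 /dissipation big_ord0/= /noiseless_diff !expr0; ring.
rewrite big_ord_recr/= {}IH /dissipation big_ord_recr/= /noiseless_diff subr0.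
move: (gamma ^+ 4) => b; have e k : (b / 2) ^+ k = b ^+ k * 2^-1 ^+ k by rewrite exprMn.
by rewrite !e !(exprS 2^-1) !(exprS b); field.
Qed.

Lemma dissipation_ge0 w w' u v m t : sol w u -> sol w' v -> t \in `[0, T] ->
  0 <= dissipation u v m t.
Proof.
move=> su sv tT; apply: sumr_ge0 => j _; rewrite mulr_ge0//; last first.
  by rewrite addr_ge0// ?(sol_ge0 su)// (sol_ge0 sv).
rewrite mulr_ge0 ?sqr_ge0// exprn_ge0// divr_ge0// exprn_ge0//.
exact: le_trans gamma1.
Qed.

Lemma dissipation_homo w w' u v m n t : sol w u -> sol w' v -> t \in `[0, T] ->
  (m <= n)%N -> dissipation u v m t <= dissipation u v n t.
Proof.
move=> su sv tT /subnKC <-; elim: (n - m)%N => [|k IH]; first by rewrite addn0.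
apply: le_trans IH _; rewrite addnS /dissipation big_ord_recr/= lerDl mulr_ge0//; last first.
  by rewrite addr_ge0// ?(sol_ge0 su)// (sol_ge0 sv).
rewrite mulr_ge0 ?sqr_ge0// exprn_ge0// divr_ge0// exprn_ge0//.
exact: le_trans gamma1.
Qed.

Lemma dissipation_cont w w' u v m : sol w u -> sol w' v -> cont T (dissipation u v m).
Proof.
move=> su sv; apply: (cont_sum (F := fun j t => (beta / 2) ^+ j *
  (u t j - v t j) ^+ 2 * (u t j.+1 + v t j.+1))) => j.
apply: contM; last by apply: contD; [exact: sol_cont su _|exact: sol_cont sv _].
apply: contZ; apply: contX; apply: contB; [exact: sol_cont su _|exact: sol_cont sv _].
Qed.

(** The unpaired flux at n is at most
    2 (beta/2)^n u_n v_n (u_(n+1) + v_(n+1)), whose integral is controlled by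
    [sol_boundary]. The number delta bounds the work done by the difference of
    the drivers, and G accounts for the dissipation, kept up to a fixed m. *)
Lemma stability w w' u v : sol w u -> sol w' v -> exists2 C : R, 0 <= C &
  forall delta, (forall t, t \in `[0, T] ->
    2 * (sigma * w t - sigma * w' t) * (u t 0%N * u t 1%N - v t 0%N * v t 1%N)
      <= delta) ->
  forall t m n G, t \in `[0, T] -> (m <= n)%N -> (0 < n)%N ->
    prim T G (dissipation u v m) ->
    Lyapunov w w' u v n t + (G t - G 0) <=
      Lyapunov w w' u v n 0 + delta * t + C * (gamma / 2) ^+ n.
Proof.
move=> su sv.
have [C1 C10 H1] := sol_boundary T0 gamma1 su sv.
have [C2 C20 H2] := sol_boundary T0 gamma1 sv su.
exists (2 * (C1 + C2)); first by rewrite mulr_ge0 ?addr_ge0.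
move=> delta hd t m n G tT mn n0 pG.
have pK (a b : R -> nat -> R) q q' : sol q a -> sol q' b -> exists2 K : R -> R,
    prim T K (fun t => (beta / 2) ^+ n * (a t n * b t n * a t n.+1)) & K 0 = 0.
  move=> su' sv'; apply: prim_exists => //; apply: contZ.
  apply: contM; last exact: (sol_cont su' _).
  by apply: contM; [exact: (sol_cont su' _)|exact: (sol_cont sv' _)].
have [K1 pK1 K10] := pK u v w w' su sv.
have [K2 pK2 K20] := pK v u w' w sv su.
have := prim_le T0 (primD (Lyapunov_prim n su sv) pG)
  (primZ 2 (primD (primD pK1 pK2) (primZ (2^-1 * delta) (prim_id T)))) _ tT.
rewrite K10 K20 !(mulr0, addr0) subr0 => h.
have {}h : Lyapunov w w' u v n t + G t - (Lyapunov w w' u v n 0 + G 0) <=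
    2 * (K1 t + K2 t + 2^-1 * delta * t).
  apply: h => r rT; rewrite mulr1.
  have h1 := hd r rT; have h2 := dissipation_homo su sv rT mn.
  have b0 : 0 <= (beta / 2) ^+ n.
    by rewrite exprn_ge0// divr_ge0// exprn_ge0// (le_trans _ gamma1).
  have p1 : 0 <= (beta / 2) ^+ n * (u r n ^+ 2 * u r n.+1).
    apply: mulr_ge0 => //; apply: mulr_ge0; first exact: sqr_ge0.
    exact: (sol_ge0 su n rT).
  have p2 : 0 <= (beta / 2) ^+ n * (v r n ^+ 2 * v r n.+1).
    apply: mulr_ge0 => //; apply: mulr_ge0; first exact: sqr_ge0.
    exact: (sol_ge0 sv n rT).
  by move: h1 h2 p1 p2; lra.
have := H1 t n K1 tT pK1; have := H2 t n K2 tT pK2; rewrite K10 K20 !subr0.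
by move: h; lra.
Qed.

Lemma le_geometric (a b C q : R) N : 0 <= q -> q < 1 ->
  (forall n, (N <= n)%N -> a <= b + C * q ^+ n) -> a <= b.
Proof.
move=> q0 q1 h.
have : (fun n => b + C * q ^+ n) @ \oo --> b + C * 0.
  apply: cvgD; first exact: cvg_cst.
  by apply: cvgMr; apply: cvg_expr; rewrite ger0_norm.
rewrite mulr0 addr0 => /cvgr_to_ge; apply.
by exists N.
Qed.

Let q0 : 0 <= gamma / 2. Proof. by have := gamma1; lra. Qed.
Let q1 : gamma / 2 < 1. Proof. by have := gamma2; lra. Qed.

Lemma sol_square_summable w u t : sol w u -> t \in `[0, T] ->
  square_summable (u t).
Proof.
by move=> s tT; have [C _ [H _]] := sol_energy T0 gamma1 s; exists C => n; exact: H.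
Qed.

Lemma Lyapunov_same w u v n t : Lyapunov w w u v n t = psum (u t) (v t) n.+1.
Proof.
by apply: eq_bigr => -[[|j] ?] _; rewrite /noiseless_diff/= ?subrr subr0.
Qed.

(** Equal drivers do no relative work, and the boundary term vanishes in the
    limit. *)
Lemma contraction_dissipation w u v m G t : sol w u -> sol w v -> t \in `[0, T] ->
  prim T G (dissipation u v m) ->
  dsq (u t) (v t) + (G t - G 0) <= dsq (u 0) (v 0).
Proof.
move=> su sv tT pG; rewrite -lerBrDr.
have [C _ H] := stability su sv.
apply: dsq_le => n; rewrite lerBrDr.
apply: (@le_geometric _ _ C _ (maxn n (maxn m 1)) q0 q1) => k.
rewrite !geq_max => /and3P[nk mk k0].
have := H 0 _ t m k G tT mk k0 pG.
rewrite mul0r addr0 !Lyapunov_same => /(_ _)/le_trans h.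
apply: le_trans (h _ _ _); last 2 first.
- by move=> r rT; rewrite subrr mulr0 mul0r.
- rewrite lerD2r; apply: psum_dsq; apply: sol_square_summable => //; try exact: mem0; eassumption.
by rewrite lerD2r psum_homo// (leq_trans nk).
Qed.

Lemma contraction w u v t : sol w u -> sol w v -> t \in `[0, T] ->
  dsq (u t) (v t) <= dsq (u 0) (v 0).
Proof.
move=> su sv tT; have [G pG G0] := prim_exists T0 (dissipation_cont (m := 0) su sv).
have := contraction_dissipation su sv tT pG; apply: le_trans.
rewrite lerDl subr_ge0; apply: (prim_mono pG) => //; last 2 first.
- exact: mem0.
- by move: tT; rewrite in0T => /andP[].
by move=> r _; rewrite /dissipation big_ord0.
Qed.

Lemma prim_const_eq0 (x f : R -> R) : prim T x f ->
  (forall t, t \in `]0, T[ -> 0 <= f t) -> x T <= x 0 ->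
  forall t, t \in `]0, T[ -> f t = 0.
Proof.
move=> px f0 xT t tT.
have xc s : s \in `[0, T] -> x s = x 0.
  move=> sT; have [s0 s1] : 0 <= s /\ s <= T by move: sT; rewrite in0T => /andP[].
  apply/eqP; rewrite eq_le; apply/andP; split.
    by apply: le_trans xT; apply: (prim_mono px) => //; exact: memT.
  by apply: (prim_mono px) => //; exact: mem0.
have d0 : is_derive t 1 x 0.
  apply: near_eq_is_derive (is_derive_cst (x 0) t 1).
  near=> s; apply/esym/xc/oo_cc.
  by near: s; exact: near_in_itvoo.
by have [_ <-] := prim_derive px tT; have [_ ->] := d0.
Unshelve. all: by end_near. Qed.

(** At t the nonnegative component u_(j+1) has an interior minimum, so its
    derivative there, beta^j u_j^2, is zero. *)
Lemma sol_zero_interior w u j t : sol w u -> t \in `]0, T[ ->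
  u t j.+1 = 0 -> u t j = 0.
Proof.
move=> s tT ut.
have d0 : is_derive t 1 (u^~ j.+1) 0.
  apply: (@derive1_at_min _ _ 0 T); [exact: ltW| |exact: tT|].
    by move=> r rT; have [] := prim_derive (sol_primS s j) rT.
  by move=> r /oo_cc rT; rewrite ut; exact: (sol_ge0 s).
have [_] := prim_derive (sol_primS s j) tT; have [_ ->] := d0.
rewrite ut mulr0 mul0r add0r => /esym/eqP; rewrite mulf_eq0 sqrf_eq0.
by rewrite !expf_eq0/= gt_eqF ?(lt_le_trans _ gamma1)// !andbF => /eqP.
Qed.

(** If the distance did not decrease, all dissipation terms would vanish inside
    ]0, T[. Then u_j = v_j, or else u_(j+1) = v_(j+1) = 0 and both u_j and v_j
    are zero by [sol_zero_interior]. So u = v inside, and at 0 by continuity. *)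
Lemma contraction_strict w u v : sol w u -> sol w v ->
  0 < dsq (u 0) (v 0) -> dsq (u T) (v T) < dsq (u 0) (v 0).
Proof.
move=> su sv; rewrite !ltNge => /negP D0; apply/negP => DT; apply: D0.
have z m t : t \in `]0, T[ -> dissipation u v m t = 0.
  have [G pG G0] := prim_exists T0 (dissipation_cont (m := m) su sv).
  apply: (prim_const_eq0 pG).
    by move=> r /oo_cc; exact: dissipation_ge0 su sv.
  have := contraction_dissipation su sv (memT T0) pG; rewrite -subr_le0.
  by move: DT; lra.
have uv j t : t \in `]0, T[ -> u t j = v t j.
  move=> tT; have := z j.+1 t tT; rewrite /dissipation big_ord_recr/=.
  rewrite -/(dissipation u v j t) z// add0r => /eqP.
  have b0 : (beta / 2) ^+ j != 0.
    by rewrite expf_neq0// mulf_neq0// expf_neq0// gt_eqF// (lt_le_trans _ gamma1).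
  rewrite mulf_eq0 mulf_eq0 (negPf b0)/= sqrf_eq0 subr_eq0 => /orP[/eqP//|].
  rewrite paddr_eq0 ?(sol_ge0 su) ?(sol_ge0 sv) ?oo_cc// => /andP[/eqP u0 /eqP v0].
  by rewrite (sol_zero_interior su tT u0) (sol_zero_interior sv tT v0).
apply: dsq_le => n; rewrite /psum big1// => j _.
suff: (u 0 j - v 0 j) ^+ 2 <= 0.
  move=> h; have : (u 0 j - v 0 j) ^+ 2 == 0 by rewrite eq_le h sqr_ge0.
  by move=> /eqP ->; rewrite mulr0.
apply: (@cont_le_closed _ T T0 (fun t => (u t j - v t j) ^+ 2)); last exact: mem0.
  by apply: contX; apply: contB; [exact: (sol_cont su)|exact: (sol_cont sv)].
by move=> t /uv ->; rewrite subrr expr0n.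
Qed.

End Stability.

(** * Limits of solutions *)

Section UniformLimits.
Variables (R : realType) (T : R).
Hypothesis T0 : 0 < T.
Implicit Types (f g x : R -> R) (F G X : nat -> R -> R) (r t A B C M e delta : R).

Definition ucvg F f := forall e, 0 < e ->
  exists N, forall k, (N <= k)%N -> forall t, t \in `[0, T] -> `|F k t - f t| <= e.

Lemma ucvg_cont F f : (forall k, cont T (F k)) -> ucvg F f -> cont T f.
Proof.
move=> cF Ff; apply/subspace_continuousP => t tT.
apply/cvgrPdist_le => e e0.
have e3 : 0 < e / 3 by rewrite divr_gt0.
have [N HN] := Ff _ e3.
have /subspace_continuousP/(_ t tT)/cvgrPdist_le/(_ _ e3) := cF N.
rewrite !near_withinE; apply: filterS => s h sT.
have h1 := HN N (leqnn N) t tT; have h2 := HN N (leqnn N) s sT.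
have := h sT; move: h1 h2; rewrite /from_subspace/= !ler_norml => /andP[? ?] /andP[? ?] /andP[? ?].
by apply/andP; split; lra.
Qed.

Lemma ucvg_cst f : ucvg (fun=> f) f.
Proof. by move=> e e0; exists 0%N => k _ t _; rewrite subrr normr0 ltW. Qed.

Lemma ucvgD F G f g : ucvg F f -> ucvg G g ->
  ucvg (fun k t => F k t + G k t) (fun t => f t + g t).
Proof.
move=> Ff Gg e e0; have e2 : 0 < e / 2 by rewrite divr_gt0.
have [N HN] := Ff _ e2; have [M HM] := Gg _ e2.
exists (maxn N M) => k; rewrite geq_max => /andP[Nk Mk] t tT.
have := HN k Nk t tT; have := HM k Mk t tT.
rewrite !ler_norml => /andP[? ?] /andP[? ?]; apply/andP; split; lra.
Qed.

Lemma ucvgM F G f g : cont T f -> cont T g -> ucvg F f -> ucvg G g ->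
  ucvg (fun k t => F k t * G k t) (fun t => f t * g t).
Proof.
move=> /(cont_bounded T0)[A A0 HA] /(cont_bounded T0)[B B0 HB] Ff Gg e e0.
pose d := Num.min 1 (e / (A + B + 1)).
have AB : 0 < A + B + 1 by lra.
have d0 : 0 < d by rewrite lt_min ltr01 divr_gt0.
have [N HN] := Ff _ d0; have [M HM] := Gg _ d0.
exists (maxn N M) => k; rewrite geq_max => /andP[Nk Mk] t tT.
have h1 := HN k Nk t tT; have h2 := HM k Mk t tT.
have -> : F k t * G k t - f t * g t =
   (F k t - f t) * (G k t - g t) + f t * (G k t - g t) + (F k t - f t) * g t by ring.
have d1 : d <= 1 by rewrite ge_min lexx.
have de : d * (A + B + 1) <= e by rewrite -ler_pdivlMr// /d ge_min lexx orbT.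
apply: le_trans (ler_normD _ _) _; apply: le_trans (lerD (ler_normD _ _) (lexx _)) _.
rewrite !normrM.
have k1 : `|F k t - f t| * `|G k t - g t| <= d * 1.
  by rewrite ler_pM// (le_trans h2).
have k2 : `|f t| * `|G k t - g t| <= A * d by rewrite ler_pM// HA.
have k3 : `|F k t - f t| * `|g t| <= d * B by rewrite ler_pM// HB.
by move: k1 k2 k3 de; lra.
Qed.

Lemma ucvgZ a F f : cont T f -> ucvg F f ->
  ucvg (fun k t => a * F k t) (fun t => a * f t).
Proof. by move=> cf; apply: ucvgM cf (ucvg_cst _) => //; exact: cont_cst. Qed.

Lemma ucvg_ext F G f g : ucvg F f -> (forall k t, F k t = G k t) ->
  (forall t, f t = g t) -> ucvg G g.
Proof.
by move=> Ff FG fg e /Ff[N HN]; exists N => k Nk t tT; rewrite -FG -fg HN.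
Qed.

Lemma ucvg_pt F f t e : ucvg F f -> t \in `[0, T] -> 0 < e ->
  exists N, forall k, (N <= k)%N -> `|F k t - f t| <= e.
Proof. by move=> Ff tT /Ff[N HN]; exists N => k Nk; exact: HN. Qed.

Lemma prim_ucvg X F x f : (forall k, prim T (X k) (F k)) ->
  ucvg X x -> ucvg F f -> prim T x f.
Proof.
move=> pX Xx Ff.
have cx : cont T x by apply: ucvg_cont Xx => k; case: (pX k).
have cf : cont T f by apply: ucvg_cont Ff => k; case: (pX k).
have [P pP P0] := prim_exists T0 cf.
apply: prim_int => // t tT; have := int_prim pP tT; rewrite P0 add0r => <-.
apply/eqP; rewrite -subr_eq0 -normr_le0; apply/ler_addgt0Pr => e e0; rewrite add0r.
pose d := e / (2 + T); have d0 : 0 < d by rewrite divr_gt0// addr_gt0.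
have [N HN] := Xx _ d0; have [M HM] := Ff _ d0.
pose k := maxn N M.
have h1 := HN k (leq_maxl _ _) t tT; have h2 := HN k (leq_maxl _ _) 0 (mem0 T0).
have h3 := HM k (leq_maxr _ _).
have h4 : X k t - X k 0 <= P t + d * t.
  have := prim_le T0 (pX k) (primD pP (primZ d (prim_id T))) _ tT.
  rewrite P0 mulr0 !addr0 subr0; apply => r rT.
  by have := h3 r rT; rewrite ler_norml mulr1 => /andP[? ?]; lra.
have h5 : P t - d * t <= X k t - X k 0.
  have := prim_le T0 (primB pP (primZ d (prim_id T))) (pX k) _ tT.
  rewrite P0 mulr0 !subr0; apply => r rT.
  by have := h3 r rT; rewrite ler_norml mulr1 => /andP[? ?]; lra.
have h6 : d * t <= d * T.
  by apply: (ler_wpM2l (ltW d0)); move: tT; rewrite in0T => /andP[].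
have h7 : d * (2 + T) <= e by rewrite /d divfK// gt_eqF// addr_gt0.
move: h1 h2; rewrite !ler_norml => /andP[? ?] /andP[? ?].
by apply/andP; split; lra.
Qed.

Lemma ucvg_cauchy F : (forall e, 0 < e -> exists N, forall k l,
    (N <= k)%N -> (N <= l)%N -> forall t, t \in `[0, T] -> `|F k t - F l t| <= e) ->
  exists f, ucvg F f.
Proof.
move=> H; exists (fun t => lim (F^~ t @ \oo)).
have cv t : t \in `[0, T] -> cvg (F^~ t @ \oo).
  move=> tT; apply/cauchy_cvgP/cauchy_ballP => e e0; near_simpl.
  have e2 : 0 < e / 2 by rewrite divr_gt0.
  have [N HN] := H _ e2.
  near=> k l; rewrite /ball/=.
  apply: (le_lt_trans (y := e / 2)); last by lra.
  apply: HN => //; by [near: k; exists N|near: l; exists N].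
move=> e /H[N HN]; exists N => k Nk t tT.
have c2 : (fun l => F k t - F l t) @ \oo --> F k t - lim (F^~ t @ \oo).
  by apply: cvgB; [exact: cvg_cst|exact: cv].
apply: (cvgr_to_le (cvg_norm c2)).
by exists N => // l Nl; exact: HN.
Unshelve. all: by end_near. Qed.

End UniformLimits.

Section Closure.
Variables (R : realType) (T sigma gamma : R).
Hypothesis T0 : 0 < T.
Hypothesis gamma1 : 1 <= gamma.
Hypothesis gamma2 : gamma < 2.
Notation beta := (gamma ^+ 4).
Notation sol := (sol T sigma gamma).
Implicit Types (w : R -> R) (u v : R -> nat -> R) (x y : nat -> R) (r t A B C M e delta : R).

Lemma norm_le_sqr (a e : R) : 0 <= e -> a ^+ 2 <= e ^+ 2 -> `|a| <= e.
Proof. by move=> e0 h; rewrite -(@ler_pXn2r _ 2)// ?nnegrE// real_normK ?num_real. Qed.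

Lemma Lyapunov_init w w' u v n : w 0 = 0 -> w' 0 = 0 ->
  Lyapunov sigma w w' u v n 0 = psum (u 0) (v 0) n.+1.
Proof.
move=> w0 w0'; apply: eq_bigr => -[[|j] ?] _; rewrite /noiseless_diff/= ?w0 ?w0'.
  by rewrite mulr0 subr0 subr0.
by rewrite subr0.
Qed.

(** Continuous dependence on the initial state and on the driver. The term
    4 delta B T bounds the relative work of the drivers, and 2 delta^2 is the
    cost of putting the noise back into the component of index 0. *)
Lemma stability_drivers w w' u v B delta : sol w u -> sol w' v ->
  w 0 = 0 -> w' 0 = 0 ->
  (forall t, t \in `[0, T] -> `|u t 0%N * u t 1%N| <= B) ->
  (forall t, t \in `[0, T] -> `|v t 0%N * v t 1%N| <= B) ->
  (forall t, t \in `[0, T] -> `|sigma * w t - sigma * w' t| <= delta) ->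
  forall t, t \in `[0, T] ->
    dsq (u t) (v t) <= 2 * (dsq (u 0) (v 0) + 4 * delta * B * T) + 2 * delta ^+ 2.
Proof.
move=> su sv w0 w0' uB vB hd t tT.
have [C _ H] := stability T0 gamma1 su sv.
have d0 : 0 <= delta by apply: le_trans (hd t tT).
have B0 : 0 <= B by apply: le_trans (uB t tT).
have {}H := H (4 * delta * B) _.
have {}H : forall n, (0 < n)%N -> Lyapunov sigma w w' u v n t <=
    dsq (u 0) (v 0) + 4 * delta * B * t + C * (gamma / 2) ^+ n.
  move=> n n0; have [G pG G0] := prim_exists T0 (dissipation_cont (m := 0) su sv).
  have := H _ t 0%N n G tT (leq0n n) n0 pG.
  have -> : G t = G 0.
    apply/eqP; rewrite eq_le -subr_le0.
    have := prim_le T0 pG (prim_cst T 0) _ tT; rewrite subrr => ->/=; last first.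
      by move=> r _; rewrite /dissipation big_ord0.
    have := prim_le T0 (prim_cst T 0) pG _ tT; rewrite subrr subr_ge0; apply.
    by move=> r _; rewrite /dissipation big_ord0.
  rewrite subrr addr0 Lyapunov_init// => h; apply: le_trans (h _) _; last first.
    by rewrite !lerD2r; exact: (psum_dsq _ (sol_init su) (sol_init sv)).
  move=> r rT; apply: le_trans (ler_norm _) _; rewrite !normrM ger0_norm//.
  have h1 := hd r rT; have h2 := uB r rT; have h3 := vB r rT.
  have h4 : `|u r 0%N * u r 1%N - v r 0%N * v r 1%N| <= B + B.
    by apply: le_trans (ler_normB _ _) _; exact: lerD.
  have := ler_pM (normr_ge0 _) (normr_ge0 _) h1 h4; lra.
have q0 : 0 <= gamma / 2 by move: gamma1; lra.
have q1 : gamma / 2 < 1 by move: gamma2; lra.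
apply: dsq_le => n.
apply: (@le_geometric _ _ _ (2 * C) (gamma / 2) (maxn n 1) q0 q1) => k.
rewrite geq_max => /andP[nk k0].
have := H k k0.
have h1 : psum (u t) (v t) k.+1 <= 2 * Lyapunov sigma w w' u v k t + 2 * delta ^+ 2.
  rewrite /psum /Lyapunov !big_ord_recl/= !expr0 !mul1r.
  set S := (X in _ + X <= _); set S' := (X in _ <= 2 * (_ + X) + _).
  have -> : S' = S by apply: eq_bigr => j _; rewrite /noiseless_diff/= subr0.
  have S0 : 0 <= S by apply: sumr_ge0 => j _; rewrite mulr_ge0 ?half_ge0 ?sqr_ge0.
  have hz : (u t 0%N - v t 0%N) ^+ 2 <=
      2 * noiseless_diff sigma w w' u v t 0 ^+ 2 + 2 * delta ^+ 2.
    have hd2 : (sigma * w t - sigma * w' t) ^+ 2 <= delta ^+ 2.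
      by rewrite -real_normK ?num_real// ler_pXn2r ?nnegrE// hd.
    rewrite /noiseless_diff; set p := u t 0%N - v t 0%N; set q := sigma * w t - sigma * w' t in hd2 *.
    by have := sqr_ge0 (p - q - q); move: hd2; lra.
  by move: hz S0; lra.
have h2 : psum (u t) (v t) n <= psum (u t) (v t) k.+1 by rewrite psum_homo// leqW.
have h3 : delta * B * t <= delta * B * T.
  by rewrite ler_wpM2l ?mulr_ge0//; move: tT; rewrite in0T => /andP[].
by move: h1 h2 h3; lra.
Qed.

(** By [stability_drivers] the sequence U is uniformly Cauchy in the weighted
    distance, so that its components converge uniformly and the equations pass
    to the limit. *)
Lemma sol_closed (w : R -> R) (x : nat -> R) (W : nat -> R -> R)
    (U : nat -> R -> nat -> R) :
  square_summable x -> cont T w -> w 0 = 0 ->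
  (forall k, sol (W k) (U k)) -> (forall k, W k 0 = 0) ->
  ucvg T W w ->
  (forall e, 0 < e -> exists N, forall k, (N <= k)%N -> dsq (U k 0) x <= e) ->
  exists u, [/\ sol w u, forall j, u 0 j = x j &
    forall e, 0 < e -> exists N, forall k, (N <= k)%N -> dsq (U k T) (u T) <= e].
Proof.
move=> sx cw w0 sU W0 Ww Ux.
have [Mw Mw0 HMw] := cont_bounded T0 cw.
have sW : ucvg T (fun k t => sigma * W k t) (fun t => sigma * w t) by exact: ucvgZ.
have [N1 HN1] := Ww _ ltr01.
have [N2 HN2] := Ux _ ltr01.
pose N0 := maxn N1 N2.
have x0 k j : (N0 <= k)%N -> `|U k 0 j| <= `|x j| + 2 ^+ j.
  rewrite geq_max => /andP[_ /HN2 h].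
  have := coord_dist j (sol_init (sU k)) sx.
  have j1 : 1 <= 2 ^+ j :> R by rewrite exprn_ege1// ler1n.
  have {}h : 2 ^+ j * dsq (U k 0) x <= 2 ^+ j * 1 by rewrite ler_wpM2l// ltW// (lt_le_trans _ j1).
  move=> /le_trans/(_ h); rewrite mulr1 => h1.
  have h2 : `|U k 0 j - x j| <= 2 ^+ j.
    have j0 : 0 <= 2 ^+ j :> R by exact: le_trans j1.
    by apply: norm_le_sqr => //; apply: le_trans h1 _; rewrite expr2 ler_peMl.
  by rewrite -[U k 0 j](subrK (x j)) addrC; apply: le_trans (ler_normD _ _) _; rewrite lerD2l.
pose B0 := (`|x 0%N| + 1) + `|sigma| * (Mw + 1) + `|sigma| * (Mw + 1).
have b0 k t : (N0 <= k)%N -> t \in `[0, T] -> `|U k t 0%N| <= B0.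
  move=> Nk; apply: (sol_bound0 T0 (sU k)); first exact: x0 k 0%N Nk.
  move=> r rT; rewrite normrM ler_wpM2l//.
  have h : `|W k r - w r| <= 1 by apply: HN1 => //; rewrite (leq_trans _ Nk)// leq_maxl.
  rewrite -[W k r](subrK (w r)) addrC; apply: le_trans (ler_normD _ _) _.
  by rewrite lerD// HMw.
have B00 : 0 <= B0 by rewrite !addr_ge0// mulr_ge0// addr_ge0.
pose B1 := `|x 1%N| + 2 + B0 ^+ 2 * T.
have b1 k t : (N0 <= k)%N -> t \in `[0, T] -> `|U k t 1%N| <= B1.
  move=> Nk tT; rewrite ger0_norm ?(sol_ge0 (sU k))//.
  have h := @sol_bound1 _ _ _ _ T0 gamma1 _ _ _ (sU k) (b0 k ^~ Nk) t tT.
  apply: le_trans h _; rewrite lerD2r; apply: le_trans (ler_norm _) _.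
  exact: x0 k 1%N Nk.
pose B := B0 * B1.
have b k t : (N0 <= k)%N -> t \in `[0, T] -> `|U k t 0%N * U k t 1%N| <= B.
  by move=> Nk tT; rewrite normrM ler_pM ?b0 ?b1.
clearbody N0.
have B_ge0 : 0 <= B by apply: le_trans (b N0 0 (leqnn _) (mem0 T0)).
(* A size d of the perturbations for which the bound of [stability_drivers] is
   below e. *)
have small B' e : 0 <= B' -> 0 < e -> exists2 d : R, 0 < d &
    forall a : R, a <= d -> 2 * (a + 4 * d * B' * T) + 2 * d ^+ 2 <= e.
  move=> B'0 e0; pose K := 2 + 8 * (B' * T) + 2.
  have K0 : 0 < K by have := mulr_ge0 B'0 (ltW T0); rewrite /K; lra.
  exists (Num.min 1 (e / K)); first by rewrite lt_min ltr01 divr_gt0.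
  move=> a; set d := Num.min _ _ => ad.
  have d0 : 0 < d by rewrite lt_min ltr01 divr_gt0.
  have d1 : d <= 1 by rewrite ge_min lexx.
  have dist_to : d * K <= e by rewrite -ler_pdivlMr// /d ge_min lexx orbT.
  have h2 : d ^+ 2 <= d by rewrite expr2 -[leRHS]mulr1 ler_pM// ltW.
  by move: h2 ad dist_to; rewrite /K; lra.
have xcauchy e : 0 < e -> exists N, forall k l, (N <= k)%N -> (N <= l)%N ->
    dsq (U k 0) (U l 0) <= e.
  move=> e0; have e4 : 0 < Num.sqrt e / 2 by rewrite divr_gt0// sqrtr_gt0.
  have [N HN] := Ux _ (exprn_gt0 2 e4); exists N => k l Nk Nl.
  have sk := sol_init (sU k); have sl := sol_init (sU l).
  have dk m : (N <= m)%N -> dist (U m 0) x <= Num.sqrt e / 2.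
    move=> /HN h; rewrite -[leRHS]ger0_norm ?(ltW e4)// -sqrtr_sqr ler_sqrt//.
  have := dist_triangle sk sx sl; rewrite (distC x).
  have := dk k Nk; have := dk l Nl => h1 h2 h3.
  rewrite -sqr_dist -[leRHS]sqr_sqrtr ?(ltW e0)// ler_pXn2r ?nnegrE ?sqrtr_ge0//.
  by move: h1 h2 h3; lra.
have wcauchy e : 0 < e -> exists N, forall k l, (N <= k)%N -> (N <= l)%N ->
    forall t, t \in `[0, T] -> `|sigma * W k t - sigma * W l t| <= e.
  move=> e0; have e2 : 0 < e / 2 by rewrite divr_gt0.
  have [N HN] := sW _ e2; exists N => k l Nk Nl t tT.
  rewrite (_ : _ - _ = (sigma * W k t - sigma * w t) - (sigma * W l t - sigma * w t)); last by ring.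
  apply: le_trans (ler_normB _ _) _.
  by have := HN k Nk t tT; have := HN l Nl t tT; lra.
have Ucauchy e : 0 < e -> exists N, forall k l, (N <= k)%N -> (N <= l)%N ->
    forall t, t \in `[0, T] -> dsq (U k t) (U l t) <= e.
  move=> /(small B _ B_ge0)[d d0 Hd].
  have [N HN] := xcauchy _ d0; have [M HM] := wcauchy _ d0.
  exists (maxn N0 (maxn N M)) => k l.
  rewrite !geq_max => /and3P[k1 k2 k3] /and3P[l1 l2 l3] t tT.
  apply: le_trans (Hd _ (HN k l k2 l2)).
  exact: (stability_drivers (sU k) (sU l) (W0 k) (W0 l) (b k ^~ k1) (b l ^~ l1) (HM k l k3 l3) tT).
have Ulim j : exists f, ucvg T (fun k t => U k t j) f.
  apply: ucvg_cauchy => e e0.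
  have d0 : 0 < (2 ^+ j)^-1 * e ^+ 2 by rewrite mulr_gt0 ?exprn_gt0// invr_gt0 exprn_gt0.
  have [N HN] := Ucauchy _ d0; exists N => k l Nk Nl t tT.
  have := coord_dist j (sol_square_summable T0 gamma1 (sU k) tT)
    (sol_square_summable T0 gamma1 (sU l) tT).
  have := HN k l Nk Nl t tT; rewrite ler_pdivlMl ?exprn_gt0// => h1 /le_trans/(_ h1).
  by apply: norm_le_sqr; exact: ltW.
have [f Hf] := choice Ulim.
pose u t j := f j t.
have ucont j : cont T (f j) by apply: ucvg_cont (Hf j) => k; exact: (sol_cont (sU k)).
have ux j : u 0 j = x j.
  apply/eqP; rewrite -subr_eq0 -normr_le0; apply/ler_addgt0Pr => e e0; rewrite add0r.
  have e2 : 0 < e / 2 by rewrite divr_gt0.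
  have d0 : 0 < (2 ^+ j)^-1 * (e / 2) ^+ 2 by rewrite mulr_gt0 ?exprn_gt0// invr_gt0 exprn_gt0.
  have [N HN] := ucvg_pt (Hf j) (mem0 T0) e2.
  have [M HM] := Ux _ d0; pose k := maxn N M.
  have h1 := HN k (leq_maxl _ _).
  have h2 : `|U k 0 j - x j| <= e / 2.
    have := coord_dist j (sol_init (sU k)) sx.
    have := HM k (leq_maxr _ _); rewrite ler_pdivlMl ?exprn_gt0// => h /le_trans/(_ h).
    by apply: norm_le_sqr; exact: ltW.
  rewrite (_ : _ - _ = (U k 0 j - x j) - (U k 0 j - u 0 j)); last by ring.
  by apply: le_trans (ler_normB _ _) _; move: h1 h2; rewrite /u; lra.
have su : sol w u.
  split.
  - exact: ucont.
  - move=> t j tT; rewrite leNgt; apply/negP => h.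
    have e0 : 0 < - u t j.+1 / 2 by lra.
    have [N HN] := ucvg_pt (Hf j.+1) tT e0.
    have := HN N (leqnn N); have := sol_ge0 (sU N) j tT.
    by rewrite ler_norml /u in h e0 * => h1 /andP[h2 h3]; lra.
  - apply: (prim_ucvg T0 (fun k => sol_prim0 (sU k))).
      apply: ucvgD (Hf 0%N) _; apply: ucvg_ext (ucvgZ T0 (-1) _ sW) _ _.
      + by apply: contZ.
      + by move=> k t; rewrite mulN1r.
      + by move=> t; rewrite mulN1r.
    apply: ucvg_ext (ucvgZ T0 (-1) _ (ucvgM T0 _ _ (Hf 1%N) (Hf 0%N))) _ _ => //.
    + by apply: contM.
    + by move=> k t; rewrite mulN1r.
    + by move=> t; rewrite mulN1r.
  - move=> j; apply: (prim_ucvg T0 (fun k => sol_primS (sU k) j) (Hf j.+1)).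
    apply: (@ucvgD _ _ (fun k t => - beta ^+ j.+1 * U k t j.+1 * U k t j.+2)
      (fun k t => beta ^+ j * U k t j ^+ 2)).
      apply: (ucvgM T0 (contZ (ucont j.+1)) (ucont j.+2) _ (Hf j.+2)).
      exact: (ucvgZ T0 (- beta ^+ j.+1) (ucont j.+1) (Hf j.+1)).
    have h : ucvg T (fun k t => U k t j ^+ 2) (fun t => f j t ^+ 2).
      exact: (ucvg_ext (ucvgM T0 (ucont j) (ucont j) (Hf j) (Hf j))).
    have h' : cont T (fun t => f j t ^+ 2) by exact: contX.
    exact: (ucvgZ T0 (beta ^+ j) h' h).
  - have [C HC] := sx; exists C => n; apply: le_trans (HC n).
    by apply: ler_sum => i _; rewrite ux.
exists u; split => // e e0.
have [Bu Bu0 HBu] := cont_bounded T0 (contM (ucont 0%N) (ucont 1%N)).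
have [d d0 Hd] := small (B + Bu) e (addr_ge0 B_ge0 Bu0) e0.
have [N HN] := Ux _ d0; have [M HM] := sW _ d0.
exists (maxn N0 (maxn N M)) => k; rewrite !geq_max => /and3P[k1 k2 k3].
apply: le_trans (Hd _ (HN k k2)).
have <- : u 0 = x by apply/funext.
apply: (stability_drivers (sU k) su (W0 k) w0 _ _ (HM k k3) (memT T0)) => t tT.
  by apply: le_trans (b k t k1 tT) _; rewrite lerDl.
by apply: le_trans (HBu t tT) _; rewrite lerDr.
Qed.

End Closure.

(** * Means of bounded random variables *)

Section Expectation.
Context (R : realType) d (Omega : measurableType d) (P : probability Omega R).
Implicit Types (f g : Omega -> R) (a B : R).

Definition bounded_rv f :=
  measurable_fun setT f /\ exists B, forall w, `|f w| <= B.

Definition mean f : R := \int[P]_w f w.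

Lemma bounded_rv_integrable f : bounded_rv f -> P.-integrable setT (EFin \o f).
Proof.
move=> [mf [B fB]]; apply: measurable_bounded_integrable => //.
  by apply: (le_lt_trans (y := 1%E)); [rewrite -(probability_setT P)|exact: ltry].
exists B; split; first exact: num_real.
by move=> M BM w _; apply: le_trans (fB w) (ltW BM).
Qed.

Lemma bounded_rvD f g : bounded_rv f -> bounded_rv g ->
  bounded_rv (fun w => f w + g w).
Proof.
move=> [mf [B fB]] [mg [C gC]]; split; first exact: measurable_funD.
by exists (B + C) => w; apply: le_trans (ler_normD _ _) (lerD (fB w) (gC w)).
Qed.

Lemma bounded_rvZ a f : bounded_rv f -> bounded_rv (fun w => a * f w).
Proof.
move=> [mf [B fB]]; split; first exact: measurable_funM.
by exists (`|a| * B) => w; rewrite normrM ler_wpM2l.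
Qed.

Lemma meanD f g : bounded_rv f -> bounded_rv g ->
  mean (fun w => f w + g w) = mean f + mean g.
Proof. by move=> bf bg; apply: RintegralD => //; exact: bounded_rv_integrable. Qed.

Lemma meanZ a f : bounded_rv f -> mean (fun w => a * f w) = a * mean f.
Proof. by move=> bf; apply: RintegralZl => //; exact: bounded_rv_integrable. Qed.

Lemma mean_cst a : mean (fun=> a) = a.
Proof. rewrite /mean Rintegral_cst//.
have -> : fine (P setT) = 1 by have := congr1 fine (probability_setT P).
by rewrite mulr1. Qed.

Lemma mean_le f g : bounded_rv f -> bounded_rv g -> (forall w, f w <= g w) ->
  mean f <= mean g.
Proof.
move=> bf bg fg; apply: le_Rintegral => //; exact: bounded_rv_integrable.
Qed.

Lemma bounded_rv_cst a : bounded_rv (fun=> a).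
Proof. by split; [exact: measurable_cst|exists `|a|]. Qed.

Lemma mean_norm f B : bounded_rv f -> (forall w, `|f w| <= B) -> `|mean f| <= B.
Proof.
move=> bf fB; rewrite ler_norml; apply/andP; split.
  rewrite -[leLHS]mean_cst; apply: mean_le => // [|w]; first exact: bounded_rv_cst.
  by have := fB w; rewrite ler_norml => /andP[].
rewrite -[leRHS]mean_cst; apply: mean_le => // [|w]; first exact: bounded_rv_cst.
by have := fB w; rewrite ler_norml => /andP[].
Qed.

Lemma mean_ae f g : bounded_rv f -> bounded_rv g ->
  {ae P, forall w, f w = g w} -> mean f = mean g.
Proof.
move=> [mf _] [mg _] fg; congr fine; apply: ae_eq_integral => //.
- exact/measurable_EFinP.
- exact/measurable_EFinP.
- by apply: filterS fg => w /= ->.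
Qed.

Lemma mean_gt0 f : bounded_rv f -> (forall w, 0 <= f w) ->
  {ae P, forall w, 0 < f w} -> 0 < mean f.
Proof.
move=> bf f0 fp; rewrite lt_neqAle; apply/andP; split; last first.
  by rewrite -(mean_cst 0); apply: mean_le => //; exact: bounded_rv_cst.
apply/negP => /eqP e.
have iE : (\int[P]_w `|(f w)%:E| = 0)%E.
  under eq_integral do rewrite /= ger0_norm//.
  have := bounded_rv_integrable bf => /integrable_fin_num => /(_ measurableT).
  by move=> /fineK <-; rewrite /mean /Rintegral in e; rewrite -e.
have [mf _] := bf.
have /ae_eq_integral_abs : measurable_fun setT (EFin \o f) by exact/measurable_EFinP.
move=> /(_ P measurableT)[/(_ iE) h _].
have : {ae P, forall w : Omega, False}.
  apply: filterS2 fp h => w fw /(_ I) /= [] fw0; move: fw; by rewrite fw0 ltxx.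
move=> [A [mA PA0 sub]].
have : P setT = 0.
  by apply: subset_measure0 PA0 => //; apply: subset_trans sub => w _ /=; exact.
by move=> PT; have := probability_setT P; rewrite [LHS]PT => /esym/eqP; rewrite onee_eq0.
Qed.

Lemma bounded_rv_indic (A : set Omega) : measurable A -> bounded_rv (\1_A : Omega -> R).
Proof.
move=> mA; split; first exact: measurable_indic.
by exists 1 => w; rewrite indicE; case: (w \in A); rewrite ?normr1 ?normr0.
Qed.

Lemma mean_indic (A : set Omega) : measurable A -> mean \1_A = fine (P A).
Proof. by move=> mA; rewrite /mean /Rintegral integral_indic// setIT. Qed.

End Expectation.

(** * Two invariant laws moved by the same contracting random map *)

Section Coupling.
Context (R : realType) d (Omega : measurableType d) (P : probability Omega R).
Variables (S : Type) (dS : S -> S -> R) (Phi : S -> Omega -> S) (X Y : Omega -> S).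
Variable K : nat -> set S.
Implicit Types (f : S -> R) (g h : S -> S -> R) (e a : R).
Notation mean := (mean P).

(** Bounded Lipschitz functions of two states. *)
Definition blip g := exists L B, [/\ 0 <= L, forall x y, `|g x y| <= B &
  forall x y x' y', `|g x y - g x' y'| <= L * (dS x x' + dS y y')].

Definition blip1 f := blip (fun x _ => f x).

Hypothesis dS_ge0 : forall x y, 0 <= dS x y.
Hypothesis dSxx : forall x, dS x x = 0.
Hypothesis dSC : forall x y, dS x y = dS y x.
Hypothesis dS_triangle : forall x y z, dS x z <= dS x y + dS y z.
Hypothesis Phi_meas : forall g, blip g -> forall x y,
  measurable_fun setT (fun w => g (Phi x w) (Phi y w)).
Hypothesis XY_meas : forall g, blip g -> measurable_fun setT (fun w => g (X w) (Y w)).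
Hypothesis Phi_contr : forall x y w, dS (Phi x w) (Phi y w) <= dS x y.
Hypothesis Phi_strict :
  {ae P, forall w, forall x y, 0 < dS x y -> dS (Phi x w) (Phi y w) < dS x y}.
Hypothesis invX : forall f, blip1 f ->
  mean (fun w => mean (fun w' => f (Phi (X w) w'))) = mean (f \o X).
Hypothesis invY : forall f, blip1 f ->
  mean (fun w => mean (fun w' => f (Phi (Y w) w'))) = mean (f \o Y).
Hypothesis tight : forall e, 0 < e -> exists m, exists2 A, measurable A &
  (P A <= e%:E)%E /\ forall w, ~ A w -> K m (X w) /\ K m (Y w).
Hypothesis K_compact : forall m (x y : nat -> S),
  (forall k, K m (x k)) -> (forall k, K m (y k)) ->
  exists x0 y0, forall e N, 0 < e ->
    exists2 k, (N <= k)%N & dS (x k) x0 < e /\ dS (y k) y0 < e.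

(** The Markov operator of a pair of states moved with common randomness. *)
Definition step_mean g x y : R := mean (fun w => g (Phi x w) (Phi y w)).

(** The n-th law of that Markov chain of pairs, started from the joint law of X
    and Y, as a functional of g. *)
Definition chain_mean n g : R := mean (fun w => iter n step_mean g (X w) (Y w)).

Lemma blipD g h : blip g -> blip h -> blip (fun x y => g x y + h x y).
Proof.
move=> [L [B [L0 gB gL]]] [M [C [M0 hC hM]]]; exists (L + M), (B + C); split.
- exact: addr_ge0.
- by move=> x y; apply: le_trans (ler_normD _ _) (lerD (gB x y) (hC x y)).
- move=> x y x' y'; rewrite mulrDl opprD addrACA.
  by apply: le_trans (ler_normD _ _) (lerD (gL _ _ _ _) (hM _ _ _ _)).
Qed.

Lemma blipZ a g : blip g -> blip (fun x y => a * g x y).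
Proof.
move=> [L [B [L0 gB gL]]]; exists (`|a| * L), (`|a| * B); split.
- exact: mulr_ge0.
- by move=> x y; rewrite normrM ler_wpM2l.
- by move=> x y x' y'; rewrite -mulrBr normrM -mulrA ler_wpM2l.
Qed.

Lemma blip_cst a : blip (fun _ _ => a).
Proof.
by exists 0, `|a|; split => // x y x' y'; rewrite subrr normr0 mul0r.
Qed.

Lemma blip_Phi g x y : blip g -> bounded_rv (fun w => g (Phi x w) (Phi y w)).
Proof.
move=> bg; split; first exact: Phi_meas.
by have [L [B [_ gB _]]] := bg; exists B.
Qed.

Lemma blip_XY g : blip g -> bounded_rv (fun w => g (X w) (Y w)).
Proof.
move=> bg; split; first exact: XY_meas.
by have [L [B [_ gB _]]] := bg; exists B.
Qed.

Lemma blip_step_mean g : blip g -> blip (step_mean g).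
Proof.
move=> bg; have [L [B [L0 gB gL]]] := bg; exists L, B; split => //.
  by move=> x y; apply: mean_norm => //; exact: blip_Phi.
move=> x y x' y'.
have -> : step_mean g x y - step_mean g x' y' =
    mean (fun w => g (Phi x w) (Phi y w) + -1 * g (Phi x' w) (Phi y' w)).
  by rewrite meanD ?meanZ ?mulN1r//; try apply: bounded_rvZ; exact: blip_Phi.
apply: mean_norm.
  by apply: bounded_rvD; [|apply: bounded_rvZ]; exact: blip_Phi.
move=> w; rewrite mulN1r; apply: le_trans (gL _ _ _ _) _.
by rewrite ler_wpM2l// lerD// Phi_contr.
Qed.

Lemma chain_meanS n g : chain_mean n.+1 g = chain_mean n (step_mean g).
Proof. by rewrite /chain_mean iterSr. Qed.

Lemma chain_mean_le n g h : blip g -> blip h -> (forall x y, g x y <= h x y) ->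
  chain_mean n g <= chain_mean n h.
Proof.
elim: n g h => [|n IH] g h bg bh gh.
  by apply: mean_le => [||w]; [exact: blip_XY|exact: blip_XY|exact: gh].
rewrite !chain_meanS; apply: IH; [exact: blip_step_mean|exact: blip_step_mean|] => x y.
by apply: mean_le => [||w]; [exact: blip_Phi|exact: blip_Phi|exact: gh].
Qed.

Lemma chain_meanD n g h : blip g -> blip h ->
  chain_mean n (fun x y => g x y + h x y) = chain_mean n g + chain_mean n h.
Proof.
elim: n g h => [|n IH] g h bg bh; first by rewrite /chain_mean meanD//; exact: blip_XY.
rewrite !chain_meanS -IH; try exact: blip_step_mean; congr chain_mean.
by apply/funext => x; apply/funext => y; rewrite /step_mean meanD//; exact: blip_Phi.
Qed.

Lemma chain_meanZ n a g : blip g -> chain_mean n (fun x y => a * g x y) = a * chain_mean n g.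
Proof.
elim: n g => [|n IH] g bg; first by rewrite /chain_mean meanZ//; exact: blip_XY.
rewrite !chain_meanS -IH; try exact: blip_step_mean; congr chain_mean.
by apply/funext => x; apply/funext => y; rewrite /step_mean meanZ//; exact: blip_Phi.
Qed.

Lemma chain_mean_cst n a : chain_mean n (fun _ _ => a) = a.
Proof.
elim: n => [|n IH]; first by rewrite /chain_mean mean_cst.
rewrite chain_meanS -[RHS]IH; congr chain_mean.
by apply/funext => x; apply/funext => y; rewrite /step_mean mean_cst.
Qed.

Lemma blip_swap f : blip1 f -> blip (fun _ y => f y).
Proof.
move=> [L [B [L0 fB fL]]]; exists L, B; split => //.
  by move=> _ y; exact: fB.
move=> x y x' y'; apply: le_trans (fL y x y' x') _.
by rewrite addrC.
Qed.

Lemma blip1_push f : blip1 f -> blip1 (fun x => mean (fun w => f (Phi x w))).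
Proof. by move=> bf; exact: (blip_step_mean bf). Qed.

(** By invariance, the marginals of the chain of pairs are constant in n. *)
Lemma chain_mean_X n f : blip1 f -> chain_mean n (fun x _ => f x) = mean (f \o X).
Proof.
elim: n f => [//|n IH] f bf.
by rewrite chain_meanS -(invX bf); exact: (IH _ (blip1_push bf)).
Qed.

Lemma chain_mean_Y n f : blip1 f -> chain_mean n (fun _ y => f y) = mean (f \o Y).
Proof.
elim: n f => [//|n IH] f bf.
by rewrite chain_meanS -(invY bf); exact: (IH _ (blip1_push bf)).
Qed.

(** Strictly increasing in the distance and bounded, so that its mean exists. *)
Definition bdist x y : R := dS x y / (1 + dS x y).

Lemma frac_lip (s t : R) : 0 <= s -> 0 <= t ->
  `|s / (1 + s) - t / (1 + t)| <= `|s - t|.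
Proof.
move=> s0 t0; have s1 : 0 < 1 + s by lra.
have t1 : 0 < 1 + t by lra.
have -> : s / (1 + s) - t / (1 + t) = (s - t) / ((1 + s) * (1 + t)).
  by field; rewrite !gt_eqF.
rewrite normrM ler_piMr// normfV invf_le1 ?normr_gt0 ?mulf_neq0 ?gt_eqF//.
by rewrite ger0_norm ?mulr_ge0 ?(ltW s1) ?(ltW t1)//; nra.
Qed.

Lemma frac_lt (s t : R) : 0 <= s -> s < t -> s / (1 + s) < t / (1 + t).
Proof.
move=> s0 st; rewrite ltr_pdivrMr; last by lra.
by rewrite mulrAC ltr_pdivlMr; [nra|lra].
Qed.

Lemma frac_le (s t : R) : 0 <= s -> s <= t -> s / (1 + s) <= t / (1 + t).
Proof.
by move=> s0; rewrite le_eqVlt => /predU1P[->//|st]; exact/ltW/frac_lt.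
Qed.

Lemma bdist_ge0 x y : 0 <= bdist x y.
Proof. by rewrite divr_ge0// addr_ge0. Qed.

Lemma bdist_le1 x y : bdist x y <= 1.
Proof. by rewrite ler_pdivrMr ?ltr_pwDl// mul1r lerDr. Qed.

Lemma dS_lip x y x' y' : `|dS x y - dS x' y'| <= dS x x' + dS y y'.
Proof.
have h1 := dS_triangle x x' y; have h2 := dS_triangle x' y' y.
have h3 := dS_triangle x' x y'; have h4 := dS_triangle x y y'.
move: h2 h3; rewrite (dSC y' y) (dSC x' x) => h2 h3.
by rewrite ler_norml; apply/andP; split; lra.
Qed.

Lemma blip_bdist : blip bdist.
Proof.
exists 1, 1; split => // [x y|x y x' y'].
  by rewrite ger0_norm ?bdist_ge0// bdist_le1.
by rewrite mul1r; apply: le_trans (frac_lip _ _) (dS_lip _ _ _ _).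
Qed.

Lemma step_mean_bdist_le x y : step_mean bdist x y <= bdist x y.
Proof.
rewrite -[leRHS](mean_cst P); apply: mean_le => [||w]; last exact: frac_le.
  exact: blip_Phi blip_bdist.
exact: bounded_rv_cst.
Qed.

Lemma step_mean_bdist_lt x y : 0 < dS x y -> step_mean bdist x y < bdist x y.
Proof.
move=> xy; rewrite -subr_gt0.
have -> : bdist x y - step_mean bdist x y = mean (fun w => bdist x y + -1 * bdist (Phi x w) (Phi y w)).
  rewrite meanD ?mean_cst ?meanZ ?mulN1r//; try exact: bounded_rv_cst.
    exact: blip_Phi blip_bdist.
  by apply: bounded_rvZ; exact: blip_Phi blip_bdist.
apply: mean_gt0.
- apply: bounded_rvD; first exact: bounded_rv_cst.
  by apply: bounded_rvZ; exact: blip_Phi blip_bdist.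
- by move=> w; rewrite mulN1r subr_ge0; exact: frac_le.
- apply: filterS Phi_strict => w /(_ x y xy) h; rewrite mulN1r subr_gt0.
  exact: frac_lt.
Qed.

Definition dist_to m x : R := inf [set dS x q | q in K m].

Lemma dist_to_lb m x q : K m q -> dist_to m x <= dS x q.
Proof.
by move=> Kq; apply: ge_inf; [exists 0 => _ [z _ <-]|exists q].
Qed.

Lemma dist_to_lip m x y : K m !=set0 -> dist_to m x <= dS x y + dist_to m y.
Proof.
move=> [q0 Kq0]; rewrite addrC -lerBlDr.
apply: lb_le_inf; first by exists (dS y q0), q0.
move=> _ [q Kq <-]; rewrite lerBlDr addrC.
by apply: le_trans (dist_to_lb x Kq) (dS_triangle _ _ _).
Qed.

Lemma dist_to_ge0 m x : K m !=set0 -> 0 <= dist_to m x.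
Proof.
move=> [q0 Kq0]; apply: lb_le_inf; first by exists (dS x q0), q0.
by move=> _ [q Kq <-].
Qed.

Lemma dist_to_lt m x e : K m !=set0 -> dist_to m x < e -> exists2 q, K m q & dS x q < e.
Proof.
move=> [q0 Kq0] h.
have hi : has_inf [set dS x q | q in K m].
  by split; [exists (dS x q0), q0|exists 0 => _ [z _ <-]].
have e0 : 0 < e - dist_to m x by rewrite subr_gt0.
have [_ [q Kq <-]] := inf_adherent e0 hi.
by rewrite -/(dist_to m x) addrC subrK => qe; exists q.
Qed.

(** A Lipschitz substitute for the indicator function of the complement of K m. *)
Definition escape m e x : R := Num.min 1 (dist_to m x / e).

Lemma minr_lip (s t : R) : `|Num.min 1 s - Num.min 1 t| <= `|s - t|.
Proof.
rewrite /Num.min; case: ltP => ?; case: ltP => ?; rewrite ?subrr ?normr0//.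
- by rewrite !ger0_norm; lra.
- by rewrite !ler0_norm; lra.
Qed.

Lemma blip1_escape m e : 0 < e -> K m !=set0 -> blip1 (escape m e).
Proof.
move=> e0 K0; exists e^-1, 1; split => [|x _|x y x' y'].
- by rewrite invr_ge0 ltW.
- rewrite ger0_norm; first by rewrite /escape ge_min lexx.
  by rewrite /escape le_min ler01 divr_ge0 ?dist_to_ge0// ltW.
- apply: le_trans (minr_lip _ _) _; rewrite -mulrBl normrM mulrC.
  rewrite ger0_norm ?invr_ge0 ?(ltW e0)// ler_wpM2l ?invr_ge0 ?(ltW e0)//.
  have h1 := dist_to_lip x x' K0; have := dist_to_lip x' x K0; rewrite (dSC x') => h2.
  by have := dS_ge0 y y'; rewrite ler_norml => ?; apply/andP; split; lra.
Qed.

Lemma mean_escape_le m e (Z : Omega -> S) (A : set Omega) a : 0 < e -> measurable A ->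
  (P A <= a%:E)%E -> (forall w, ~ A w -> K m (Z w)) ->
  bounded_rv (escape m e \o Z) -> mean (escape m e \o Z) <= a.
Proof.
move=> e0 mA PA AZ bk.
have PAf : P A \is a fin_num by exact: fin_num_measure.
apply: le_trans (_ : _ <= mean (\1_A)) _; last first.
  by rewrite mean_indic// -lee_fin fineK.
apply: mean_le => //; first exact: bounded_rv_indic.
move=> w; rewrite indicE; have [Aw|nAw] := boolP (w \in A).
  by rewrite /= /escape ge_min lexx.
have Kw : K m (Z w) by apply: AZ; move/negP: nAw; rewrite inE.
rewrite /= /escape ge_min; apply/orP; right.
have := dist_to_lb (Z w) Kw; rewrite dSxx => h.
by rewrite ler_pdivrMr// mul0r.
Qed.

(** The strict decrease off the diagonal is uniform near a compact set:
    otherwise pairs that violate it more and more narrowly would cluster at a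
    pair x0, y0 at positive distance, on which one step does not decrease the
    mean of the bounded distance. *)
Lemma compact_gap m e : 0 < e -> K m !=set0 -> exists2 a : R, 0 < a &
  forall x y, dist_to m x < a -> dist_to m y < a -> bdist x y - step_mean bdist x y < a -> bdist x y < e.
Proof.
move=> e0 K0; apply: contrapT => H.
pose a k : R := k.+1%:R^-1.
have a0 k : 0 < a k by rewrite invr_gt0.
have Hk k : exists p : (S * S) * (S * S),
    [/\ K m p.2.1, K m p.2.2, dS p.1.1 p.2.1 < a k, dS p.1.2 p.2.2 < a k &
     bdist p.1.1 p.1.2 - step_mean bdist p.1.1 p.1.2 < a k /\ e <= bdist p.1.1 p.1.2].
  apply: contrapT => Hn; apply: H; exists (a k) => // x y xa ya hxy.
  rewrite ltNge; apply/negP => he; apply: Hn.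
  have [q Kq xq] := dist_to_lt K0 xa; have [r Kr yr] := dist_to_lt K0 ya.
  by exists ((x, y), (q, r)).
have [p Hp] := choice Hk.
have K1 k : K m (p k).2.1 by have [] := Hp k.
have K2 k : K m (p k).2.2 by have [] := Hp k.
have [x0 [y0 Hxy]] := K_compact K1 K2.
have [L [B [L0 _ HL]]] := blip_step_mean blip_bdist.
have close s : 0 < s -> exists k, [/\ dS (p k).1.1 x0 < s, dS (p k).1.2 y0 < s & a k < s].
  move=> s0; have s2 : 0 < s / 2 by rewrite divr_gt0.
  have [N HN] : exists N, forall k, (N <= k)%N -> a k < s / 2.
    exists (Num.truncn (s / 2)^-1) => k Nk.
    rewrite /a -[ltRHS]invrK ltf_pV2 ?posrE ?invr_gt0//.
    apply: lt_le_trans (truncnS_gt _) _.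
    by rewrite ler_nat ltnS.
  have [k Nk [hx hy]] := Hxy (s / 2) N s2; exists k.
  have [_ _ h1 h2 _] := Hp k; have h3 := HN k Nk.
  split; last by lra.
    by apply: le_lt_trans (dS_triangle _ (p k).2.1 _) _; lra.
  by apply: le_lt_trans (dS_triangle _ (p k).2.2 _) _; lra.
have h1 : e <= bdist x0 y0.
  apply/ler_addgt0Pr => s s0; have s2 : 0 < s / 2 by rewrite divr_gt0.
  have [k [k1 k2 _]] := close _ s2; have [_ _ _ _ [_ he]] := Hp k.
  have := frac_lip (dS_ge0 (p k).1.1 (p k).1.2) (dS_ge0 x0 y0).
  have := dS_lip (p k).1.1 (p k).1.2 x0 y0.
  move: he; rewrite /bdist => he hl /le_trans/(_ hl); rewrite ler_norml => /andP[? ?].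
  lra.
have h2 : bdist x0 y0 <= step_mean bdist x0 y0.
  apply/ler_addgt0Pr => s s0.
  have s3 : 0 < s / (2 * L + 3) by rewrite divr_gt0//; lra.
  have [k [k1 k2 k3]] := close _ s3; have [_ _ _ _ [hq _]] := Hp k.
  have := frac_lip (dS_ge0 (p k).1.1 (p k).1.2) (dS_ge0 x0 y0).
  have := dS_lip (p k).1.1 (p k).1.2 x0 y0.
  move=> hl /le_trans/(_ hl); rewrite ler_norml => /andP[? ?].
  have := HL (p k).1.1 (p k).1.2 x0 y0; rewrite ler_norml => /andP[? ?].
  set r := s / (2 * L + 3) in s3 k1 k2 k3 *.
  have hr : r * (2 * L + 3) = s by rewrite /r divfK// gt_eqF//; lra.
  have h4 : L * (dS (p k).1.1 x0 + dS (p k).1.2 y0) <= L * (r + r).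
    by rewrite ler_wpM2l//; lra.
  move: hq; rewrite /bdist in h1 *; lra.
have d0 : 0 < dS x0 y0.
  rewrite lt0r dS_ge0 andbT; apply/eqP => d00.
  by move: h1; rewrite /bdist d00 mul0r leNgt e0.
by have := step_mean_bdist_lt d0; rewrite ltNge h2.
Qed.

(** These means do not increase. At all times the pairs far from K m have a
    small contribution, because the marginals are constant and tight. On the
    others [compact_gap] applies, so that as long as the mean exceeds e it drops
    by a fixed amount at each step. *)
Lemma chain_mean_bdist_small e : 0 < e -> exists n, chain_mean n bdist <= e.
Proof.
move=> e0; pose e' := Num.min (e / 4) 2^-1.
have e'0 : 0 < e' by rewrite lt_min divr_gt0//= invr_gt0.
have [m [A mA [PA AK]]] := tight e'0.
have K0 : K m !=set0.
  apply: contrapT => K0; have AT : A = setT.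
    apply/seteqP; split => // w _; apply: contrapT => /AK[Kx _].
    by apply: K0; exists (X w).
  move: PA; rewrite AT (_ : P _ = 1%E); last exact: probability_setT.
  by rewrite lee_fin /e' le_min => /andP[_]; lra.
have [a a0 Ha] := compact_gap e'0 K0.
have bh := blip_bdist; have bk := blip1_escape a0 K0.
have bk2 := blip_swap bk.
have bQ : blip (fun x y => bdist x y + -1 * step_mean bdist x y).
  by apply: blipD => //; apply: blipZ; exact: blip_step_mean.
have pw x y : bdist x y <= e' + escape m a x + escape m a y +
    a^-1 * (bdist x y + -1 * step_mean bdist x y).
  have k0 z : 0 <= escape m a z by rewrite /escape le_min ler01 divr_ge0 ?dist_to_ge0// ltW.
  have q0 : 0 <= a^-1 * (bdist x y + -1 * step_mean bdist x y).
    by rewrite mulr_ge0 ?invr_ge0 ?(ltW a0)// mulN1r subr_ge0 step_mean_bdist_le.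
  have k1 z : a <= dist_to m z -> 1 <= escape m a z.
    by move=> h; rewrite /escape le_min lexx ler_pdivlMr// mul1r.
  have h1 := bdist_le1 x y; have kx0 := k0 x; have ky0 := k0 y.
  have [xa|/k1 kx] := ltP (dist_to m x) a; last by lra.
  have [ya|/k1 ky] := ltP (dist_to m y) a; last by lra.
  have [ha|ha] := ltP (bdist x y - step_mean bdist x y) a; first by have := Ha x y xa ya ha; lra.
  have : 1 <= a^-1 * (bdist x y + -1 * step_mean bdist x y).
    by rewrite mulN1r mulrC ler_pdivlMr// mul1r.
  by lra.
have key n : chain_mean n bdist <= e' + e' + e' + a^-1 * (chain_mean n bdist - chain_mean n.+1 bdist).
  apply: le_trans (chain_mean_le n bh _ pw) _.
    by do 2?[apply: blipD]; [apply: blipD => //; exact: blip_cst| |exact: blipZ].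
  rewrite chain_meanD; [|by do 2?[apply: blipD] => //; exact: blip_cst|exact: blipZ].
  rewrite chain_meanD; [|by apply: blipD => //; exact: blip_cst|by []].
  rewrite chain_meanD//; last exact: blip_cst.
  rewrite chain_meanZ// chain_meanD//; last by apply: blipZ; exact: blip_step_mean.
  rewrite chain_meanZ; last exact: blip_step_mean.
  rewrite chain_mean_cst chain_mean_X// chain_mean_Y// -chain_meanS mulN1r lerD2r.
  have b1 : mean (escape m a \o X) <= e'.
    apply: (mean_escape_le a0 mA PA) => [w /AK[]//|]; exact: (blip_XY bk).
  have b2 : mean (escape m a \o Y) <= e'.
    apply: (mean_escape_le a0 mA PA) => [w /AK[]//|]; exact: (blip_XY bk2).
  by lra.
have e'4 : e' <= e / 4 by rewrite /e' ge_min lexx.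
have Lam0 n : 0 <= chain_mean n bdist.
  rewrite -(chain_mean_cst n 0); apply: chain_mean_le => //; [exact: blip_cst|exact: bdist_ge0].
apply: contrapT => Hn.
have big n : e < chain_mean n bdist by rewrite ltNge; apply/negP => h; apply: Hn; exists n.
have drop n : chain_mean n.+1 bdist <= chain_mean n bdist - a * (e / 4).
  have := key n; have := big n => h1 h2.
  have : e / 4 <= a^-1 * (chain_mean n bdist - chain_mean n.+1 bdist) by lra.
  by rewrite ler_pdivlMl//; lra.
have dropn n : chain_mean n bdist <= chain_mean 0 bdist - n%:R * (a * (e / 4)).
  elim: n => [|n IH]; first by rewrite mul0r subr0.
  by apply: le_trans (drop n) _; rewrite -[n.+1%:R]natr1 mulrDl mul1r opprD addrA lerD2r.
have ae : 0 < a * (e / 4) by rewrite mulr_gt0// divr_gt0.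
have := dropn (Num.truncn (chain_mean 0 bdist / (a * (e / 4)))).+1.
have := truncnS_gt (chain_mean 0 bdist / (a * (e / 4))).
rewrite ltr_pdivrMr// => h1 h2.
have := Lam0 (Num.truncn (chain_mean 0 bdist / (a * (e / 4)))).+1; lra.
Qed.

(** A multiple of the bounded distance dominates |f x - f y|, and the means of
    f along the two marginals of the chain of pairs are constant in n. *)
Lemma stationary_unique f : blip1 f -> mean (f \o X) = mean (f \o Y).
Proof.
move=> bf; have [L [B [L0 fB fL]]] := bf.
have [w0 _] : exists w : Omega, True.
  apply: contrapT => H.
  have : P setT = 0.
    have -> : setT = set0 :> set Omega.
      by apply/seteqP; split => // w _; apply: H; exists w.
    exact: measure0.
  by move=> h; have := probability_setT P; rewrite [LHS]h => /esym/eqP; rewrite onee_eq0.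
have B0 : 0 <= B by apply: le_trans (fB (X w0) (X w0)).
pose C := 2 * L + 4 * B.
have C0 : 0 <= C by rewrite addr_ge0 ?mulr_ge0.
(* Lipschitz bound at distances below 1, uniform bound beyond. *)
have fh x y : `|f x - f y| <= C * bdist x y.
  have h1 := fL x x y x; rewrite dSxx addr0 in h1.
  have h2 : `|f x - f y| <= B + B.
    by apply: le_trans (ler_normB _ _) (lerD (fB x x) (fB y y)).
  have d0 := dS_ge0 x y; have d1 : 0 < 1 + dS x y by lra.
  have [d2|d2] := leP (dS x y) 1.
    have h3 : dS x y <= 2 * bdist x y.
      by rewrite /bdist mulrA ler_pdivlMr//; nra.
    have h4 : L * dS x y <= L * (2 * bdist x y) by rewrite ler_wpM2l.
    have := mulr_ge0 B0 (bdist_ge0 x y); rewrite /C; lra.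
  have h3 : 1 <= 2 * bdist x y.
    by rewrite /bdist mulrA ler_pdivlMr//; lra.
  have h4 : B * 1 <= B * (2 * bdist x y) by rewrite ler_wpM2l.
  have := mulr_ge0 L0 (bdist_ge0 x y); rewrite /C; lra.
have bf2 := blip_swap bf.
have bd : blip (fun x y => f x + -1 * f y) by apply: blipD => //; exact: blipZ.
apply/eqP; rewrite -subr_eq0 -normr_le0; apply/ler_addgt0Pr => e e0; rewrite add0r.
have e1 : 0 < e / (C + 1) by rewrite divr_gt0//; lra.
have [n Hn] := chain_mean_bdist_small e1.
have -> : mean (f \o X) - mean (f \o Y) = chain_mean n (fun x y => f x + -1 * f y).
  by rewrite chain_meanD//; [rewrite chain_meanZ// chain_mean_X// chain_mean_Y// mulN1r|exact: blipZ].
apply: le_trans (_ : _ <= C * chain_mean n bdist) _; last first.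
  have : (C + 1) * (e / (C + 1)) = e by rewrite mulrC divfK// gt_eqF//; lra.
  have := ler_wpM2l C0 Hn; rewrite mulrDl; move: e1; lra.
rewrite ler_norml -mulNr -!chain_meanZ//; try exact: blip_bdist.
apply/andP; split; apply: chain_mean_le => //; try (apply: blipZ; exact: blip_bdist).
  by move=> x y; rewrite mulN1r; have := fh x y; rewrite ler_norml mulNr => /andP[].
by move=> x y; rewrite mulN1r; have := fh x y; rewrite ler_norml => /andP[].
Qed.

End Coupling.

(** * Measurability and independence *)

Section Measurability.
Context (R : realType) d (T : measurableType d).

Lemma measurable_bigcup_countType (I : countType) (B : I -> set T) :
  (forall i, measurable (B i)) -> measurable (\bigcup_i B i).
Proof. by move=> mB; apply: countable_bigcupT_measurable. Qed.

Lemma measurable_ray (f : T -> R) :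
  (forall r, measurable [set t | r < f t]) -> measurable_fun setT f.
Proof.
move=> mf mD; apply: (measurability _ (RGenOInfty.measurableE R)) => //.
move=> /= _ [_ [r ->] <-]; rewrite setTI.
rewrite [X in measurable X](_ : _ = [set t | r < f t]) //.
by apply/seteqP; split => t /=; rewrite in_itv/= andbT.
Qed.

(** Lower semicontinuity implies measurability, where the events B i take the
    place of a countable base of a topology, which T does not have. *)
Lemma measurable_countable_base (I : countType) (B : I -> set T) (f : T -> R) :
  (forall i, measurable (B i)) ->
  (forall t e, 0 < e -> exists2 i, B i t & forall s, B i s -> f t - e < f s) ->
  measurable_fun setT f.
Proof.
move=> mB H; apply: measurable_ray => r.
rewrite (_ : [set t | r < f t] =
  \bigcup_i (if `[< B i `<=` [set t | r < f t] >] then B i else set0)).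
  by apply: measurable_bigcup_countType => i; case: ifP.
apply/seteqP; split => t /=.
  move=> rt; have e0 : 0 < f t - r by rewrite subr_gt0.
  have [i Bt Bs] := H t _ e0; exists i => //.
  case: asboolP => // -[]; move=> s /Bs /=; lra.
by move=> [i _]; case: asboolP => // + Bt; exact.
Qed.

End Measurability.

Section Independence.
Context (R : realType) d (Omega : measurableType d) (P : probability Omega R).

Definition independent_sys (F G : set (set Omega)) :=
  forall A B, F A -> G B -> P (A `&` B) = (P A * P B)%E.

(** For A in F, the measures that send B to P (A `&` B) and to P A times P B
    agree on the pi-system G. *)
Lemma independent_sigma (F G : set (set Omega)) :
  F `<=` measurable -> G `<=` measurable -> setI_closed G ->
  independent_sys F G -> independent_sys F <<s G >>.
Proof.
move=> mF mG GI FG A B FA GB.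
have mA := mF _ FA.
have PAf : P A \is a fin_num by exact: fin_num_measure.
have PA0 : 0 <= fine (P A) by rewrite fine_ge0.
pose m1 := mrestr P mA; pose m2 := mscale (NngNum PA0) P.
have mBs : <<s G >> `<=` measurable.
  by apply: smallest_sub => //; exact: sigma_algebra_measurable.
have PT1 : (P setT = 1)%E by exact: probability_setT.
have H : m1 B = m2 B.
  apply: (g_sigma_algebra_measure_unique_trace (d := d) G setT) => //.
  - by move=> X [/mG].
  - by move=> X Y [GX _] [GY _]; split => //; exact: GI.
  - rewrite -[LHS]/(P (setT `&` A)) -[RHS]/((fine (P A))%:E * P setT)%E.
    rewrite setTI fineK// -[LHS]mule1; congr (_ * _)%E.
    exact/esym/probability_setT.
  - move=> X [GX _].
    rewrite -[LHS]/(P (X `&` A)) -[RHS]/((fine (P A))%:E * P X)%E.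
    by rewrite fineK// setIC; exact: FG.
  - rewrite -[X in (X < _)%E]/(P (setT `&` A)) setTI ltey_eq PAf//.
  - rewrite (_ : [set X | G X /\ X `<=` setT] = G)//.
    by apply/seteqP; split => [X []//|X GX]; split.
by rewrite setIC -[LHS]/(m1 B) H -[LHS]/((fine (P A))%:E * P B)%E fineK.
Qed.

(** Freezing of the F-measurable argument. By independence the law of (w, w) on
    the product of the two sigma-algebras is a product measure, so that this is
    Fubini's theorem; the pieces B1 and B2 make theta jointly measurable. *)
Lemma independent_integral (F G : set (set Omega)) (I : countType)
    (B1 B2 : I -> set Omega) (theta : Omega -> Omega -> R) M :
  F `<=` measurable -> G `<=` measurable ->
  sigma_algebra setT F -> sigma_algebra setT G ->
  independent_sys F G ->
  (forall i, F (B1 i)) -> (forall i, G (B2 i)) ->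
  (forall w w', `|theta w w'| <= M) ->
  (forall w w' e, 0 < e -> exists i, [/\ B1 i w, B2 i w' &
     forall v v', B1 i v -> B2 i v' -> theta w w' - e < theta v v']) ->
  mean P (fun w => theta w w) = mean P (fun w => mean P (fun w' => theta w w')).
Proof.
move=> FO GO sF sG FG FB GB thetaM cont.
pose T1 : measurableType _ := g_sigma_algebraType F.
pose T2 : measurableType _ := g_sigma_algebraType G.
pose T12 : measurableType _ := (T1 * T2)%type.
have m1 A : measurable (A : set T1) <-> F A.
  by rewrite /measurable/= (sigma_algebra_id sF).
have m2 A : measurable (A : set T2) <-> G A.
  by rewrite /measurable/= (sigma_algebra_id sG).
pose i1 : Omega -> T1 := id; pose i2 : Omega -> T2 := id.
have mi1 : measurable_fun setT i1.
  by move=> _ A /m1/FO mA; rewrite setTI.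
have mi2 : measurable_fun setT i2.
  by move=> _ A /m2/GO mA; rewrite setTI.
pose dg w : T12 := (i1 w, i2 w).
have mdg : measurable_fun setT dg by exact: measurable_fun_pair.
pose I1 : {mfun Omega >-> T1} := mfun_Sub (mem_set mi1).
pose I2 : {mfun Omega >-> T2} := mfun_Sub (mem_set mi2).
pose DG : {mfun Omega >-> T12} := mfun_Sub (mem_set mdg).
pose P1 : probability T1 R := distribution P I1.
pose P2 : probability T2 R := distribution P I2.
pose P12 : probability T12 R := distribution P DG.
pose th (z : T12) := theta z.1 z.2.
have mth : measurable_fun setT th.
  apply: (@measurable_countable_base R _ T12 I (fun i => B1 i `*` B2 i)).
    by move=> i; apply: measurableX; [exact/m1|exact/m2].
  move=> [w w'] e e0; have [i [b1 b2 H]] := cont w w' e e0.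
  by exists i => // -[v v'] /= [? ?]; exact: H.
have meth : measurable_fun setT (EFin \o th) by exact/measurable_EFinP.
have thM : forall z, `|th z| <= M by move=> z; exact: thetaM.
have mth2 w : measurable_fun [set: T2] (fun w' : T2 => th (i1 w, w')).
  exact: measurable_fun_pair2.
have b1 w : bounded_rv (theta w).
  split; last by exists M.
  have : measurable_fun setT ((fun w' : T2 => th (i1 w, w')) \o i2).
    by apply: measurableT_comp => //; exact: measurable_fun_pair2.
  by [].
have inner w : (\int[P2]_w' (theta w w')%:E = (mean P (theta w))%:E)%E.
  rewrite /P2 integral_distribution//=; last 2 first.
  - by apply/measurable_EFinP; exact: (mth2 w).
  - exact: (bounded_rv_integrable P (b1 w)).
  rewrite /mean /Rintegral fineK//.
  exact: (integrable_fin_num _ (bounded_rv_integrable P (b1 w))).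
pose Fb (x : T1) : \bar R := (\int[P2]_y (EFin \o th) (x, y))%E.
have prodE A : measurable A -> (P1 \x P2)%E A = P12 A.
  move=> mA; apply: product_measure_unique => // C D mC mD.
  exact: (FG C D (proj1 (m1 C) mC) (proj1 (m2 D) mD)).
have int12 : (P1 \x P2)%E.-integrable [set: T12] (EFin \o th).
  apply: measurable_bounded_integrable => //.
    have e1 : (P1 \x P2)%E setT = 1%E.
      by rewrite prodE; [exact: (probability_setT P12)|exact: measurableT].
    by rewrite [X in (X < _)%E]e1 ltry.
  exists M; split; first exact: num_real.
  by move=> N MN z _; apply: le_trans (thM z) (ltW MN).
have mFb : measurable_fun [set: T1] Fb by exact: (measurable_fubini_F int12).
have FbE w : Fb (i1 w) = (mean P (theta w))%:E by exact: inner.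
have bE : bounded_rv (fun w => mean P (theta w)).
  split; last by exists M => w; exact: mean_norm.
  apply/measurable_EFinP.
  rewrite (_ : _ \o _ = Fb \o i1); last by apply/funext => w; rewrite /= FbE.
  exact: measurableT_comp.
have bdiag : bounded_rv (fun w => theta w w).
  split; last by exists M => w.
  have : measurable_fun setT (th \o dg) by exact: measurableT_comp.
  by [].
have diagE : (\int[P]_w (theta w w)%:E = \int[P12]_z (EFin \o th) z)%E.
  rewrite integral_distribution//.
  exact: (bounded_rv_integrable P bdiag).
rewrite /mean /Rintegral; congr fine.
rewrite diagE (eq_measure_integral (P1 \x P2)%E); last first.
  by move=> A mA _; exact/esym/prodE.
rewrite -(integral12_prod_meas1 int12) -[LHS]/(\int[P1]_x Fb x)%E.
have FbE' : Fb \o I1 = EFin \o (fun w => mean P (theta w)).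
  by apply/funext => w /=; rewrite FbE.
rewrite /P1 integral_distribution//; last first.
  by rewrite FbE'; exact: (bounded_rv_integrable P bE).
by rewrite FbE'.
Qed.

End Independence.

(** * Open sets and Borel sets of H_+ *)

Section HplusFacts.
Variable R : realType.
Implicit Types (x y u v : nat -> R) (C e r : R).

Lemma sqnorm_ge u n : ((\sum_(j < n) u j ^+ 2)%:E <= sqnorm u)%E.
Proof.
apply: le_trans (nneseries_lim_ge n _) => [|k _]; last by rewrite lee_fin sqr_ge0.
by rewrite sumEFin big_mkord.
Qed.

Lemma sqnorm_le u C : (forall n, \sum_(j < n) u j ^+ 2 <= C) -> (sqnorm u <= C%:E)%E.
Proof.
move=> h; apply: lime_le.
  by apply: is_cvg_nneseries => k _ _; rewrite lee_fin sqr_ge0.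
by apply: nearW => n; rewrite sumEFin lee_fin big_mkord.
Qed.

Lemma ell2P u : ell2 u <-> square_summable u.
Proof.
split=> [|[C hC]].
  rewrite /ell2/= => h; have s0 : (0 <= sqnorm u)%E.
    by apply: le_trans (sqnorm_ge u 0); rewrite big_ord0.
  exists (fine (sqnorm u)) => n; rewrite -lee_fin fineK ?sqnorm_ge//.
  by rewrite ge0_fin_numE.
by rewrite /ell2/=; apply: le_lt_trans (sqnorm_le hC) (ltry _).
Qed.

Lemma Hplus_square_summable x : Hplus x -> square_summable x.
Proof. by move=> [/ell2P]. Qed.

Lemma sum_sqr_le_norm u n : square_summable u ->
  \sum_(j < n) u j ^+ 2 <= ell2_norm u ^+ 2.
Proof.
move=> /ell2P su; rewrite /ell2_norm.
have s0 : (0 <= sqnorm u)%E.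
  by apply: le_trans (sqnorm_ge u 0); rewrite big_ord0.
rewrite sqr_sqrtr ?fine_ge0// -lee_fin fineK ?sqnorm_ge//.
by rewrite ge0_fin_numE.
Qed.

Lemma norm_le_sum_sqr u C : (forall n, \sum_(j < n) u j ^+ 2 <= C) ->
  ell2_norm u ^+ 2 <= C.
Proof.
move=> h; have s0 : (0 <= sqnorm u)%E.
  by apply: le_trans (sqnorm_ge u 0); rewrite big_ord0.
have h1 := sqnorm_le h; rewrite /ell2_norm sqr_sqrtr ?fine_ge0//.
rewrite -lee_fin fineK// ge0_fin_numE//.
exact: le_lt_trans h1 (ltry _).
Qed.

Lemma ell2_norm_ge0 u : 0 <= ell2_norm u. Proof. exact: sqrtr_ge0. Qed.

Lemma square_summableB x y : square_summable x -> square_summable y ->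
  square_summable (fun j => x j - y j).
Proof.
move=> [C hC] [D hD]; exists (2 * C + 2 * D) => n.
apply: le_trans (_ : _ <= 2 * (\sum_(j < n) x j ^+ 2) + 2 * (\sum_(j < n) y j ^+ 2)) _; last first.
  by rewrite lerD// ler_wpM2l.
rewrite !mulr_sumr -big_split/=; apply: ler_sum => j _.
by have := sqr_ge0 (x j + y j); lra.
Qed.

Lemma le_of_sqr (a b : R) : 0 <= b -> a ^+ 2 <= b ^+ 2 -> a <= b.
Proof. by move=> b0 /(norm_le_sqr b0); apply: le_trans; exact: ler_norm. Qed.

Lemma dist_le_norm x y : square_summable x -> square_summable y ->
  dist x y <= ell2_norm (fun j => x j - y j).
Proof.
move=> sx sy; apply: le_of_sqr; first exact: ell2_norm_ge0.
rewrite sqr_dist; apply: dsq_le => n.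
apply: le_trans (sum_sqr_le_norm n (square_summableB sx sy)).
apply: ler_sum => j _; rewrite -[leRHS]mul1r ler_wpM2r ?sqr_ge0//.
exact: half_le1.
Qed.

Definition dist_open (U : set (nat -> R)) := U `<=` @Hplus R /\
  forall u, U u -> exists2 e : R, 0 < e & forall v, Hplus v -> dist v u < e -> U v.

(** The weighted distance is at most the norm. *)
Lemma dist_open_borel U : dist_open U -> Hplus_borel U.
Proof.
move=> [UH Uo]; apply: sub_sigma_algebra; split => // u Uu.
have [e e0 He] := Uo u Uu; exists e => // v Hv vu; apply: He => //.
apply: le_lt_trans vu; apply: dist_le_norm; apply: Hplus_square_summable => //.
exact: UH.
Qed.

Lemma Hplus_borelD U : Hplus_borel U -> Hplus_borel (@Hplus R `\` U).
Proof. exact: sigma_algebraCD. Qed.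

Lemma Hplus_borel_Hplus : Hplus_borel (@Hplus R).
Proof. by rewrite -[X in Hplus_borel X]setD0; apply: Hplus_borelD; exact: sigma_algebra0. Qed.

Lemma Hplus_borel_sub U : Hplus_borel U -> U `<=` @Hplus R.
Proof.
move=> hU; apply: (smallest_sub (X := [set V | V `<=` @Hplus R]) _ _ hU) => //.
  split => [|A _|F hF].
  - exact: sub0set.
  - exact: subDsetl.
  - by apply: bigcup_sub => i _; exact: hF.
by move=> V [].
Qed.

Lemma Hplus_dist_triangle x y z : Hplus x -> Hplus y -> Hplus z ->
  dist x z <= dist x y + dist y z.
Proof. by move=> *; apply: dist_triangle; exact: Hplus_square_summable. Qed.

Lemma ball_dist_open x e : Hplus x -> dist_open [set y | Hplus y /\ dist y x < e].
Proof.
move=> Hx; split => [y []//|y [Hy yx]]; exists (e - dist y x).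
  by rewrite subr_gt0.
move=> v Hv vy; split => //.
by apply: le_lt_trans (Hplus_dist_triangle Hv Hy Hx) _; rewrite -ltrBrDr.
Qed.

(** Finite rational sequences, a countable dense subset of H_+; the absolute
    value enforces the sign condition. *)
Definition ratseq (s : seq rat) (j : nat) : R :=
  if j is 0 then ratr s`_0 else `|ratr s`_j|.

Lemma ratseq_Hplus s : Hplus (ratseq s).
Proof.
split; last by move=> [//|j] _; exact: normr_ge0.
apply/ell2P; exists (\sum_(j < size s) ratseq s j ^+ 2) => n.
have H k : \sum_(j < size s + k) ratseq s j ^+ 2 = \sum_(j < size s) ratseq s j ^+ 2.
  elim: k => [|k IH]; first by rewrite addn0.
  rewrite addnS big_ord_recr/= IH [X in _ + X](_ : _ = 0) ?addr0//.
  have sk : (size s <= size s + k)%N by rewrite leq_addr.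
  rewrite /ratseq; case: (size s + k)%N sk => [|m] sk; rewrite nth_default//.
    by rewrite raddf0 expr0n.
  by rewrite raddf0 normr0 expr0n.
rewrite -(H n) addnC big_split_ord/= lerDl.
by apply: sumr_ge0 => j _; exact: sqr_ge0.
Qed.

Lemma ratseq_dense x e : Hplus x -> 0 < e ->
  exists s, ell2_norm (fun j => ratseq s j - x j) < e.
Proof.
move=> Hx e0; have sx := Hplus_square_summable Hx.
pose S n := \sum_(j < n) x j ^+ 2.
have hs : has_sup (range S).
  split; first by exists (S 0%N), 0%N.
  by have [C hC] := sx; exists C => _ [n _ <-]; exact: (hC n).
pose d := e ^+ 2 / 4; have d0 : 0 < d by rewrite divr_gt0// exprn_gt0.
have [_ [n _ <-] Sn] := sup_adherent d0 hs.
have tail k : \sum_(j < k) x (n + j)%N ^+ 2 <= d.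
  have : S (n + k)%N <= sup (range S) by apply: ub_le_sup; [exact: hs.2|exists (n + k)%N].
  by rewrite /S big_split_ord/= => h; move: Sn; rewrite /S; lra.
pose a := Num.min 1 (d / n.+1%:R).
have a0 : 0 < a by rewrite lt_min ltr01 divr_gt0.
have Hr j : exists r : rat, `|ratr r - x j| < a.
  have xa : x j - a < x j + a by lra.
  have [r] := rat_in_itvoo xa.
  by rewrite in_itv/= => /andP[h1 h2]; exists r; rewrite ltr_norml; apply/andP; split; lra.
have [r Hr'] := choice Hr.
pose s := mkseq r n; exists s.
have close j : (j < n)%N -> (ratseq s j - x j) ^+ 2 <= d / n.+1%:R.
  move=> jn; have h : `|ratseq s j - x j| < a.
    rewrite /ratseq /s; case: j jn => [|j] jn; rewrite nth_mkseq//.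
    have xj : 0 <= x j.+1 by apply: Hx.2.
    rewrite -{1}(ger0_norm xj); apply: le_lt_trans (Hr' j.+1).
    exact: ler_dist_dist.
  rewrite -real_normK ?num_real// expr2; apply: le_trans (_ : _ <= a * 1) _.
    by rewrite ler_pM// ltW// (lt_le_trans h)// /a ge_min lexx.
  by rewrite mulr1 /a ge_min lexx orbT.
have far j : ratseq s (n + j)%N - x (n + j)%N = - x (n + j)%N.
  rewrite [ratseq s _](_ : _ = 0) ?sub0r// /ratseq /s.
  have nn : (size (mkseq r n) <= n + j)%N by rewrite size_mkseq leq_addr.
  by case: (n + j)%N nn => [|m] nn; rewrite nth_default// raddf0// normr0.
have tot : ell2_norm (fun j => ratseq s j - x j) ^+ 2 <= d + d.
  apply: norm_le_sum_sqr => k.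
  apply: le_trans (_ : _ <= \sum_(j < n + k) (ratseq s j - x j) ^+ 2) _.
    rewrite addnC big_split_ord/= lerDl.
    by apply: sumr_ge0 => j _; exact: sqr_ge0.
  rewrite big_split_ord/= lerD//.
    apply: le_trans (_ : _ <= \sum_(j < n) d / n.+1%:R) _.
      by apply: ler_sum => j _; exact: close.
    clearbody d; rewrite sumr_const card_ord -[leLHS]mulr_natr mulrAC ler_pdivrMr//.
    by apply: ler_wpM2l; [exact: ltW|rewrite ler_nat].
  apply: le_trans (tail k); apply: ler_sum => j _.
  by rewrite far sqrrN.
have e2 : d + d < e ^+ 2 by have := exprn_gt0 2 e0; rewrite /d; lra.
rewrite ltNge; apply/negP => h.
have : e ^+ 2 <= ell2_norm (fun j => ratseq s j - x j) ^+ 2.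
  by rewrite ler_pXn2r ?nnegrE ?ell2_norm_ge0// ltW.
by move: tot e2; lra.
Qed.

Lemma ratseq_dist_dense x e : Hplus x -> 0 < e -> exists s, dist (ratseq s) x < e.
Proof.
move=> Hx e0; have [s hs] := ratseq_dense Hx e0; exists s.
apply: le_lt_trans hs; apply: dist_le_norm; apply: Hplus_square_summable => //.
exact: ratseq_Hplus.
Qed.

End HplusFacts.

(** * Laws on H_+ *)

Section Laws.
Context (R : realType) d (Omega : measurableType d) (P : probability Omega R).
Implicit Types (X Y : Omega -> nat -> R).

Definition Hplus_measurable X := forall A, Hplus_borel A -> measurable (X @^-1` A).

(** The laws of f X and f Y agree on open rays, which form a pi-system that
    generates the Borel sets of the line. *)
Lemma same_law_mean X Y (f : (nat -> R) -> R) (B : R) :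
  (forall w, Hplus (X w)) -> (forall w, Hplus (Y w)) ->
  Hplus_measurable X -> Hplus_measurable Y -> same_law P X Y ->
  (forall r, Hplus_borel [set x | Hplus x /\ r < f x]) ->
  (forall x, `|f x| <= B) -> mean P (f \o X) = mean P (f \o Y).
Proof.
move=> HX HY mX mY XY mf fB.
have pre Z r : (forall w, Hplus (Z w)) ->
    Z @^-1` [set x | Hplus x /\ r < f x] = [set w | r < (f \o Z) w].
  by move=> HZ; apply/seteqP; split => w /= => [[]//|]; split.
have mfZ Z : (forall w, Hplus (Z w)) -> Hplus_measurable Z -> measurable_fun setT (f \o Z).
  by move=> HZ mZ; apply: measurable_ray => r; rewrite -pre//; exact: mZ.
have mfX := mfZ X HX mX; have mfY := mfZ Y HY mY.
pose FX : {mfun Omega >-> R} := mfun_Sub (mem_set mfX).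
pose FY : {mfun Omega >-> R} := mfun_Sub (mem_set mfY).
have bX : bounded_rv (f \o X) by split => //; exists B => w; exact: fB.
have bY : bounded_rv (f \o Y) by split => //; exists B => w; exact: fB.
pose G : set (set R) := [set A | exists r : R, A = `]r, +oo[%classic].
have ext A : measurable A -> distribution P FX A = distribution P FY A.
  apply: (@measure_unique _ _ _ G (fun n => `](- n%:R : R), +oo[%classic)).
  - exact: (RGenOInfty.measurableE R).
  - move=> _ _ [r ->] [s ->]; exists (Num.max r s); apply/seteqP; split => x /=.
      by rewrite !in_itv/= !andbT gt_max => -[-> ->].
    by rewrite !in_itv/= !andbT gt_max => /andP[-> ->].
  - by move=> n; exists (- n%:R).
  - apply/seteqP; split => // x _; exists (Num.truncn `|x|).+1 => //=.
    rewrite in_itv/= andbT ltrNl; apply: le_lt_trans (truncnS_gt `|x|).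
    by rewrite -normrN ler_norm.
  - move=> _ [r ->].
    have e (Z : Omega -> nat -> R) : (forall w, Hplus (Z w)) ->
        (f \o Z) @^-1` `]r, +oo[%classic = Z @^-1` [set x | Hplus x /\ r < f x].
      by move=> HZ; rewrite pre//; apply/seteqP; split => w /=; rewrite in_itv/= andbT.
    rewrite -[LHS]/(P ((f \o X) @^-1` _)) -[RHS]/(P ((f \o Y) @^-1` _)).
    by rewrite !e// XY.
  - move=> n; apply: le_lt_trans (ltry 1); exact: probability_le1.
rewrite /mean /Rintegral; congr fine.
have -> : (\int[P]_w ((f \o X) w)%:E = \int[distribution P FX]_y y%:E)%E.
  by rewrite integral_distribution//; exact: (bounded_rv_integrable P bX).
have -> : (\int[P]_w ((f \o Y) w)%:E = \int[distribution P FY]_y y%:E)%E.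
  by rewrite integral_distribution//; exact: (bounded_rv_integrable P bY).
by apply: eq_measure_integral => A mA _; exact: ext.
Qed.

Definition dist_closed (C : set (nat -> R)) := C `<=` @Hplus R /\
  forall x, Hplus x -> (forall e : R, 0 < e -> exists2 y, C y & dist x y < e) -> C x.

Lemma dist_closed_open C : dist_closed C -> dist_open (@Hplus R `\` C).
Proof.
move=> [CH Cc]; split => [|u [Hu nCu]]; first exact: subDsetl.
apply: contrapT => H; apply: nCu; apply: Cc => // e e0.
apply: contrapT => H2; apply: H; exists e => // v Hv vu; split => // Cv.
by apply: H2; exists v => //; rewrite distC.
Qed.

Lemma dist_closed_borel C : dist_closed C -> Hplus_borel C.
Proof.
move=> Cc; have [CH _] := Cc.
have -> : C = @Hplus R `\` (@Hplus R `\` C) by rewrite setDD setIidr.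
by apply: Hplus_borelD; exact: (dist_open_borel (dist_closed_open Cc)).
Qed.

Lemma dist_closedI : setI_closed dist_closed.
Proof.
move=> C D [CH Cc] [DH Dc]; split => [x [/CH]//|x Hx H]; split.
  by apply: Cc => // e /H[y [Cy _] xy]; exists y.
by apply: Dc => // e /H[y [_ Dy] xy]; exists y.
Qed.

(** The norm is lower semicontinuous for the weighted distance: each finite
    partial sum of squares is continuous for it. *)
Lemma norm_ball_closed x r : Hplus x ->
  dist_closed [set y | Hplus y /\ ell2_norm (fun j => y j - x j) <= r].
Proof.
move=> Hx; split => [y []//|y Hy H]; split => //.
have sx := Hplus_square_summable Hx; have sy := Hplus_square_summable Hy.
have r0 : 0 <= r.
  by have [z [_ h] _] := H 1 ltr01; apply: le_trans h; exact: ell2_norm_ge0.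
apply: le_of_sqr => //; apply: norm_le_sum_sqr => n.
apply/ler_addgt0Pr => e e0.
(* Partial sums of (y - x)^2 are at most (1 + l) times those of (z - x)^2
   plus (1 + 1/l) times those of (y - z)^2: l is chosen first, then z. *)
pose l := e / (2 * (r ^+ 2 + 1)).
have r21 : 0 < r ^+ 2 + 1 by have := sqr_ge0 r; lra.
have l0 : 0 < l by rewrite divr_gt0// mulr_gt0.
have lr : l * r ^+ 2 <= e / 2.
  have -> : e / 2 = l * (r ^+ 2 + 1) by rewrite /l; field; rewrite gt_eqF.
  by apply: ler_wpM2l; [exact: ltW|lra].
pose K := (1 + l^-1) * 2 ^+ n.
have K0 : 0 < K by rewrite mulr_gt0 ?exprn_gt0// addr_gt0// invr_gt0.
have q0 : 0 < e / 2 / K by rewrite !divr_gt0.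
have [z [Hz zr] yz] := H (Num.sqrt (e / 2 / K)) (eq_ind_r is_true q0 (sqrtr_gt0 _)).
have sz := Hplus_square_summable Hz.
have dyz : dsq y z <= e / 2 / K.
  rewrite -sqr_dist -[leRHS]sqr_sqrtr ?(ltW q0)//.
  by rewrite ler_pXn2r ?nnegrE ?dist_ge0 ?sqrtr_ge0// ltW.
have h1 : \sum_(j < n) (z j - x j) ^+ 2 <= r ^+ 2.
  apply: le_trans (sum_sqr_le_norm n (square_summableB sz sx)) _.
  by rewrite ler_pXn2r ?nnegrE ?ell2_norm_ge0.
have h2 : \sum_(j < n) (y j - z j) ^+ 2 <= 2 ^+ n * dsq y z.
  apply: le_trans (_ : _ <= 2 ^+ n * psum y z n) _; last first.
    by rewrite ler_wpM2l ?psum_dsq// exprn_ge0.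
  rewrite /psum mulr_sumr; apply: ler_sum => j _; rewrite mulrA.
  rewrite -[leLHS]mul1r ler_wpM2r ?sqr_ge0//.
  rewrite exprVn ler_pdivlMr ?exprn_gt0// mul1r.
  by rewrite ler_weXn2l ?ler1n// ltnW.
have h3 : (1 + l^-1) * (2 ^+ n * dsq y z) <= e / 2.
  by rewrite mulrA mulrC -ler_pdivlMr.
have h4 : \sum_(j < n) (y j - x j) ^+ 2 <=
    (1 + l) * \sum_(j < n) (z j - x j) ^+ 2 + (1 + l^-1) * \sum_(j < n) (y j - z j) ^+ 2.
  rewrite !mulr_sumr -big_split/=; apply: ler_sum => j _.
  have := amgm (z j - x j) (y j - z j) l0.
  have -> : y j - x j = (z j - x j) + (y j - z j) by ring.
  by set p := z j - x j; set q := y j - z j; lra.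
have h5 : (1 + l) * \sum_(j < n) (z j - x j) ^+ 2 <= (1 + l) * r ^+ 2.
  by apply: ler_wpM2l h1; lra.
have h6 : (1 + l^-1) * \sum_(j < n) (y j - z j) ^+ 2 <= (1 + l^-1) * (2 ^+ n * dsq y z).
  by apply: ler_wpM2l h2; rewrite addr_ge0// invr_ge0 ltW.
by move: h3 h4 h5 h6 lr; lra.
Qed.

(** As H_+ is separable, a norm-open set is a countable union of norm balls, and
    these are closed for the weighted distance. *)
Lemma Hplus_open_closed U : Hplus_open U ->
  <<s @Hplus R, dist_closed >> U.
Proof.
move=> [UH Uo].
pose B (i : seq rat * nat) := [set y : nat -> R | Hplus y /\
  ell2_norm (fun j => y j - ratseq R i.1 j) <= i.2.+1%:R^-1].
have -> : U = \bigcup_i (if `[< B i `<=` U >] then B i else set0).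
  apply/seteqP; split => [x Ux|x [i _]]; last by case: asboolP => // + Bx; exact.
  have Hx := UH x Ux; have [e e0 He] := Uo x Ux.
  pose k := Num.truncn (2 / e).
  have ke : k.+1%:R^-1 < e / 2 :> R.
    by rewrite -[ltRHS]invf_div ltf_pV2 ?posrE ?divr_gt0// truncnS_gt.
  have k0 : 0 < k.+1%:R^-1 :> R by rewrite invr_gt0.
  have [s hs] := ratseq_dense Hx k0.
  have nC (a b : nat -> R) : ell2_norm (fun j => a j - b j) = ell2_norm (fun j => b j - a j).
    rewrite /ell2_norm /sqnorm; congr (Num.sqrt (fine _)).
    by apply: eq_eseriesr => j _; rewrite -sqrrN opprB.
  exists (s, k) => //; case: asboolP => [_|].
    by split => //=; rewrite nC ltW.
  case=> y [Hy /= yr]; apply: He => //.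
  have sq := Hplus_square_summable (ratseq_Hplus R s).
  have sy := Hplus_square_summable Hy; have sx := Hplus_square_summable Hx.
  pose a := ell2_norm (fun j => y j - ratseq R s j).
  pose b := ell2_norm (fun j => ratseq R s j - x j).
  have : ell2_norm (fun j => y j - x j) ^+ 2 <= 2 * a ^+ 2 + 2 * b ^+ 2.
    apply: norm_le_sum_sqr => n.
    have h1 := sum_sqr_le_norm n (square_summableB sy sq).
    have h2 := sum_sqr_le_norm n (square_summableB sq sx).
    apply: le_trans (_ : _ <= 2 * \sum_(j < n) (y j - ratseq R s j) ^+ 2 +
      2 * \sum_(j < n) (ratseq R s j - x j) ^+ 2) _; last by rewrite lerD// ler_wpM2l.
    rewrite !mulr_sumr -big_split/=; apply: ler_sum => j _.
    by have := sqr_ge0 ((y j - ratseq R s j) - (ratseq R s j - x j)); lra.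
  have a1 : a ^+ 2 < (e / 2) ^+ 2.
    by rewrite ltr_pXn2r ?nnegrE ?ell2_norm_ge0 ?divr_ge0 ?(ltW e0)// (le_lt_trans yr).
  have b1 : b ^+ 2 < (e / 2) ^+ 2.
    by rewrite ltr_pXn2r ?nnegrE ?ell2_norm_ge0 ?divr_ge0 ?(ltW e0)// (lt_trans hs).
  move=> h; rewrite ltNge; apply/negP => h'.
  have : e ^+ 2 <= ell2_norm (fun j => y j - x j) ^+ 2.
    by rewrite ler_pXn2r ?nnegrE ?ell2_norm_ge0 ?(ltW e0).
  by move: h a1 b1; rewrite expr_div_n; lra.
have -> (F : seq rat * nat -> set (nat -> R)) :
    \bigcup_i F i = \bigcup_n (if unpickle n is Some i then F i else set0).
  apply/seteqP; split => [x [i _ Fi]|x [n _]].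
    by exists (pickle i) => //; rewrite pickleK.
  by case: unpickle => [i|//] Fi; exists i.
apply: sigma_algebra_bigcup => n; case: unpickle => [i|]; last exact: sigma_algebra0.
case: asboolP => _; last exact: sigma_algebra0.
by apply: sub_sigma_algebra; exact/norm_ball_closed/ratseq_Hplus.
Qed.

Lemma Hplus_borelDiff (A B : set (nat -> R)) :
  Hplus_borel A -> Hplus_borel B -> Hplus_borel (A `\` B).
Proof.
move=> hA hB; have -> : A `\` B = @Hplus R `\` ((@Hplus R `\` A) `|` B).
  have AH := Hplus_borel_sub hA.
  apply/seteqP; split => [x [Ax nB]|x [Hx H]].
    by split; [exact: AH|move=> [[_ /(_ Ax)]|/nB]].
  split; last by move=> Bx; apply: H; right.
  by apply: contrapT => nA; apply: H; left.
apply: Hplus_borelD; rewrite -bigcup2E; apply: sigma_algebra_bigcup.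
by move=> [|[|n]]/=; [exact: Hplus_borelD| |exact: sigma_algebra0].
Qed.

Lemma Hplus_borelI (A B : set (nat -> R)) :
  Hplus_borel A -> Hplus_borel B -> Hplus_borel (A `&` B).
Proof.
move=> hA hB; have -> : A `&` B = A `\` (A `\` B) by rewrite setDD.
by apply: (Hplus_borelDiff hA); exact: (Hplus_borelDiff hA hB).
Qed.

Lemma same_law_closed X Y :
  (forall w, Hplus (X w)) -> (forall w, Hplus (Y w)) ->
  Hplus_measurable X -> Hplus_measurable Y ->
  (forall C, dist_closed C -> P (X @^-1` C) = P (Y @^-1` C)) -> same_law P X Y.
Proof.
move=> HX HY mX mY XY.
pose L := [set A | Hplus_borel A /\ P (X @^-1` A) = P (Y @^-1` A)].
have LC : dist_closed `<=` L.
  by move=> C Cc; split; [exact: dist_closed_borel|exact: XY].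
have Psub Z A B : Hplus_measurable Z -> Hplus_borel A -> Hplus_borel B -> B `<=` A ->
    P (Z @^-1` (A `\` B)) = (P (Z @^-1` A) - P (Z @^-1` B))%E.
  move=> mZ hA hB BA; rewrite (_ : Z @^-1` (A `\` B) = Z @^-1` A `\` Z @^-1` B)// measureD; [|exact: mZ|exact: mZ|].
    by rewrite setIidr//; exact: preimage_subset.
  apply: (le_lt_trans (y := 1%E)); last exact: ltry.
  by apply: probability_le1; exact: mZ.
have lamL : lambda_system (@Hplus R) L.
  split.
  - by move=> A [/Hplus_borel_sub].
  - split; first exact: Hplus_borel_Hplus.
    have e Z : (forall w, Hplus (Z w)) -> Z @^-1` (@Hplus R) = [set: Omega].
      by move=> HZ; apply/seteqP; split => // w _; exact: HZ.
    by rewrite !e.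
  - by move=> A B BA [hA PA] [hB PB]; split; [exact: Hplus_borelDiff|rewrite !Psub// PA PB].
  - move=> A ndA LA; have hA n : Hplus_borel (A n) by case: (LA n).
    have hU : Hplus_borel (\bigcup_i A i) by exact: sigma_algebra_bigcup.
    split => //; rewrite !preimage_bigcup.
    have cv Z : Hplus_measurable Z ->
        (fun n => P (Z @^-1` A n)) @ \oo --> P (\bigcup_i (Z @^-1` A i)).
      move=> mZ; apply: nondecreasing_cvg_mu.
      + by move=> n; exact: mZ.
      + by apply: bigcupT_measurable => n; exact: mZ.
      + move=> m n mn; have /subsetPset Amn := ndA _ _ mn.
        by apply/subsetPset => w; exact: Amn.
    have := cv X mX; rewrite (_ : (fun n => _) = (fun n => P (Y @^-1` A n))); last first.
      by apply/funext => n; case: (LA n).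
    by move/(cvg_unique _); apply => //; exact: cv.
move=> A hA; suff: L A by case.
have HCH : forall V, <<s @Hplus R, dist_closed >> V -> V `<=` @Hplus R.
  move=> V hV; apply: (smallest_sub (X := [set V | V `<=` @Hplus R]) _ _ hV) => //.
    split => [|B _|F hF].
    - exact: sub0set.
    - exact: subDsetl.
    - by apply: bigcup_sub => i _; exact: hF.
  by move=> W [].
have := lambda_system_subset dist_closedI lamL LC HCH; apply.
apply: (smallest_sub (X := <<s @Hplus R, dist_closed >>) _ _ hA).
  exact: smallest_sigma_algebra.
exact: Hplus_open_closed.
Qed.

End Laws.

Section LawLipschitz.
Context (R : realType) d (Omega : measurableType d) (P : probability Omega R).

Definition Hplus_point := {x : nat -> R | Hplus x}.
Definition point_dist (x y : Hplus_point) : R := dist (sval x) (sval y).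

Lemma point_dist_ge0 x y : 0 <= point_dist x y. Proof. exact: dist_ge0. Qed.
Lemma point_distxx x : point_dist x x = 0. Proof. exact: distxx. Qed.
Lemma point_distC x y : point_dist x y = point_dist y x. Proof. exact: distC. Qed.
Lemma point_dist_triangle x y z : point_dist x z <= point_dist x y + point_dist y z.
Proof. by apply: Hplus_dist_triangle; exact: svalP. Qed.

Lemma blip1_open (f : Hplus_point -> R) r : blip1 point_dist f ->
  dist_open [set x | exists Hx : Hplus x, r < f (exist _ x Hx)].
Proof.
move=> [L [B [L0 _ hL]]]; split => [x []//|x [Hx fx]].
have d0 : 0 < (f (exist _ x Hx) - r) / (L + 1) by rewrite divr_gt0 ?subr_gt0//; lra.
exists ((f (exist _ x Hx) - r) / (L + 1)) => // v Hv vx; exists Hv.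
have := hL (exist _ v Hv) (exist _ x Hx) (exist _ x Hx) (exist _ x Hx).
rewrite point_distxx addr0 ler_norml => /andP[h _].
have : L * point_dist (exist _ v Hv) (exist _ x Hx) <=
  L * ((f (exist _ x Hx) - r) / (L + 1)) by apply: ler_wpM2l => //; exact: ltW.
have : (L + 1) * ((f (exist _ x Hx) - r) / (L + 1)) = f (exist _ x Hx) - r.
  by rewrite mulrC divfK// gt_eqF//; lra.
by move: h d0; rewrite mulrDl; lra.
Qed.

Lemma blip1_bounded_rv (f : Hplus_point -> R) (U : Omega -> Hplus_point) : blip1 point_dist f ->
  Hplus_measurable (fun w => sval (U w)) -> bounded_rv (f \o U).
Proof.
move=> bf mU; split; last by have [L [B [_ h _]]] := bf; exists B => w; exact: (h (U w) (U w)).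
apply: measurable_ray => r.
rewrite (_ : [set t | _] = (fun w => sval (U w)) @^-1`
    [set x | exists Hx : Hplus x, r < f (exist _ x Hx)]).
  by apply: mU; apply: dist_open_borel; exact: blip1_open.
have E w (Hx : Hplus (sval (U w))) : exist _ _ Hx = U w.
  by case: (U w) Hx => u Hu Hx; congr exist; exact: Prop_irrelevance.
apply/seteqP; split => w /=; last by move=> [Hx]; rewrite E.
by move=> h; exists (svalP (U w)); rewrite E.
Qed.

(** The functions max 0 (1 - dist (x, C) / e) decrease to the indicator function
    of the closed set C as e tends to 0. *)
Lemma same_law_lip (X Y : Omega -> Hplus_point) :
  Hplus_measurable (fun w => sval (X w)) -> Hplus_measurable (fun w => sval (Y w)) ->
  (forall f, blip1 point_dist f -> mean P (f \o X) = mean P (f \o Y)) ->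
  same_law P (fun w => sval (X w)) (fun w => sval (Y w)).
Proof.
move=> mX mY XY; apply: same_law_closed => //; try by move=> w; exact: svalP.
suff main (Z V : Omega -> Hplus_point) C : Hplus_measurable (fun w => sval (Z w)) ->
    Hplus_measurable (fun w => sval (V w)) ->
    (forall f, blip1 point_dist f -> mean P (f \o Z) = mean P (f \o V)) ->
    dist_closed C ->
    (P ((fun w => sval (Z w)) @^-1` C) <= P ((fun w => sval (V w)) @^-1` C))%E.
  move=> C Cc; apply/eqP; rewrite eq_le; apply/andP; split; apply: main => //.
  by move=> f bf; rewrite XY.
move=> mZ mV ZV Cc; have hC := dist_closed_borel Cc.
have [[c0 Cc0]|C0] := pselect (C !=set0); last first.
  rewrite (_ : C = set0); last by apply/seteqP; split => // x Cx; case: C0; exists x.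
  by rewrite !preimage_set0.
have [CH Cl] := Cc.
pose K (_ : nat) := [set x : Hplus_point | C (sval x)].
have K0 : K 0%N !=set0 by exists (exist _ c0 (CH _ Cc0)).
pose Ce (e : R) := [set x : nat -> R | Hplus x /\ exists2 y, C y & dist x y < e].
have Ceo e : dist_open (Ce e).
  split => [x []//|x [Hx [y Cy xy]]]; exists (e - dist x y); first by rewrite subr_gt0.
  move=> v Hv vx; split => //; exists y => //.
  apply: le_lt_trans (Hplus_dist_triangle Hv Hx (CH _ Cy)) _.
  by rewrite -ltrBrDr.
have step_path e : 0 < e ->
    (P ((fun w => sval (Z w)) @^-1` C) <= P ((fun w => sval (V w)) @^-1` Ce e))%E.
  move=> e0; pose f x := 1 + -1 * escape point_dist K 0 e x.
  have bf : blip1 point_dist f.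
    apply: (blipD (blip_cst _ 1)); apply: blipZ.
    exact: (blip1_escape point_dist_ge0 point_distC point_dist_triangle e0 K0).
  have mf U mU := blip1_bounded_rv (U := U) bf mU.
  have m1 := mZ _ hC; have m2 := mV _ (dist_open_borel (Ceo e)).
  rewrite -[leLHS]fineK ?fin_num_measure// -[leRHS]fineK ?fin_num_measure// lee_fin.
  rewrite -!mean_indic//.
  apply: le_trans (_ : _ <= mean P (f \o Z)) _.
    apply: mean_le; [exact: bounded_rv_indic|exact: mf|] => w.
    rewrite indicE; have [/set_mem Cw|_] := boolP (w \in _).
      have := dist_to_lb point_dist_ge0 (K := K) (m := 0%N) (Z w) (Cw : K 0%N (Z w)).
      rewrite point_distxx => h /=; rewrite /f /escape.
      have : Num.min 1 (dist_to point_dist K 0 (Z w) / e) <= 0.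
        by rewrite ge_min; apply/orP; right; rewrite ler_pdivrMr// mul0r.
      by rewrite /=; lra.
    by rewrite /f /escape/= mulN1r subr_ge0 ge_min lexx.
  rewrite ZV//; apply: mean_le; [exact: mf|exact: bounded_rv_indic|] => w.
  rewrite indicE; have [_|nw] := boolP (w \in _).
    have : 0 <= escape point_dist K 0 e (V w).
      by rewrite /escape le_min ler01 divr_ge0 ?(dist_to_ge0 point_dist_ge0)// ltW.
    by rewrite /f/=; lra.
  have : e <= dist_to point_dist K 0 (V w).
    rewrite leNgt; apply/negP => /(dist_to_lt point_dist_ge0 K0)[q Kq Vq].
    move: nw; rewrite notin_setE; apply; split; first exact: svalP.
    by exists (sval q).
  by move=> h; rewrite /f/= /escape min_l ?mulr1 ?subrr// ler_pdivlMr// mul1r.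
pose a k : R := k.+1%:R^-1.
have CE : (fun w => sval (V w)) @^-1` C = \bigcap_k ((fun w => sval (V w)) @^-1` Ce (a k)).
  apply/seteqP; split => w /=.
    move=> Cw k _; split; first exact: svalP.
    by exists (sval (V w)) => //; rewrite distxx invr_gt0.
  move=> h; apply: Cl; first exact: svalP.
  move=> e e0; have [_ [y Cy vy]] := h (Num.truncn e^-1) I; exists y => //.
  apply: lt_trans vy _; rewrite /a -[ltRHS]invrK ltf_pV2 ?posrE ?invr_gt0//.
  exact: truncnS_gt.
have mE k : measurable ((fun w => sval (V w)) @^-1` Ce (a k)).
  exact: (mV _ (dist_open_borel (Ceo (a k)))).
have cv : (fun k => P ((fun w => sval (V w)) @^-1` Ce (a k))) @ \oo -->
    P ((fun w => sval (V w)) @^-1` C).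
  rewrite CE; apply: nonincreasing_cvg_mu => //.
  - by apply: (le_lt_trans (y := 1%E)); [exact: probability_le1|exact: ltry].
  - exact: bigcapT_measurable.
  - move=> m n mn; apply/subsetPset => w /= [Hw [y Cy wy]]; split => //; exists y => //.
    by apply: lt_le_trans wy _; rewrite lef_pV2 ?posrE// ler_nat.
rewrite -(cvg_lim _ cv)//; apply: lime_ge; first by apply/cvg_ex; eexists; exact: cv.
by apply: nearW => k; apply: step_path; rewrite invr_gt0.
Qed.

End LawLipschitz.

(** * Compactness of norm balls *)

Section Compactness.
Import ArrowAsProduct.
Variable R : realType.
Implicit Types (C e : R).

(** Uniform smallness of the tails of the weighted distance on norm balls. *)
Lemma psum_tail (a p : nat -> R) C D n m :
  (forall n, \sum_(j < n) a j ^+ 2 <= C) -> (forall n, \sum_(j < n) p j ^+ 2 <= D) ->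
  psum a p (n + m) <= psum a p n + 2^-1 ^+ n * (2 * C + 2 * D).
Proof.
move=> aC pD; rewrite /psum big_split_ord/= lerD2l.
apply: le_trans (_ : _ <= \sum_(j < m) 2^-1 ^+ n * (a (n + j)%N - p (n + j)%N) ^+ 2) _.
  apply: ler_sum => j _; rewrite ler_wpM2r ?sqr_ge0// exprD ler_piMr ?half_ge0//.
  exact: half_le1.
rewrite -mulr_sumr ler_wpM2l ?half_ge0//.
have ha : \sum_(j < m) a (n + j)%N ^+ 2 <= C.
  apply: le_trans (aC (n + m)%N); rewrite big_split_ord/= lerDr.
  by apply: sumr_ge0 => j _; exact: sqr_ge0.
have hp : \sum_(j < m) p (n + j)%N ^+ 2 <= D.
  apply: le_trans (pD (n + m)%N); rewrite big_split_ord/= lerDr.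
  by apply: sumr_ge0 => j _; exact: sqr_ge0.
apply: le_trans (_ : _ <= 2 * \sum_(j < m) a (n + j)%N ^+ 2 +
    2 * \sum_(j < m) p (n + j)%N ^+ 2) _; last by rewrite lerD// ler_wpM2l.
rewrite !mulr_sumr -big_split/=; apply: ler_sum => j _.
by have := sqr_ge0 (a (n + j)%N + p (n + j)%N); lra.
Qed.

(** The coordinates stay in a segment, so that Tychonoff's theorem gives a
    cluster point of the sequence of pairs for pointwise convergence, and
    [psum_tail] turns pointwise convergence into convergence in the distance. *)
Lemma ball_seq_compact (a b : nat -> nat -> R) C :
  (forall k, Hplus (a k)) -> (forall k, Hplus (b k)) ->
  (forall k n, \sum_(j < n) a k j ^+ 2 <= C) ->
  (forall k n, \sum_(j < n) b k j ^+ 2 <= C) ->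
  exists x y, [/\ Hplus x, Hplus y & forall e N, 0 < e ->
    exists2 k, (N <= k)%N & dist (a k) x < e /\ dist (b k) y < e].
Proof.
move=> Ha Hb aC bC.
have C0 : 0 <= C by have := aC 0%N 0%N; rewrite big_ord0.
pose M := 1 + C.
pose z k (i : bool * nat) : R := if i.1 then a k i.2 else b k i.2.
pose A : set (forall i : bool * nat, R) := [set f | forall i, `[- M, M]%classic (f i)].
have cA : compact A.
  exact: (@tychonoff (bool * nat)%type (fun _ => R : topologicalType)
    (fun _ => `[- M, M]%classic) (fun _ => @segment_compact R (- M) M)).
have zA k : A (z k).
  have zM (c : nat -> R) j : (forall n, \sum_(j < n) c j ^+ 2 <= C) -> `[- M, M]%classic (c j).
    move=> /(sqr_le_sum j) h; rewrite /= in_itv/= -ler_norml.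
    by apply: le1D_of_sqr; rewrite real_normK ?num_real.
  by move=> [[] j]; exact: zM.
have [p [Ap clp]] : A `&` cluster (z @ \oo) !=set0.
  by apply: cA; exists 0%N => // k _; exact: zA.
pose x j := p (true, j); pose y j := p (false, j).
have near n s N : 0 < s -> exists2 k, (N <= k)%N &
    forall j, (j < n)%N -> `|a k j - x j| < s /\ `|b k j - y j| < s.
  move=> s0.
  have Vn : nbhs p [set f : forall i : bool * nat, R | forall j, (j < n)%N ->
      `|f (true, j) - x j| < s /\ `|f (false, j) - y j| < s].
    elim: n => [|n IH]; first exact: filterE.
    have V1 i : nbhs p [set f : forall i : bool * nat, R | `|f i - p i| < s].
      have := @proj_continuous _ (fun _ : bool * nat => R) i p.
      move=> /cvgrPdist_lt/(_ _ s0); apply: filterS => f /=.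
      by rewrite distrC.
    apply: (filterS _ (filterI IH (filterI (V1 (true, n)) (V1 (false, n))))).
    move=> f [H [f1 f2]] j; rewrite ltnS leq_eqVlt => /predU1P[->//|].
    exact: H.
  have ZN : (z @ \oo) [set f | exists2 k, (N <= k)%N & f = z k].
    by exists N => // k Nk; exists k.
  have [f [[k Nk ->] H]] := clp _ _ ZN Vn.
  by exists k.
have lim_ss (c : nat -> nat -> R) q : (forall k n, \sum_(j < n) c k j ^+ 2 <= C) ->
    (forall n s, 0 < s -> exists k, forall j, (j < n)%N -> `|c k j - q j| < s) ->
    forall n, \sum_(j < n) q j ^+ 2 <= 2 * C + 2.
  move=> cC cq n; have s0 : 0 < n.+1%:R^-1 :> R by rewrite invr_gt0.
  have [k Hk] := cq n _ s0.
  apply: le_trans (_ : _ <= 2 * (\sum_(j < n) c k j ^+ 2) + \sum_(j < n) 2 * n.+1%:R^-1) _.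
    rewrite mulr_sumr -big_split/=; apply: ler_sum => j _.
    have h := ltW (Hk j (ltn_ord j)).
    have h1 : (c k j - q j) ^+ 2 <= n.+1%:R^-1.
      rewrite -real_normK ?num_real// expr2 -[leRHS]mulr1 ler_pM//.
      by apply: le_trans h _; rewrite invf_le1 ?ler1n.
    move: h1 (sqr_ge0 (q j - c k j - c k j)).
    by move: (n.+1%:R^-1 : R) (q j) (c k j) => i qj cj; lra.
  rewrite sumr_const card_ord lerD// ?ler_wpM2l//.
  by rewrite -[leLHS]mulr_natr mulrAC ler_pdivrMr// ler_wpM2l// ler_nat.
have ge0 (c : nat -> nat -> R) q : (forall k, Hplus (c k)) ->
    (forall n s, 0 < s -> exists k, forall j, (j < n)%N -> `|c k j - q j| < s) ->
    forall j, (1 <= j)%N -> 0 <= q j.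
  move=> Hc cq j j1; rewrite leNgt; apply/negP => qj.
  have s0 : 0 < - q j by lra.
  have [k Hk] := cq j.+1 _ s0; have := Hk j (ltnSn _).
  by have := (Hc k).2 j j1; rewrite ltr_norml => h /andP[_]; lra.
have ax n s : 0 < s -> exists k, forall j, (j < n)%N -> `|a k j - x j| < s.
  by move=> s0; have [k _ Hk] := near n s 0%N s0; exists k => j /Hk[].
have by_ n s : 0 < s -> exists k, forall j, (j < n)%N -> `|b k j - y j| < s.
  by move=> s0; have [k _ Hk] := near n s 0%N s0; exists k => j /Hk[].
have xC := lim_ss _ _ aC ax; have yC := lim_ss _ _ bC by_.
have Hx : Hplus x by split; [apply/ell2P; exists (2 * C + 2)|exact: ge0 Ha ax].
have Hy : Hplus y by split; [apply/ell2P; exists (2 * C + 2)|exact: ge0 Hb by_].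
exists x, y; split => // e N e0.
pose K := 2 * C + 2 * (2 * C + 2).
have K0 : 0 < K by rewrite /K; lra.
pose d := e ^+ 2 / 4; have d0 : 0 < d by rewrite divr_gt0// exprn_gt0.
have [n Hn] : exists n, 2^-1 ^+ n * K <= d.
  have : (fun n => 2^-1 ^+ n * K) @ \oo --> 0 * K.
    by apply: cvgMl; apply: cvg_expr; rewrite ger0_norm ?invr_ge0// invf_lt1// ltr1n.
  rewrite mul0r => /cvgr0Pnorm_le/(_ _ d0)[n _ Hn]; exists n.
  by have := Hn n (leqnn n); apply: le_trans; exact: ler_norm.
have s0 : 0 < Num.min 1 (d / n.+1%:R) by rewrite lt_min ltr01 divr_gt0.
have [k Nk Hk] := near n _ N s0; exists k => //.
have fin (c q : nat -> R) : (forall n, \sum_(j < n) c j ^+ 2 <= C) ->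
    (forall n, \sum_(j < n) q j ^+ 2 <= 2 * C + 2) ->
    (forall j, (j < n)%N -> `|c j - q j| < Num.min 1 (d / n.+1%:R)) -> dist c q < e.
  move=> cC qC cq.
  have h1 : psum c q n <= d.
    apply: le_trans (_ : _ <= \sum_(j < n) d / n.+1%:R) _.
      apply: ler_sum => j _; have := ltW (cq j (ltn_ord j)).
      rewrite le_min => /andP[h1 h2].
      apply: le_trans (_ : _ <= 1 * (c j - q j) ^+ 2) _.
        by rewrite ler_wpM2r ?sqr_ge0// half_le1.
      by rewrite mul1r -real_normK ?num_real// expr2 -[leRHS]mul1r ler_pM.
    clearbody d; rewrite sumr_const card_ord -[leLHS]mulr_natr mulrAC ler_pdivrMr//.
    by apply: ler_wpM2l; [exact: ltW|rewrite ler_nat].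
  have h2 : dsq c q <= d + d.
    apply: dsq_le => m; have := psum_tail n m cC qC.
    have := psum_homo c q (leq_addl n m); rewrite -/K; lra.
  rewrite ltNge; apply/negP => h.
  have : e ^+ 2 <= dsq c q by rewrite -sqr_dist ler_pXn2r ?nnegrE ?dist_ge0// ltW.
  by have := exprn_gt0 2 e0; rewrite /d in h2; lra.
by split; apply: fin => // j /Hk[].
Qed.

End Compactness.

(** * Supports, and solutions started in a support *)

Section SigmaAlgebra.
Variables (Omega : Type) (G : set (set Omega)).
Hypothesis sG : sigma_algebra setT G.

Lemma sigmaC A : G A -> G (~` A).
Proof. by case: sG => _ h _ hA; rewrite -setTD; exact: h. Qed.

Lemma sigma_bigcup (I : countType) (A : I -> set Omega) :
  (forall i, G (A i)) -> G (\bigcup_i A i).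
Proof.
move=> GA.
have -> : \bigcup_i A i = \bigcup_n (if unpickle n is Some i then A i else set0).
  apply/seteqP; split => [x [i _ Fi]|x [n _]].
    by exists (pickle i) => //; rewrite pickleK.
  by case: unpickle => [i|//] Fi; exists i.
by case: sG => G0 _; apply => n; case: unpickle.
Qed.

Lemma sigma_bigcap (I : countType) (A : I -> set Omega) :
  (forall i, G (A i)) -> G (\bigcap_i A i).
Proof.
move=> GA; rewrite -[X in G X]setCK setC_bigcap; apply: sigmaC.
by apply: sigma_bigcup => i; exact: sigmaC.
Qed.

Lemma sigmaI A B : G A -> G B -> G (A `&` B).
Proof. by move=> GA GB; rewrite -bigcap2E; apply: sigma_bigcap => -[|[|[|n]]]//=; case: sG => G0 _ _; rewrite -setC0; exact: sigmaC. Qed.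

Lemma sigmaU A B : G A -> G B -> G (A `|` B).
Proof.
move=> GA GB; rewrite -[X in G X]setCK setCU; apply: sigmaC.
by apply: sigmaI; exact: sigmaC.
Qed.

End SigmaAlgebra.

Lemma small_inv (R : realType) (e : R) : 0 < e ->
  exists N, forall k, (N <= k)%N -> k.+1%:R^-1 <= e.
Proof.
move=> e0; exists (Num.truncn e^-1) => k Nk.
rewrite -[leRHS]invrK lef_pV2 ?posrE ?invr_gt0//.
by apply: ltW; apply: lt_le_trans (truncnS_gt _) _; rewrite ler_nat ltnS.
Qed.

Section Support.
Context (R : realType) d (Omega : measurableType d) (P : probability Omega R).
Implicit Types (X Y : Omega -> nat -> R) (x y : nat -> R) (e : R).

Definition Hball x e := [set y : nat -> R | Hplus y /\ dist y x < e].

(** The topological support of the law of X, for the weighted distance. *)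
Definition supp X := [set x : nat -> R | Hplus x /\
  forall e, 0 < e -> (0 < P (X @^-1` Hball x e))%E].

Lemma Hball_borel x e : Hplus x -> Hplus_borel (Hball x e).
Proof. by move=> Hx; apply: dist_open_borel; exact: ball_dist_open. Qed.

Lemma Hball_sub x y e r : Hplus x -> Hplus y -> dist y x < r -> e <= r - dist y x ->
  Hball y e `<=` Hball x r.
Proof.
move=> Hx Hy yx er z [Hz zy]; split => //.
by apply: le_lt_trans (Hplus_dist_triangle Hz Hy Hx) _; lra.
Qed.

Lemma supp_closed X : Hplus_measurable X -> dist_closed (supp X).
Proof.
move=> mX; split => [x []//|x Hx H]; split => // e e0.
have e20 : 0 < e / 2 by rewrite divr_gt0.
have [y [Hy Py] xy] := H _ e20.
apply: lt_le_trans (Py _ e20) _; apply: le_measure; rewrite ?inE.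
- by apply: mX; exact: Hball_borel.
- by apply: mX; exact: Hball_borel.
- by apply: preimage_subset; apply: Hball_sub => //; rewrite distC; lra.
Qed.

Lemma same_law_supp X Y : same_law P X Y -> supp X = supp Y.
Proof.
move=> XY; apply/seteqP; split => x [Hx Px]; split => // e e0.
  by rewrite -XY; [exact: Px|exact: Hball_borel].
by rewrite XY; [exact: Px|exact: Hball_borel].
Qed.

(** The complement of the support is a countable union of null balls centred at
    finite rational sequences. *)
Lemma supp_null X : Hplus_measurable X -> P (X @^-1` (@Hplus R `\` supp X)) = 0.
Proof.
move=> mX.
pose B (i : seq rat * nat) := Hball (ratseq R i.1) i.2.+1%:R^-1.
pose N := \bigcup_i (if `[< P (X @^-1` B i) = 0%E >] then X @^-1` B i else set0).
have mB i : measurable (X @^-1` B i).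
  by apply: mX; apply: Hball_borel; exact: ratseq_Hplus.
have mN i : measurable (if `[< P (X @^-1` B i) = 0%E >] then X @^-1` B i else set0).
  by case: ifP.
have N0 : P.-negligible N.
  rewrite /N.
  have -> (F : seq rat * nat -> set Omega) :
      \bigcup_i F i = \bigcup_n (if unpickle n is Some i then F i else set0).
    apply/seteqP; split => [x [i _ Fi]|x [n _]].
      by exists (pickle i) => //; rewrite pickleK.
    by case: unpickle => [i|//] Fi; exists i.
  apply: negligible_bigcup => n; case: unpickle => [i|]; last exact: negligible_set0.
  by case: asboolP => h; [apply/negligibleP|exact: negligible_set0].
have := dist_closed_borel (supp_closed mX) => bs.
apply/negligibleP; first by apply: mX; exact: Hplus_borelD.
apply: negligibleS N0 => w [HX nX].
have [e e0 Pe] : exists2 e, 0 < e & P (X @^-1` Hball (X w) e) = 0%E.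
  apply: contrapT => H; apply: nX; split => // e e0.
  by rewrite lt0e measure_ge0 andbT; apply/eqP => h; apply: H; exists e.
pose k := Num.truncn (2 / e).
have ke : k.+1%:R^-1 < e / 2 :> R.
  by rewrite -[ltRHS]invf_div ltf_pV2 ?posrE ?divr_gt0// truncnS_gt.
have k0 : 0 < k.+1%:R^-1 :> R by rewrite invr_gt0.
have [s hs] := ratseq_dist_dense HX k0.
exists (s, k) => //; case: asboolP => [_|].
  by split => //; rewrite distC.
case; apply/eqP; rewrite eq_le measure_ge0 andbT -Pe.
apply: le_measure; rewrite ?inE; [exact: mB|by apply: mX; exact: Hball_borel|].
apply: preimage_subset; apply: Hball_sub => //.
- exact: ratseq_Hplus.
- by apply: lt_trans hs (lt_trans ke _); rewrite ltr_pdivrMr// ltr_pMr// ltr1n.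
- move: hs ke => /=; move: (k.+1%:R^-1 : R) (dist _ _) => r q; lra.
Qed.

End Support.

Section Existence.
Context (R : realType) d (Omega : measurableType d) (P : probability Omega R).
Variables (T sigma gamma : R) (V : Omega -> R -> R) (F G : set (set Omega)).
Hypotheses (T0 : 0 < T) (gamma1 : 1 <= gamma) (gamma2 : gamma < 2).
Hypotheses (FO : F `<=` measurable) (GO : G `<=` measurable).
Hypotheses (sG : sigma_algebra setT G) (FG : independent_sys P F G).
Hypotheses (V0 : forall w, V w 0 = 0) (Vc : forall w, cont T (V w)).
Variable B : nat -> nat -> set Omega.
Hypothesis GB : forall k n, G (B k n).
Hypothesis Bcov : forall k w, exists n, B k n w.
Hypothesis Bsmall : forall k n w w', B k n w -> B k n w' ->
  forall t : R, t \in `[0, T] -> `|V w t - V w' t| <= k.+1%:R^-1.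

Lemma sol_in_Hplus w u t : sol T sigma gamma w u -> t \in `[0, T] -> Hplus (u t).
Proof.
move=> su tT; split; first by apply/ell2P; exact: (sol_square_summable T0 gamma1 su tT).
by move=> [//|j] _; exact: (sol_ge0 su).
Qed.

(** The support of the law of the driver, where the cells B k n are the
    neighbourhoods of size about 1 / k. *)
Definition typical_driver :=
  \bigcap_k \bigcup_n (if `[< (0 < P (B k n))%E >] then B k n else set0).

Lemma typical_driver_G : G typical_driver.
Proof.
apply: sigma_bigcap => // k; apply: sigma_bigcup => // n.
by case: ifP => // _; case: sG.
Qed.

Lemma typical_driver_ae : {ae P, forall w, typical_driver w}.
Proof.
exists (~` typical_driver); split => //.
  by apply: measurableC; apply: GO; exact: typical_driver_G.
apply/negligibleP; first by apply: measurableC; apply: GO; exact: typical_driver_G.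
rewrite /typical_driver setC_bigcap.
apply: (@negligibleS _ _ _ _ (\bigcup_k \bigcup_n
   (if `[< (0 < P (B k n))%E >] then set0 else B k n))).
  move=> w [k _ nk]; exists k => //; have [n Bn] := Bcov k w; exists n => //.
  by case: asboolP => // h; case: nk; exists n => //; case: asboolP.
apply: negligible_bigcup => k; apply: negligible_bigcup => n.
case: asboolP => h; first exact: negligible_set0.
apply/negligibleP; first exact/GO/GB.
by apply/eqP; rewrite eq_le measure_ge0 andbT leNgt; apply/negP.
Qed.

Definition joins w x y := exists u, [/\ sol T sigma gamma (V w) u,
  forall j, u 0 j = x j & forall j, u T j = y j].

(** The event that X is close to x and the event that the driver is close to V w
    are independent and have positive probabilities. So they have a common
    sample point at which moreover the path joins X to X' and X' lies in the
    support. These paths converge to the desired solution by [sol_closed]. *)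
Lemma flow_exists (X X' : Omega -> nat -> R) x w :
  (forall A, Hplus_borel A -> F (X @^-1` A)) -> (forall w, Hplus (X' w)) ->
  Hplus_measurable X' -> same_law P X X' ->
  {ae P, forall w, joins w (X w) (X' w)} ->
  supp P X x -> typical_driver w ->
  exists u, [/\ sol T sigma gamma (V w) u, forall j, u 0 j = x j & supp P X (u T)].
Proof.
move=> FX HX' mX' XX' joinX [Hx Px] tw.
have mX : Hplus_measurable X by move=> A hA; exact/FO/FX.
have mT : T \in `[0, T] by rewrite in_itv/= lexx ltW.
have aeX' : {ae P, forall w, supp P X (X' w)}.
  exists (X' @^-1` (@Hplus R `\` supp P X)); split.
  - have bs := dist_closed_borel (supp_closed P mX).
    by apply: mX'; exact: Hplus_borelD.
  - by rewrite (same_law_supp XX'); exact: supp_null.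
  - by move=> v nv; split.
have pick k : exists v u, [/\ forall t : R, t \in `[0, T] -> `|V v t - V w t| <= k.+1%:R^-1,
    sol T sigma gamma (V v) u, dist (u 0) x < k.+1%:R^-1 & supp P X (u T)].
  have [n _] := tw k I; case: asboolP => // PB Bw.
  have k0 : 0 < k.+1%:R^-1 :> R by rewrite invr_gt0.
  have FA : F (X @^-1` Hball x k.+1%:R^-1) by apply: FX; exact: Hball_borel.
  have PA : (0 < P ((X @^-1` Hball x k.+1%:R^-1) `&` B k n))%E.
    by rewrite FG// mule_gt0//; exact: Px.
  have [v [[[HXv Xv] Bv] [u [su u0 uT]] sX']] : exists v,
      [/\ ((X @^-1` Hball x k.+1%:R^-1) `&` B k n) v, joins v (X v) (X' v) & supp P X (X' v)].
    apply: contrapT => H; move: PA; rewrite lt0e => /andP[/eqP + _]; apply.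
    apply/negligibleP; first by apply: measurableI; [exact/FO|exact/GO/GB].
    have N : P.-negligible (~` [set v | joins v (X v) (X' v)] `|`
        ~` [set v | supp P X (X' v)]) by exact: negligibleU.
    apply: negligibleS N => v AB; apply: contrapT => /not_orP[].
    by move=> /contrapT h1 /contrapT h2; apply: H; exists v.
  exists v, u; split => //.
  - by move=> t tT; exact: (Bsmall Bv Bw).
  - by rewrite (_ : u 0 = X v)//; exact/funext.
  - by rewrite (_ : u T = X' v)//; exact/funext.
have [v /choice[u H]] := choice pick.
have sx := Hplus_square_summable Hx.
have [U [sU U0 UT]] : exists U, [/\ sol T sigma gamma (V w) U, forall j, U 0 j = x j &
    forall e, 0 < e -> exists N, forall k, (N <= k)%N -> dsq (u k T) (U T) <= e].
  apply: (@sol_closed _ _ _ _ T0 gamma1 gamma2 (V w) x (fun k => V (v k)) u) => //.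
  - by move=> k; case: (H k).
  - move=> e /small_inv[N hN]; exists N => k Nk t tT; have [h _ _ _] := H k.
    by apply: le_trans (h t tT) _; exact: hN.
  - move=> e e0; have se : 0 < Num.sqrt e by rewrite sqrtr_gt0.
    have [N hN] := small_inv se; exists N => k Nk; have [_ _ h _] := H k.
    rewrite -sqr_dist -[leRHS]sqr_sqrtr ?(ltW e0)//.
    by rewrite ler_pXn2r ?nnegrE ?dist_ge0 ?sqrtr_ge0// (le_trans (ltW h))// hN.
exists U; split => //.
have [_ cl] := supp_closed P mX; apply: cl; first exact: sol_in_Hplus sU mT.
move=> e e0; have e2 : 0 < (e / 2) ^+ 2 by rewrite exprn_gt0 ?divr_gt0.
have [N hN] := UT _ e2; exists (u N T); first by case: (H N).
rewrite distC; apply: le_lt_trans (_ : _ <= e / 2) _; last by lra.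
by rewrite -(@ler_pXn2r _ 2) ?nnegrE ?dist_ge0 ?divr_ge0 ?(ltW e0)// sqr_dist hN.
Qed.

End Existence.

(** * The random endpoint map *)

Section Flow.
Context (R : realType) d (Omega : measurableType d) (P : probability Omega R).
Variables (T sigma gamma : R) (V : Omega -> R -> R) (F G : set (set Omega)).
Hypotheses (T0 : 0 < T) (gamma1 : 1 <= gamma) (gamma2 : gamma < 2).
Hypotheses (FO : F `<=` measurable) (GO : G `<=` measurable).
Hypotheses (sF : sigma_algebra setT F) (sG : sigma_algebra setT G).
Hypothesis FG : independent_sys P F G.
Hypotheses (V0 : forall w, V w 0 = 0) (Vc : forall w, cont T (V w)).
Variable B : nat -> nat -> set Omega.
Hypothesis GB : forall k n, G (B k n).
Hypothesis Bcov : forall k w, exists n, B k n w.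
Hypothesis Bsmall : forall k n w w', B k n w -> B k n w' ->
  forall t : R, t \in `[0, T] -> `|V w t - V w' t| <= k.+1%:R^-1.

Notation typ := (typical_driver P B).

Variable E : set (nat -> R).
Hypothesis Ec : dist_closed E.
Hypothesis flow : forall x w, E x -> typ w -> exists u,
  [/\ sol T sigma gamma (V w) u, forall j, u 0 j = x j & E (u T)].

(** The states on which the endpoint map is defined for all typical drivers. *)
Definition state := {x : nat -> R | E x}.
Definition state_dist (x y : state) : R := dist (sval x) (sval y).

Lemma state_Hplus (x : state) : Hplus (sval x).
Proof. by have [EH _] := Ec; apply: EH; exact: svalP. Qed.

Lemma state_dist_ge0 x y : 0 <= state_dist x y. Proof. exact: dist_ge0. Qed.
Lemma state_distxx x : state_dist x x = 0. Proof. exact: distxx. Qed.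
Lemma state_distC x y : state_dist x y = state_dist y x. Proof. exact: distC. Qed.
Lemma state_dist_triangle x y z : state_dist x z <= state_dist x y + state_dist y z.
Proof. by apply: Hplus_dist_triangle; exact: state_Hplus. Qed.

(** The endpoint map, extended by the identity to the drivers that are not
    typical. *)
Lemma flow_map_ex : exists Phi : state -> Omega -> state,
  (forall x w, typ w -> joins T sigma gamma V w (sval x) (sval (Phi x w))) /\
  (forall x w, ~ typ w -> Phi x w = x).
Proof.
have H (xw : state * Omega) : exists y : state,
    (typ xw.2 -> joins T sigma gamma V xw.2 (sval xw.1) (sval y)) /\
    (~ typ xw.2 -> y = xw.1).
  case: xw => x w /=; have [tw|ntw] := pselect (typ w); last by exists x.
  have [u [su u0 uT]] := flow (svalP x) tw.
  by exists (exist _ _ uT); split => // _; exists u.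
have [Phi HPhi] := choice H; exists (fun x w => Phi (x, w)).
by split=> x w; have [] := HPhi (x, w).
Qed.

Lemma joins_contraction w x y x' y' : Hplus x -> Hplus y ->
  joins T sigma gamma V w x x' -> joins T sigma gamma V w y y' ->
  dist x' y' <= dist x y.
Proof.
move=> Hx Hy [u [su u0 uT]] [v [sv v0 vT]].
have mT : T \in `[0, T] by rewrite in_itv/= lexx ltW.
have -> : x' = u T by apply/funext.
have -> : y' = v T by apply/funext.
have -> : x = u 0 by apply/funext.
have -> : y = v 0 by apply/funext.
rewrite -(@ler_pXn2r _ 2) ?nnegrE ?dist_ge0// !sqr_dist.
exact: contraction su sv mT.
Qed.

Lemma joins_strict w x y x' y' :
  joins T sigma gamma V w x x' -> joins T sigma gamma V w y y' ->
  0 < dist x y -> dist x' y' < dist x y.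
Proof.
move=> [u [su u0 uT]] [v [sv v0 vT]].
have -> : x' = u T by apply/funext.
have -> : y' = v T by apply/funext.
have -> : x = u 0 by apply/funext.
have -> : y = v 0 by apply/funext.
move=> d0; rewrite -(@ltr_pXn2r _ 2) ?nnegrE ?dist_ge0// !sqr_dist.
by apply: contraction_strict su sv _ => //; rewrite -sqr_dist exprn_gt0.
Qed.

Variable Phi : state -> Omega -> state.
Hypothesis Phi_joins : forall x w, typ w ->
  joins T sigma gamma V w (sval x) (sval (Phi x w)).
Hypothesis Phi_id : forall x w, ~ typ w -> Phi x w = x.

Lemma Phi_contraction x y w : state_dist (Phi x w) (Phi y w) <= state_dist x y.
Proof.
have [tw|ntw] := pselect (typ w); last by rewrite !Phi_id.
by apply: joins_contraction (Phi_joins x tw) (Phi_joins y tw); exact: state_Hplus.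
Qed.

(** The limit of solutions from x along drivers that converge to V w is again a
    solution from x, and by contraction there is one endpoint only. *)
Lemma Phi_continuous x w e : typ w -> 0 < e -> exists k, forall w', typ w' ->
  (forall t : R, t \in `[0, T] -> `|V w' t - V w t| <= k.+1%:R^-1) ->
  state_dist (Phi x w') (Phi x w) <= e.
Proof.
move=> tw e0; apply: contrapT => H.
have H' k : exists v, [/\ typ v,
    forall t : R, t \in `[0, T] -> `|V v t - V w t| <= k.+1%:R^-1 &
    e < state_dist (Phi x v) (Phi x w)].
  apply: contrapT => H2; apply: H; exists k => v tv hv; rewrite leNgt.
  by apply/negP => h; apply: H2; exists v.
have [v Hv] := choice H'.
have tv k : typ (v k) by case: (Hv k).
have [U HU] := choice (fun k => Phi_joins x (tv k)).
have Hx := state_Hplus x.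
have [u [su u0 uT]] : exists u, [/\ sol T sigma gamma (V w) u,
    forall j, u 0 j = sval x j &
    forall e, 0 < e -> exists N, forall k, (N <= k)%N -> dsq (U k T) (u T) <= e].
  apply: (@sol_closed _ _ _ _ T0 gamma1 gamma2 (V w) (sval x) (fun k => V (v k)) U) => //.
  - exact: Hplus_square_summable.
  - by move=> k; case: (HU k).
  - move=> r /small_inv[N hN]; exists N => k Nk t tT; have [_ h _] := Hv k.
    by apply: le_trans (h t tT) _; exact: hN.
  - move=> r r0; exists 0%N => k _; have [_ U0 _] := HU k.
    rewrite (_ : U k 0 = sval x); last exact/funext.
    by rewrite -sqr_dist distxx expr0n/= ltW.
have mT : T \in `[0, T] by rewrite in_itv/= lexx ltW.
have uTH : Hplus (u T) by exact: sol_in_Hplus su mT.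
have uE : dist (u T) (sval (Phi x w)) <= 0.
  apply: le_trans (joins_contraction Hx Hx _ (Phi_joins x tw)) _; last by rewrite distxx.
  by exists u.
have e2 : 0 < (e / 2) ^+ 2 by rewrite exprn_gt0 ?divr_gt0.
have [N /(_ N (leqnn N)) hN] := uT _ e2; have [_ _] := Hv N.
have [_ _ UT] := HU N; apply/negP; rewrite -leNgt.
rewrite /state_dist (_ : sval (Phi x (v N)) = U N T); last exact/esym/funext.
have UH : Hplus (U N T) by have [h _ _] := HU N; exact: sol_in_Hplus h mT.
apply: le_trans (Hplus_dist_triangle UH uTH (state_Hplus _)) _.
have : dist (U N T) (u T) <= e / 2.
  by rewrite -(@ler_pXn2r _ 2) ?nnegrE ?dist_ge0 ?divr_ge0 ?(ltW e0)// sqr_dist.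
lra.
Qed.

(** Countably many events of G; by [driver_piece_small] they play the role of
    neighbourhoods of w for the map Phi x. *)
Definition driver_piece (i : option (nat * nat)) : set Omega :=
  if i is Some (k, n) then B k n `&` typ else ~` typ.

Lemma driver_piece_G i : G (driver_piece i).
Proof.
have Gt : G typ by exact: typical_driver_G.
by case: i => [[k n]|]/=; [exact: sigmaI|exact: sigmaC].
Qed.

Lemma driver_piece_small x y w e : 0 < e -> exists2 i, driver_piece i w &
  forall w', driver_piece i w' ->
    state_dist (Phi x w') (Phi x w) <= e /\ state_dist (Phi y w') (Phi y w) <= e.
Proof.
move=> e0; have [tw|ntw] := pselect (typ w); last first.
  by exists None => // w' nw'; rewrite !Phi_id// !state_distxx ltW.
have [k hk] := Phi_continuous x tw e0; have [l hl] := Phi_continuous y tw e0.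
pose m := maxn k l; have [n Bn] := Bcov m w.
exists (Some (m, n)) => // w' [Bn' tw'].
have h t : t \in `[0, T] -> forall i, (i <= m)%N -> `|V w' t - V w t| <= i.+1%:R^-1.
  move=> tT i im; apply: le_trans (Bsmall Bn' Bn tT) _.
  by rewrite lef_pV2 ?posrE// ler_nat.
by split; [apply: hk|apply: hl] => // t tT; apply: h => //; rewrite leq_max leqnn ?orbT.
Qed.

Lemma blip_small (g : state -> state -> R) e : blip state_dist g -> 0 < e -> exists2 r : R, 0 < r &
  forall x y x' y', state_dist x' x <= r -> state_dist y' y <= r -> g x y - e < g x' y'.
Proof.
move=> [L [M [L0 _ hg]]] e0; have L1 : 0 < L + 1 by lra.
exists (e / (2 * (L + 1))); first by rewrite divr_gt0// mulr_gt0.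
move=> x y x' y' hx hy.
have h := hg x' y' x y.
have : L * (state_dist x' x + state_dist y' y) < e.
  apply: le_lt_trans (_ : _ <= L * (e / (L + 1))) _.
    rewrite ler_wpM2l//; apply: le_trans (lerD hx hy) _.
    by rewrite le_eqVlt; apply/orP; left; apply/eqP; field; rewrite gt_eqF.
  by rewrite mulrA ltr_pdivrMr// mulrC ltr_pM2l//; lra.
by move: h; rewrite ler_norml => /andP[]; lra.
Qed.

Lemma Phi_measurable g : blip state_dist g -> forall x y,
  measurable_fun setT (fun w => g (Phi x w) (Phi y w)).
Proof.
move=> bg x y; apply: (measurable_countable_base (B := driver_piece)).
  by move=> i; apply: GO; exact: driver_piece_G.
move=> w e e0; have [r r0 hr] := blip_small bg e0.
have [i iw hi] := driver_piece_small x y w r0; exists i => // w' iw'.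
by have [h1 h2] := hi w' iw'; exact: hr.
Qed.

Definition state_piece (X : Omega -> state) (i : seq rat * nat) : set Omega :=
  (fun w => sval (X w)) @^-1` Hball (ratseq R i.1) i.2.+1%:R^-1.

Lemma state_piece_small (X : Omega -> state) w e : 0 < e -> exists2 i, state_piece X i w &
  forall w', state_piece X i w' -> state_dist (X w') (X w) <= e.
Proof.
move=> e0; have e2 : 0 < e / 2 by rewrite divr_gt0.
have [k /(_ k (leqnn k)) hk] := small_inv e2.
have k0 : 0 < k.+1%:R^-1 :> R by rewrite invr_gt0.
have [s hs] := ratseq_dist_dense (state_Hplus (X w)) k0.
exists (s, k); first by split; [exact: state_Hplus|rewrite distC].
move=> w' [Hw' hw'] /=.
apply: le_trans (Hplus_dist_triangle Hw' (ratseq_Hplus R s) (state_Hplus _)) _.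
by move: hs hw' hk => /=; move: (k.+1%:R^-1 : R) (dist _ _) (dist _ _) => a b c; lra.
Qed.

Variables (X : Omega -> state).
Hypothesis FX : forall A, Hplus_borel A -> F ((fun w => sval (X w)) @^-1` A).

Lemma state_piece_F i : F (state_piece X i).
Proof. by apply: FX; apply: Hball_borel; exact: ratseq_Hplus. Qed.

Lemma state_measurable : Hplus_measurable (fun w => sval (X w)).
Proof. by move=> A hA; apply: FO; exact: FX. Qed.

Variable X' : Omega -> nat -> R.
Hypotheses (HX' : forall w, Hplus (X' w)) (mX' : Hplus_measurable X').
Hypothesis XX' : same_law P (fun w => sval (X w)) X'.
Hypothesis joinX : {ae P, forall w, joins T sigma gamma V w (sval (X w)) (X' w)}.

(** The set is the intersection of the closed set E with an open set. *)
Lemma state_open (f : state -> R) r : blip1 state_dist f ->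
  Hplus_borel [set x | exists Hx : E x, r < f (exist _ x Hx)].
Proof.
move=> bf; have bE := dist_closed_borel Ec; have [EH _] := Ec.
pose U := [set z : nat -> R | Hplus z /\ exists e : R, exists Ez : state,
  [/\ 0 < e, forall s, state_dist s Ez <= e -> r < f s & dist z (sval Ez) < e]].
have Uo : dist_open U.
  split => [z []//|z [Hz [e [s [e0 hs zs]]]]].
  exists (e - dist z (sval s)); first by rewrite subr_gt0.
  move=> v Hv vz; split => //; exists e, s; split => //.
  by apply: le_lt_trans (Hplus_dist_triangle Hv Hz (state_Hplus s)) _; rewrite -ltrBrDr.
have -> : [set x | exists Hx : E x, r < f (exist _ x Hx)] = E `&` U.
  apply/seteqP; split => x.
    move=> [Ex rf]; split => //; split; first exact: EH.
    have f0 : 0 < f (exist _ x Ex) - r by lra.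
    have [e e0 he] := blip_small bf f0.
    exists e, (exist _ x Ex); split => //; last by rewrite distxx.
    move=> s hs; have := he (exist _ x Ex) (exist _ x Ex) s (exist _ x Ex) hs.
    by rewrite state_distxx => /(_ (ltW e0)); lra.
  by move=> [Ex [_ [e [s [e0 hs xs]]]]]; exists Ex; apply: hs; exact: ltW.
by apply: (Hplus_borelI bE); exact: dist_open_borel.
Qed.

Lemma Phi_X_pieces (f : state -> R) w w' e : blip1 state_dist f -> 0 < e ->
  exists ij, [/\ state_piece X ij.1 w, driver_piece ij.2 w' &
    forall v v', state_piece X ij.1 v -> driver_piece ij.2 v' ->
      f (Phi (X w) w') - e < f (Phi (X v) v')].
Proof.
move=> bf e0; have [r r0 hr] := blip_small bf e0.
have r20 : 0 < r / 2 by rewrite divr_gt0.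
have [i iw hi] := state_piece_small X w r20.
have [j jw hj] := driver_piece_small (X w) (X w) w' r20.
exists (i, j); split => // v v' iv jv.
have h : state_dist (Phi (X v) v') (Phi (X w) w') <= r.
  apply: le_trans (state_dist_triangle _ (Phi (X w) v') _) _.
  have := Phi_contraction (X v) (X w) v'; have := hi v iv; have [] := hj v' jv; lra.
by apply: (hr _ (Phi (X w) w') _ (Phi (X w) w')) => //; rewrite state_distxx ltW.
Qed.

Lemma Phi_X_measurable (f : state -> R) : blip1 state_dist f ->
  bounded_rv (fun w => f (Phi (X w) w)).
Proof.
move=> bf; split; last by have [L [M [_ hM _]]] := bf; exists M => w; exact: (hM _ (Phi (X w) w)).
apply: (measurable_countable_base
  (B := fun ij => state_piece X ij.1 `&` driver_piece ij.2)).
  move=> [i j]; apply: measurableI; first exact/FO/state_piece_F.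
  by apply: GO; exact: driver_piece_G.
move=> w e e0; have [[i j] [iw jw h]] := Phi_X_pieces w w bf e0.
by exists (i, j) => // w' [iw' jw']; exact: h.
Qed.

(** The initial state can be frozen because it is independent of the driver.
    Almost surely, by uniqueness of the endpoint, Phi (X w) w is X' w, and X'
    has the law of X. *)
Lemma Phi_invariant (f : state -> R) : blip1 state_dist f ->
  mean P (fun w => mean P (fun w' => f (Phi (X w) w'))) = mean P (f \o X).
Proof.
move=> bf; have [L [M [L0 fM _]]] := bf.
have {}fM x : `|f x| <= M by exact: (fM x x).
rewrite -(independent_integral FO GO sF sG FG
    (B1 := fun ij => state_piece X ij.1) (B2 := fun ij => driver_piece ij.2)
    (theta := fun w w' => f (Phi (X w) w')) (M := M)) => //; first last.
- by move=> w w' e e0; have [[i j] [h1 h2 h]] := Phi_X_pieces w w' bf e0; exists (i, j).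
- by move=> i; exact: driver_piece_G.
- by move=> i; exact: state_piece_F.
(* The value - M outside E keeps the superlevel sets of fh Borel. *)
pose fh (y : nat -> R) := if pselect (E y) is left Ey then f (exist _ y Ey) else - M.
have fhE (x : state) : fh (sval x) = f x.
  rewrite /fh; case: pselect => [Ey|]; last by have := svalP x.
  by case: x Ey => x Ex Ey; congr (f (exist _ _ _)); exact: Prop_irrelevance.
have fhM y : `|fh y| <= M.
  rewrite /fh; case: pselect => [Ey|_]; first exact: fM.
  by rewrite normrN ger0_norm// (le_trans _ (fM (X point))).
have fh_borel r : Hplus_borel [set x | Hplus x /\ r < fh x].
  have [rM|Mr] := ltP r (- M).
    rewrite (_ : [set x | _] = @Hplus R); first exact: Hplus_borel_Hplus.
    apply/seteqP; split => [x []//|x Hx]; split => //; apply: lt_le_trans rM _.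
    by have := fhM x; rewrite ler_norml => /andP[].
  rewrite (_ : [set x | _] = [set x | exists Hx : E x, r < f (exist _ x Hx)]).
    exact: state_open.
  apply/seteqP; split => [x [Hx]|x [Ex h]].
    by rewrite /fh; case: pselect => [Ex h|_ /(le_lt_trans Mr)]; [exists Ex|rewrite ltxx].
  by split; [have [EH _] := Ec; exact: EH|rewrite (fhE (exist _ x Ex))].
have bX' : bounded_rv (fh \o X').
  split; last by exists M => w; exact: fhM.
  apply: measurable_ray => r.
  rewrite (_ : [set t | _] = X' @^-1` [set x | Hplus x /\ r < fh x]); last first.
    by apply/seteqP; split => w /= => [h|[]//]; split.
  exact: mX'.
transitivity (mean P (fh \o X')).
  apply: mean_ae => //; first exact: Phi_X_measurable.
  have typ_ae := typical_driver_ae P GO sG GB Bcov.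
  apply: (filterS _ (filterI joinX typ_ae)) => w [jw tw].
  have := joins_contraction (state_Hplus (X w)) (state_Hplus (X w)) jw (Phi_joins (X w) tw).
  rewrite distxx => d0.
  have XE : X' w = sval (Phi (X w) w).
    apply/funext => j; have Hw := HX' w; have HP := state_Hplus (Phi (X w) w).
    have := coord_dist j (Hplus_square_summable Hw) (Hplus_square_summable HP).
    have : dist (X' w) (sval (Phi (X w) w)) = 0 by apply/eqP; rewrite eq_le d0 dist_ge0.
    rewrite -sqr_dist => ->; rewrite expr0n/= mulr0 => h.
    by apply/eqP; rewrite -subr_eq0 -sqrf_eq0 eq_le h sqr_ge0.
  by rewrite /= XE fhE.
rewrite -(@same_law_mean _ _ _ P (fun w => sval (X w)) X' fh M) => //.
- by congr (mean P _); apply/funext => w /=; rewrite fhE.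
- by move=> w; exact: state_Hplus.
- exact: state_measurable.
Qed.

End Flow.

(** * Uniqueness of the stationary law for an abstract driver *)

Section Versions.
Context (R : realType) d (Omega : measurableType d) (P : probability Omega R).
Implicit Types (X Y : Omega -> nat -> R) (x y : nat -> R) (e : R).

Lemma probability_setT1 : P setT = 1%E. Proof. exact: probability_setT. Qed.

Lemma supp_nonempty X : (forall w, Hplus (X w)) -> Hplus_measurable X ->
  exists x, supp P X x.
Proof.
move=> HX mX; apply: contrapT => H; have := supp_null P mX.
rewrite (_ : _ @^-1` _ = setT); last first.
  by apply/seteqP; split => // w _; split => // h; apply: H; exists (X w).
by rewrite probability_setT1 => -[] /eqP; rewrite oner_eq0.
Qed.

Lemma dist_closedU (C D : set (nat -> R)) :
  dist_closed C -> dist_closed D -> dist_closed (C `|` D).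
Proof.
move=> [CH Cc] [DH Dc]; split => [x [/CH|/DH]//|x Hx H].
have [Cx|nC] := pselect (C x); first by left.
right; apply: Dc => // e e0.
have [r r0 hr] : exists2 r : R, 0 < r & forall y, C y -> r <= dist x y.
  apply: contrapT => h; apply: nC; apply: Cc => // r r0; apply: contrapT => h2.
  apply: h; exists r => // y Cy; rewrite leNgt; apply/negP => yr.
  by apply: h2; exists y.
have m0 : 0 < Num.min e r by rewrite lt_min e0.
have [y CDy] := H _ m0; rewrite lt_min => /andP[ye yr].
case: CDy => [Cy|Dy]; last by exists y.
by have := hr y Cy; rewrite leNgt yr.
Qed.

(** A null modification of X takes all its values in a closed set that carries
    the law of X. *)
Lemma state_version (F : set (set Omega)) (E : set (nat -> R)) (s0 : state E) X :
  sigma_algebra setT F -> F `<=` measurable -> dist_closed E ->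
  (forall w, Hplus (X w)) -> (forall A, Hplus_borel A -> F (X @^-1` A)) ->
  P (X @^-1` (@Hplus R `\` E)) = 0 ->
  exists Z : Omega -> state E,
    (forall A, Hplus_borel A -> F ((fun w => sval (Z w)) @^-1` A)) /\
    {ae P, forall w, sval (Z w) = X w}.
Proof.
move=> sF FO Ec HX FX PE; have bE := dist_closed_borel Ec.
pose Z w : state E := if pselect (E (X w)) is left h then exist _ _ h else s0.
have ZE w : E (X w) -> sval (Z w) = X w by rewrite /Z; case: pselect.
have ZN w : ~ E (X w) -> Z w = s0 by rewrite /Z; case: pselect.
have bN := Hplus_borelD bE.
exists Z; split.
  move=> A hA.
  rewrite (_ : _ @^-1` A = X @^-1` (A `&` E) `|`
     (if pselect (A (sval s0)) then X @^-1` (@Hplus R `\` E) else set0)).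
    apply: sigmaU => //; first by apply: FX; exact: Hplus_borelI.
    by case: (pselect (A (sval s0))) => _ /=; [exact: FX|case: sF].
  apply/seteqP; split => w /=.
    have [Ew|nE] := pselect (E (X w)); first by rewrite ZE//; left.
    by rewrite ZN// => As0; right; case: (pselect (A (sval s0))) => // _; split.
  move=> [[Aw Ew]|]; first by rewrite ZE.
  by case: (pselect (A (sval s0))) => //= As0 [_ nE]; rewrite ZN.
exists (X @^-1` (@Hplus R `\` E)); split => //; first exact/FO/FX.
by move=> w /= h; split => // Ew; apply: h; exact: ZE.
Qed.

Lemma same_law_ae X Y : Hplus_measurable X -> Hplus_measurable Y ->
  {ae P, forall w, X w = Y w} -> same_law P X Y.
Proof.
move=> mX mY XY A hA.
have mA := mX A hA; have mB := mY A hA.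
rewrite -[LHS]fineK ?fin_num_measure// -[RHS]fineK ?fin_num_measure//; congr EFin.
rewrite -!mean_indic//; apply: mean_ae; [exact: bounded_rv_indic|exact: bounded_rv_indic|].
apply: filterS XY => w XYw; rewrite !indicE; congr (_%:R); congr nat_of_bool.
by apply/idP/idP => /set_mem h; apply/mem_set; move: h => /=; rewrite XYw.
Qed.

Lemma zero_Hplus : Hplus (fun=> 0 : R).
Proof.
split=> //; apply/ell2P; exists 0 => n; rewrite big1// => i _.
by rewrite expr0n.
Qed.

Definition norm_ball (m : nat) : set (nat -> R) :=
  [set y : nat -> R | Hplus y /\ ell2_norm (fun j => y j - 0) <= m%:R].

Lemma norm_ball_borel m : Hplus_borel (norm_ball m).
Proof. by apply: dist_closed_borel; exact: (norm_ball_closed _ zero_Hplus). Qed.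

Lemma norm_ball_sum m x n : norm_ball m x -> \sum_(j < n) x j ^+ 2 <= m%:R ^+ 2.
Proof.
move=> [Hx hx]; have sx := Hplus_square_summable Hx.
have s0 := Hplus_square_summable zero_Hplus.
have := sum_sqr_le_norm n (square_summableB sx s0).
under eq_bigr do rewrite subr0.
move=> /le_trans; apply; rewrite ler_pXn2r ?nnegrE//; exact: ell2_norm_ge0.
Qed.

Lemma norm_ball_tight X e : (forall w, Hplus (X w)) -> Hplus_measurable X -> 0 < e ->
  exists m, forall n, (m <= n)%N -> (P (~` (X @^-1` norm_ball n)) <= e%:E)%E.
Proof.
move=> HX mX e0.
pose A n := ~` (X @^-1` norm_ball n).
have mA n : measurable (A n) by apply: measurableC; apply: mX; exact: norm_ball_borel.
have A0 : \bigcap_n A n = set0.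
  apply/seteqP; split => // w /= h.
  set r := ell2_norm (fun j => X w j - 0).
  apply: (h (Num.truncn r).+1 I); split => //; exact/ltW/truncnS_gt.
have ndA : nonincreasing_seq A.
  move=> m n mn; apply/subsetPset => w /= h [Hw hw]; apply: h; split => //.
  by apply: le_trans hw _; rewrite ler_nat.
have cv : (fun n => P (A n)) @ \oo --> P (\bigcap_n A n).
  apply: nonincreasing_cvg_mu => //; last by rewrite A0.
  by apply: (le_lt_trans (y := 1%E)); [exact: probability_le1|exact: ltry].
rewrite A0 measure0 in cv.
have [m _ hm] : \forall n \near \oo, (P (A n) <= e%:E)%E.
  have := cv [set z | (z <= e%:E)%E]; apply; rewrite /nbhs/=.
  exists e => //= z; rewrite /= sub0r normrN => /ltW ze.
  by rewrite lee_fin; apply: le_trans ze; exact: ler_norm.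
by exists m => n mn; exact: hm.
Qed.

End Versions.

Section Uniqueness.
Context (R : realType) d (Omega : measurableType d) (P : probability Omega R).
Variables (T sigma gamma : R) (V : Omega -> R -> R) (F G : set (set Omega)).
Hypotheses (T0 : 0 < T) (gamma1 : 1 <= gamma) (gamma2 : gamma < 2).
Hypotheses (FO : F `<=` measurable) (GO : G `<=` measurable).
Hypotheses (sF : sigma_algebra setT F) (sG : sigma_algebra setT G).
Hypothesis FG : independent_sys P F G.
Hypotheses (V0 : forall w, V w 0 = 0) (Vc : forall w, cont T (V w)).
Variable B : nat -> nat -> set Omega.
Hypothesis GB : forall k n, G (B k n).
Hypothesis Bcov : forall k w, exists n, B k n w.
Hypothesis Bsmall : forall k n w w', B k n w -> B k n w' ->
  forall t : R, t \in `[0, T] -> `|V w t - V w' t| <= k.+1%:R^-1.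

(** The states of a stationary solution at times 0 and T, where F is the
    sigma-algebra of time 0. *)
Record stationary_pair (X X' : Omega -> nat -> R) : Prop := StationaryPair {
  pair_Hplus : forall w, Hplus (X w);
  pair_measurable : forall A, Hplus_borel A -> F (X @^-1` A);
  pair_Hplus' : forall w, Hplus (X' w);
  pair_measurable' : Hplus_measurable X';
  pair_law : same_law P X X';
  pair_joins : {ae P, forall w, joins T sigma gamma V w (X w) (X' w)} }.

(** The common state space is the union of the two supports, which is closed
    and stable under the endpoint map. *)
Lemma stationary_pair_unique X1 X1' X2 X2' :
  stationary_pair X1 X1' -> stationary_pair X2 X2' -> same_law P X1 X2.
Proof.
move=> S1 S2.
have mX i j : stationary_pair i j -> Hplus_measurable i.
  by move=> S A hA; apply: FO; exact: (pair_measurable S).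
have m1 := mX _ _ S1; have m2 := mX _ _ S2.
pose E := supp P X1 `|` supp P X2.
have Ec : dist_closed E by apply: dist_closedU; exact: supp_closed.
have flow x w : E x -> typical_driver P B w -> exists u,
    [/\ sol T sigma gamma (V w) u, forall j, u 0 j = x j & E (u T)].
  have fe X X' : stationary_pair X X' -> supp P X x -> typical_driver P B w -> exists u,
      [/\ sol T sigma gamma (V w) u, forall j, u 0 j = x j & supp P X (u T)].
    case=> HX FX HX' mX' XX' jX.
    exact: (flow_exists T0 gamma1 gamma2 FO GO FG V0 Vc GB Bsmall FX HX' mX' XX' jX).
  move=> [x1|x2] tw.
    by have [u [? ? ?]] := fe _ _ S1 x1 tw; exists u; split => //; left.
  by have [u [? ? ?]] := fe _ _ S2 x2 tw; exists u; split => //; right.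
have [Phi [Phij Phiid]] := flow_map_ex flow.
have [x0 sx0] := supp_nonempty P (pair_Hplus S1) m1.
pose s0 : state E := exist _ x0 (or_introl sx0).
have PE X X' : stationary_pair X X' -> supp P X `<=` E -> P (X @^-1` (@Hplus R `\` E)) = 0%E.
  move=> S sE; have mZ := mX _ _ S.
  apply/eqP; rewrite eq_le measure_ge0 andbT -(supp_null P mZ).
  have b1 := dist_closed_borel Ec; have b2 := dist_closed_borel (supp_closed P mZ).
  apply: le_measure; rewrite ?inE.
  - by apply: mZ; exact: Hplus_borelD.
  - by apply: mZ; exact: Hplus_borelD.
  - by apply: preimage_subset; apply: setDS.
have PE1 := PE _ _ S1 (@subsetUl _ _ _); have PE2 := PE _ _ S2 (@subsetUr _ _ _).
have [Z1 [FZ1 aZ1]] := state_version s0 sF FO Ec (pair_Hplus S1) (pair_measurable S1) PE1.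
have [Z2 [FZ2 aZ2]] := state_version s0 sF FO Ec (pair_Hplus S2) (pair_measurable S2) PE2.
have inv X X' Z (f : state E -> R) : stationary_pair X X' ->
    (forall A, Hplus_borel A -> F ((fun w => sval (Z w)) @^-1` A)) ->
    {ae P, forall w, sval (Z w) = X w} -> blip1 (@state_dist R E) f ->
    mean P (fun w => mean P (fun w' => f (Phi (Z w) w'))) = mean P (f \o Z).
  move=> S FZ aZ bf.
  apply: (Phi_invariant T0 gamma1 gamma2 FO GO sF sG FG V0 Vc GB Bcov Bsmall Ec
    Phij Phiid FZ (pair_Hplus' S) (pair_measurable' S) _ _ bf).
    move=> A hA; rewrite -(pair_law S)//; apply: same_law_ae hA => //.
      exact: (state_measurable FO FZ).
    exact: (mX _ _ S).
  by apply: filterS (filterI aZ (pair_joins S)) => w [] /= ->.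
pose K (m : nat) : set (state E) := [set s | norm_ball m (sval s)].
have coupling (f : state E -> R) : blip1 (@state_dist R E) f -> mean P (f \o Z1) = mean P (f \o Z2).
  apply: (@stationary_unique R d Omega P (state E) (@state_dist R E) Phi Z1 Z2 K).
  - exact: state_dist_ge0.
  - exact: state_distxx.
  - exact: state_distC.
  - exact: state_dist_triangle.
  - exact: (Phi_measurable T0 gamma1 gamma2 GO sG V0 Vc GB Bcov Bsmall Ec Phij Phiid).
  - move=> g bg; apply: (measurable_countable_base
      (B := fun ij => state_piece Z1 ij.1 `&` state_piece Z2 ij.2)).
      by move=> ij; apply: measurableI; apply: FO; exact: state_piece_F.
    move=> w e e0; have [r r0 hr] := blip_small bg e0.
    have [i iw hi] := state_piece_small Ec Z1 w r0.
    have [j jw hj] := state_piece_small Ec Z2 w r0.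
    by exists (i, j) => // v [iv jv]; apply: hr; [exact: hi|exact: hj].
  - exact: (Phi_contraction T0 gamma1 gamma2 Ec Phij Phiid).
  - apply: filterS (typical_driver_ae P GO sG GB Bcov) => w tw x y.
    exact: (joins_strict T0 gamma1 gamma2 (Phij x w tw) (Phij y w tw)).
  - by move=> g; exact: inv S1 FZ1 aZ1.
  - by move=> g; exact: inv S2 FZ2 aZ2.
  - move=> e e0; have e2 : 0 < e / 2 by rewrite divr_gt0.
    have HZ (Z : Omega -> state E) w : Hplus (sval (Z w)) by exact: state_Hplus.
    have mZ1 := state_measurable FO FZ1; have mZ2 := state_measurable FO FZ2.
    have [m hm] := norm_ball_tight P (HZ Z1) mZ1 e2.
    have [n hn] := norm_ball_tight P (HZ Z2) mZ2 e2.
    exists (maxn m n); exists (~` ((fun w => sval (Z1 w)) @^-1` norm_ball (maxn m n)) `|`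
      ~` ((fun w => sval (Z2 w)) @^-1` norm_ball (maxn m n))).
      by apply: measurableU; apply: measurableC; [apply: mZ1|apply: mZ2]; exact: norm_ball_borel.
    split.
      have -> : e%:E = ((e / 2)%:E + (e / 2)%:E)%E by rewrite -EFinD -splitr.
      have c1 : measurable (~` ((fun w => sval (Z1 w)) @^-1` norm_ball (maxn m n))).
        by apply: measurableC; apply: mZ1; exact: norm_ball_borel.
      have c2 : measurable (~` ((fun w => sval (Z2 w)) @^-1` norm_ball (maxn m n))).
        by apply: measurableC; apply: mZ2; exact: norm_ball_borel.
      apply: (le_trans (measureU2 P c1 c2)).
      by apply: leeD; [apply: hm|apply: hn]; rewrite ?leq_maxl ?leq_maxr.
    by move=> w /not_orP[/contrapT h1 /contrapT h2].
  - move=> m x y Kx Ky.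
    have [a [b [Ha Hb h]]] := @ball_seq_compact R (fun k => sval (x k)) (fun k => sval (y k))
      (m%:R ^+ 2) (fun k => state_Hplus Ec (x k)) (fun k => state_Hplus Ec (y k))
      (fun k n => norm_ball_sum n (Kx k)) (fun k n => norm_ball_sum n (Ky k)).
    have [_ cl] := Ec.
    have Ea : E a.
      apply: cl => // e e0; have [k _ [ka _]] := h e 0%N e0.
      by exists (sval (x k)); [exact: svalP|rewrite distC].
    have Eb : E b.
      apply: cl => // e e0; have [k _ [_ kb]] := h e 0%N e0.
      by exists (sval (y k)); [exact: svalP|rewrite distC].
    by exists (exist _ a Ea), (exist _ b Eb).
pose Y1 w : Hplus_point R := exist _ _ (pair_Hplus S1 w).
pose Y2 w : Hplus_point R := exist _ _ (pair_Hplus S2 w).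
apply: (same_law_lip (X := Y1) (Y := Y2)) => // f bf.
pose fs (s : state E) := f (exist _ _ (state_Hplus Ec s)).
have bfs : blip1 (@state_dist R E) fs.
  have [L [M [L0 hM hL]]] := bf; exists L, M; split => //.
    by move=> x y; exact: (hM (exist _ _ (state_Hplus Ec x)) (exist _ _ (state_Hplus Ec x))).
  by move=> x y x' y'; exact: (hL (exist _ _ (state_Hplus Ec x))
    (exist _ _ (state_Hplus Ec y)) (exist _ _ (state_Hplus Ec x')) (exist _ _ (state_Hplus Ec y'))).
have tr X (HX : forall w, Hplus (X w)) (Z : Omega -> state E) : Hplus_measurable X ->
    (forall A, Hplus_borel A -> F ((fun w => sval (Z w)) @^-1` A)) ->
    {ae P, forall w, sval (Z w) = X w} ->
    mean P (f \o (fun w => exist _ _ (HX w))) = mean P (fs \o Z).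
  move=> mZ FZ aZ; apply: mean_ae.
  - exact: blip1_bounded_rv.
  - apply: (blip1_bounded_rv (U := fun w => exist _ _ (state_Hplus Ec (Z w)))) => //.
    exact: (state_measurable FO FZ).
  - apply: filterS aZ => w ZX; rewrite /fs/=; congr f.
    by move: (HX w) (state_Hplus Ec (Z w)); rewrite ZX => h1 h2; congr exist; exact: Prop_irrelevance.
by rewrite (tr _ (pair_Hplus S1) Z1)// (tr _ (pair_Hplus S2) Z2)// coupling.
Qed.

End Uniqueness.

(** * The Brownian motion as a driver *)

Section DyadicGrid.
Variables (R : realType) (T : R).
Hypothesis T0 : 0 < T.
Implicit Types (f : R -> R) (e s t : R).

Lemma cont_unif f e : cont T f -> 0 < e -> exists2 r : R, 0 < r &
  forall s t, s \in `[0, T] -> t \in `[0, T] -> `|s - t| <= r -> `|f s - f t| <= e.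
Proof.
move=> /subspace_continuousP cf e0; apply: contrapT => H.
have H' k : exists st : R * R, [/\ st.1 \in `[0, T], st.2 \in `[0, T],
    `|st.1 - st.2| <= k.+1%:R^-1 & e < `|f st.1 - f st.2|].
  apply: contrapT => H2; apply: H; exists k.+1%:R^-1; first by rewrite invr_gt0.
  move=> s t sT tT st; rewrite leNgt; apply/negP => h; apply: H2; by exists (s, t).
have [q Hq] := choice H'.
have [p [pT clp]] : `[0, T]%classic `&` cluster ((fun k => (q k).1) @ \oo) !=set0.
  by apply: (@segment_compact R 0 T); exists 0%N => // k _; have [] := Hq k.
have e2 : 0 < e / 2 by rewrite divr_gt0.
have := cf p pT => /cvgrPdist_lt/(_ _ e2).
rewrite near_withinE => -[r /= r0 hr].
have r2 : 0 < r / 2 by rewrite divr_gt0.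
have [N hN] := small_inv r2.
have [_ [[k Nk <-] pk]] := clp [set (q k).1 | k in [set k | (N <= k)%N]] (ball p (r / 2))
  (ex_intro2 _ _ N I (fun k Nk => ex_intro2 _ _ k Nk erefl)) (nbhsx_ballx _ _ r2).
have [sT tT st est] := Hq k; have hk := hN k Nk.
move: pk; rewrite /ball/= => pk.
have h1 : `|f p - f (q k).1| < e / 2.
  by apply: hr => //=; apply: lt_trans pk _; rewrite ltr_pdivrMr// ltr_pMr// ltr1n.
have h2 : `|f p - f (q k).2| < e / 2.
  apply: hr => //=; rewrite (_ : p - (q k).2 = (p - (q k).1) + ((q k).1 - (q k).2)); last by ring.
  apply: le_lt_trans (ler_normD _ _) _; rewrite [ltRHS]splitr ltr_leD//.
  exact: le_trans st hk.
move: est; apply/negP; rewrite -leNgt.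
rewrite (_ : f _ - f _ = (f p - f (q k).2) - (f p - f (q k).1)); last by ring.
by apply: le_trans (ler_normB _ _) _; rewrite [leRHS]splitr lerD// ltW.
Qed.

Definition grid n i : R := T * i%:R / 2 ^+ n.

Lemma grid_in n i : (i <= 2 ^ n)%N -> grid n i \in `[0, T].
Proof.
move=> ni; rewrite in_itv/=; apply/andP; split.
  by rewrite divr_ge0 ?mulr_ge0 ?exprn_ge0// ltW.
rewrite ler_pdivrMr ?exprn_gt0// ler_pM2l//.
by rewrite -natrX ler_nat.
Qed.

Lemma grid0 n : grid n 0 = 0. Proof. by rewrite /grid mulr0 mul0r. Qed.

Lemma grid_half n i : grid n.+1 i.*2 = grid n i.
Proof.
by rewrite /grid -muln2 natrM exprS; field; rewrite expf_neq0.
Qed.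

Lemma grid_lt n i : grid n i < grid n i.+1.
Proof.
by rewrite ltr_pM2r ?invr_gt0 ?exprn_gt0// ltr_pM2l// ltr_nat.
Qed.

Lemma grid_le n i j : (i <= j)%N -> grid n i <= grid n j.
Proof.
by move=> ij; rewrite ler_pM2r ?invr_gt0 ?exprn_gt0// ler_pM2l// ler_nat.
Qed.

Definition mesh n t := Num.truncn (t / T * 2 ^+ n).

Lemma mesh_le n t : t \in `[0, T] -> (mesh n t <= 2 ^ n)%N.
Proof.
rewrite in_itv/= => /andP[t0 tT].
have h0 : 0 <= t / T * 2 ^+ n by rewrite mulr_ge0 ?exprn_ge0// divr_ge0// ltW.
have h1 : (mesh n t)%:R <= t / T * 2 ^+ n by rewrite truncn_le.
rewrite -(ler_nat R); apply: le_trans h1 _.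
by rewrite natrX ler_piMl ?exprn_ge0// ler_pdivrMr// mul1r.
Qed.

Lemma mesh_near n t : t \in `[0, T] -> `|grid n (mesh n t) - t| <= T / 2 ^+ n.
Proof.
rewrite in_itv/= => /andP[t0 tT].
have h0 : 0 <= t / T * 2 ^+ n by rewrite mulr_ge0 ?exprn_ge0// divr_ge0// ltW.
have p0 : 0 < 2 ^+ n :> R by rewrite exprn_gt0.
have h1 : (mesh n t)%:R <= t / T * 2 ^+ n by rewrite truncn_le.
 have h2 := truncnS_gt (t / T * 2 ^+ n).
have -> : grid n (mesh n t) - t = ((mesh n t)%:R - t / T * 2 ^+ n) * (T / 2 ^+ n).
  by rewrite /grid; field; rewrite !gt_eqF.
rewrite normrM (@ger0_norm _ (T / _)); last by rewrite divr_ge0// ltW.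
rewrite ler_piMl ?divr_ge0 ?(ltW T0) ?(ltW p0)//.
move: h1 h2; rewrite -/(mesh n t) -[(mesh n t).+1%:R]natr1; move: (_%:R) (t / T * _) => a b h1 h2.
by rewrite ler_norml; apply/andP; split; lra.
Qed.

Lemma mesh_small e : 0 < e -> exists n, T / 2 ^+ n <= e.
Proof.
move=> e0; have : (fun n => T * 2^-1 ^+ n) @ \oo --> T * 0.
  by apply: cvgMr; apply: cvg_expr; rewrite ger0_norm ?invr_ge0// invf_lt1// ltr1n.
rewrite mulr0 => /cvgr0Pnorm_le/(_ _ e0)[n _ Hn]; exists n.
by have := Hn n (leqnn n); rewrite exprVn; apply: le_trans; exact: ler_norm.
Qed.

Lemma cont_grid_le f (a : R) : cont T f ->
  (forall n i, (i <= 2 ^ n)%N -> `|f (grid n i)| <= a) ->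
  forall t, t \in `[0, T] -> `|f t| <= a.
Proof.
move=> cf H t tT; apply/ler_addgt0Pr => e e0.
have [r r0 hr] := cont_unif cf e0; have [n hn] := mesh_small r0.
have mn := mesh_le n tT; have := mesh_near n tT => /le_trans/(_ hn) h.
have := hr _ _ (grid_in mn) tT h; have := H n _ mn.
rewrite -{2}(subKr (f (grid n (mesh n t))) (f t)) => h1 h2.
by apply: le_trans (ler_normB _ _) _; exact: lerD.
Qed.

Definition step_path (ms : nat * seq rat) t : R := ratr (nth 0 ms.2 (mesh ms.1 t)).

(** Countably many step functions are uniformly dense, by uniform continuity. *)
Lemma step_path_dense f e : cont T f -> 0 < e -> exists ms,
  forall t, t \in `[0, T] -> `|f t - step_path ms t| <= e.
Proof.
move=> cf e0; have e2 : 0 < e / 2 by rewrite divr_gt0.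
have [r r0 hr] := cont_unif cf e2; have [m hm] := mesh_small r0.
have /choice[q Hq] j : exists q : rat, `|f (grid m j) - ratr q| < e / 2.
  have : f (grid m j) < f (grid m j) + e / 2 by rewrite ltrDl.
  move=> /rat_in_itvoo[q]; rewrite in_itv/= => /andP[h1 h2]; exists q.
  by rewrite distrC ger0_norm; lra.
exists (m, mkseq q (2 ^ m).+1) => t tT.
have mm := mesh_le m tT; rewrite /step_path/= nth_mkseq ?ltnS//.
have h := hr _ _ (grid_in mm) tT (le_trans (mesh_near m tT) hm).
have hq := Hq (mesh m t).
rewrite (_ : f t - _ = (f (grid m (mesh m t)) - ratr (q (mesh m t))) -
  (f (grid m (mesh m t)) - f t)); last by ring.
apply: le_trans (ler_normB _ _) _; rewrite [leRHS]splitr lerD//; exact: ltW.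
Qed.

End DyadicGrid.

Section RealMeasurable.
Context (R : realType) (Omega : pointedType).
Variable (G : set (set Omega)).
Hypothesis sG : sigma_algebra setT G.
Implicit Types f g : Omega -> R.

Definition real_measurable f := forall B, measurable B -> G (f @^-1` B).

Lemma real_measurableP f :
  real_measurable f <-> measurable_fun [set: g_sigma_algebraType G] f.
Proof.
split=> [mf _ B mB|mf B mB].
  by rewrite setTI; apply: sub_sigma_algebra; exact: mf.
by have := mf measurableT B mB; rewrite setTI /measurable/= (sigma_algebra_id sG).
Qed.

Lemma real_measurableD f g : real_measurable f -> real_measurable g ->
  real_measurable (fun w => f w + g w).
Proof. by rewrite !real_measurableP => mf mg; exact: measurable_funD. Qed.

Lemma real_measurableB f g : real_measurable f -> real_measurable g ->
  real_measurable (fun w => f w - g w).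
Proof. by rewrite !real_measurableP => mf mg; exact: measurable_funB. Qed.

Fixpoint rectangle (D : nat -> Omega -> R) (B : nat -> set R) m : set Omega :=
  if m is k.+1 then rectangle D B k `&` D k @^-1` B k else setT.

Lemma rectangle_mem D B m : (forall i, (i < m)%N -> G (D i @^-1` B i)) ->
  G (rectangle D B m).
Proof.
elim: m => [|m IH] H /=; first by case: sG => G0 GC _; rewrite -setC0 -setTD; exact: GC.
by apply: sigmaI => //; [apply: IH => i im; apply: H; exact: ltnW|exact: H].
Qed.

End RealMeasurable.

Section Driver.
Context (R : realType) d (Omega : measurableType d) (P : probability Omega R).
Variables (T : R) (F : R -> set (set Omega)) (W : R -> Omega -> R).
Hypotheses (T0 : 0 < T) (fF : filtration T F) (bW : brownian_motion P T F W).

Notation grid := (grid T).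

(** By induction on m: A and the first k increments are events at time
    grid n k, of which the next increment is independent. *)
Lemma increments_independent n m A (B : nat -> set R) : (m <= 2 ^ n)%N ->
  F 0 A -> (forall i, measurable (B i)) ->
  let D i := increment W (grid n i) (grid n i.+1) in
  P (A `&` rectangle D B m) = (P A * P (rectangle D B m))%E.
Proof.
move=> mn FA mB D.
have F0T : F 0 setT.
  have [G0 GC _] := filtration_sigma fF (mem0 T0); rewrite -setC0 -setTD; exact: GC.
have step_ A' k : F 0 A' -> (k < 2 ^ n)%N -> P (A' `&` rectangle D B k.+1) =
    (P (A' `&` rectangle D B k) * P (D k @^-1` B k))%E.
  move=> FA' kn; rewrite /= setIA.
  have kn' := ltnW kn.
  have g1 := grid_in T0 kn'; have g2 := grid_in T0 kn.
  apply: (bm_independent bW) => //; first exact: grid_lt.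
  have sk := filtration_sigma fF g1.
  apply: sigmaI => //.
    apply: (filtration_homo fF (mem0 T0) g1) => //.
    by move: g1; rewrite in_itv/= => /andP[].
  apply: rectangle_mem => // i ik.
  have FW j : (j <= k)%N -> real_measurable (F (grid n k)) (W (grid n j)).
    move=> jk B' mB'; have gj := grid_in T0 (leq_trans jk kn').
    apply: (filtration_homo fF gj g1).
      exact: grid_le.
    by apply: (bm_adapted bW gj); exists B' => //; rewrite setTI.
  by apply: (real_measurableB sk (FW i.+1 ik) (FW i (ltnW ik))).
elim: m mn => [|m IH] mn; first by rewrite /= !setIT probability_setT1 mule1.
rewrite step_// IH ?(ltnW mn)// -muleA; congr (_ * _)%E.
by rewrite -[in RHS](setTI (rectangle D B m.+1)) step_// setTI.
Qed.

Lemma regular_event : exists C, [/\ measurable C, P (~` C) = 0 &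
  forall w, C w -> W 0 w = 0 /\ cont T (fun t => W t w)].
Proof.
have := filterI (bm_start bW) (bm_continuous bW).
move=> [N [mN PN HN]]; exists (~` N); split; [exact: measurableC|by rewrite setCK|].
by move=> w nNw; apply: contrapT => h; apply: nNw; apply: HN.
Qed.

Variable C : set Omega.
Hypotheses (mC : measurable C) (PC : P (~` C) = 0).
Hypothesis HC : forall w, C w -> W 0 w = 0 /\ cont T (fun t => W t w).

(** The Brownian path on an event of probability one where it is continuous and
    starts at 0, and the zero path elsewhere: all drivers are then admissible. *)
Definition driver w t : R := if pselect (C w) then W t w else 0.

Lemma driverE w : C w -> driver w = fun t => W t w.
Proof. by move=> Cw; apply/funext => t; rewrite /driver; case: pselect. Qed.

Lemma driverN w : ~ C w -> driver w = fun=> 0.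
Proof. by move=> Cw; apply/funext => t; rewrite /driver; case: pselect. Qed.

Lemma driver0 w : driver w 0 = 0.
Proof. by have [Cw|Cw] := pselect (C w); [rewrite driverE//; case: (HC Cw)|rewrite driverN]. Qed.

Lemma driver_cont w : cont T (driver w).
Proof.
have [Cw|Cw] := pselect (C w); first by rewrite driverE//; case: (HC Cw).
by rewrite driverN//; exact: cont_cst.
Qed.

Lemma driver_ae : {ae P, forall w, driver w = fun t => W t w}.
Proof.
exists (~` C); split => //; first exact: measurableC.
by move=> w /= h Cw; apply: h; exact: driverE.
Qed.

Lemma driver_measurable t : t \in `[0, T] ->
  real_measurable measurable (fun w => driver w t).
Proof.
move=> tT B mB.
have mW : measurable (W t @^-1` B).
  apply: (filtration_sub fF tT); apply: (bm_adapted bW tT).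
  by exists B => //; rewrite setTI.
rewrite (_ : _ @^-1` B = (W t @^-1` B `&` C) `|`
   (if pselect (B 0) then ~` C else set0)).
  apply: measurableU; first exact: measurableI.
  by case: (pselect (B 0)) => _ //=; exact: measurableC.
apply/seteqP; split => w /=.
  have [Cw|Cw] := pselect (C w); first by rewrite driverE//; left.
  by rewrite driverN// => B0; right; case: (pselect (B 0)).
move=> [[Bw Cw]|]; first by rewrite driverE.
by case: (pselect (B 0)) => //= B0 Cw; rewrite driverN.
Qed.

Definition driver_step n i w := driver w (grid n i.+1) - driver w (grid n i).

Lemma driver_step_measurable n i : (i < 2 ^ n)%N ->
  real_measurable measurable (driver_step n i).
Proof.
move=> ni; apply: real_measurableB; first exact: sigma_algebra_measurable.
- by apply: driver_measurable; exact: grid_in.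
- by apply: driver_measurable; apply: grid_in => //; exact: ltnW.
Qed.

Lemma rectangle_step_measurable n (B : nat -> set R) : (forall i, measurable (B i)) ->
  measurable (rectangle (driver_step n) B (2 ^ n)).
Proof.
move=> mB; apply: rectangle_mem; first exact: sigma_algebra_measurable.
by move=> i ni; exact: driver_step_measurable.
Qed.

Lemma probability_regular (A B : set Omega) : measurable A -> measurable B ->
  A `&` C = B `&` C -> P A = P B.
Proof.
move=> mA mB ABC.
have h X : measurable X -> P X = P (X `&` C).
  move=> mX; apply: eq_trans (measureDI P mX mC) _.
  rewrite -[RHS]add0e; congr (_ + _)%E.
  apply/eqP; rewrite eq_le measure_ge0 andbT -PC.
  apply: le_measure; rewrite ?inE.
  - exact: measurableD.
  - exact: measurableC.
  - by rewrite setDE; exact: subIsetr.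
by rewrite h// ABC -h.
Qed.

(** On C, which has probability one, the increments of the driver are those of W. *)
Lemma driver_steps_independent n A (B : nat -> set R) :
  F 0 A -> (forall i, measurable (B i)) ->
  P (A `&` rectangle (driver_step n) B (2 ^ n)) =
  (P A * P (rectangle (driver_step n) B (2 ^ n)))%E.
Proof.
move=> FA mB; have mA : measurable A by exact: (filtration_sub fF (mem0 T0)).
pose D i := increment W (grid n i) (grid n i.+1).
have mV := rectangle_step_measurable n mB.
have mW : measurable (rectangle D B (2 ^ n)).
  apply: rectangle_mem; first exact: sigma_algebra_measurable.
  have mWt i : (i <= 2 ^ n)%N -> real_measurable measurable (W (grid n i)).
    move=> ni B' mB'; have gi := grid_in T0 ni.
    apply: (filtration_sub fF gi); apply: (bm_adapted bW gi).
    by exists B' => //; rewrite setTI.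
  move=> i ni; apply: real_measurableB => //; first exact: sigma_algebra_measurable.
    exact: mWt.
  by apply: mWt; exact: ltnW.
have VW m : rectangle (driver_step n) B m `&` C = rectangle D B m `&` C.
  elim: m => [//|m IH] /=; rewrite -!setIA ![_ `&` C]setIC !setIA IH.
  apply/seteqP; split => w /= [[h1 Cw] h2]; split => //; move: h2.
    by rewrite /D /increment /driver_step driverE.
  by rewrite /D /increment /driver_step driverE.
have -> : P (A `&` rectangle (driver_step n) B (2 ^ n)) = P (A `&` rectangle D B (2 ^ n)).
  by apply: probability_regular; [exact: measurableI|exact: measurableI|rewrite -!setIA VW].
rewrite increments_independent//; congr (_ * _)%E.
by apply: probability_regular => //; rewrite VW.
Qed.

Definition rectangles n : set (set Omega) :=
  [set X | exists2 B : nat -> set R, forall i, measurable (B i) &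
     X = rectangle (driver_step n) B (2 ^ n)].

(** The events generated by the driver on the dyadic grid of level n. *)
Definition level n : set (set Omega) := <<s rectangles n >>.

Lemma level_sigma n : sigma_algebra setT (level n).
Proof. exact: smallest_sigma_algebra. Qed.

Lemma rectangles_measurable n : rectangles n `<=` measurable.
Proof. by move=> X [B mB ->]; exact: rectangle_step_measurable. Qed.

Lemma level_measurable n : level n `<=` measurable.
Proof.
apply: smallest_sub; first exact: sigma_algebra_measurable.
exact: rectangles_measurable.
Qed.

Lemma rectangleI (D : nat -> Omega -> R) B B' m :
  rectangle D B m `&` rectangle D B' m = rectangle D (fun i => B i `&` B' i) m.
Proof.
elim: m => [|m IH] /=; first by rewrite setIT.
by rewrite -IH preimage_setI setIACA.
Qed.

Lemma level_independent n : independent_sys P (F 0) (level n).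
Proof.
apply: independent_sigma.
- exact: (filtration_sub fF (mem0 T0)).
- exact: rectangles_measurable.
- move=> X Y [B mB ->] [B' mB' ->]; exists (fun i => B i `&` B' i).
    by move=> i; exact: measurableI.
  exact: rectangleI.
- by move=> A X FA [B mB ->]; exact: driver_steps_independent.
Qed.

Lemma driver_step_level n i : (i < 2 ^ n)%N -> real_measurable (level n) (driver_step n i).
Proof.
move=> ni B mB; apply: sub_sigma_algebra.
exists (fun j => if j == i then B else setT); first by move=> j; case: ifP.
have E m : rectangle (driver_step n) (fun j => if j == i then B else setT) m =
    if (i < m)%N then driver_step n i @^-1` B else setT.
  elim: m => [//|m IH] /=; rewrite IH [in RHS]ltnS [in RHS]leq_eqVlt [in RHS]eq_sym.
  have [->|mi] := eqVneq m i; first by rewrite ltnn setTI.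
  by rewrite preimage_setT setIT; case: ltnP.
by rewrite E ni.
Qed.

Lemma driver_level n i : (i <= 2 ^ n)%N ->
  real_measurable (level n) (fun w => driver w (grid n i)).
Proof.
elim: i => [_|i IH ni].
  rewrite (_ : (fun w => _) = fun=> 0); last by apply/funext => w; rewrite grid0 driver0.
  move=> B mB; rewrite preimage_cst; case: ifP => _; last by case: (level_sigma n).
  by have [G0 GC _] := level_sigma n; rewrite -setC0 -setTD; exact: GC.
rewrite (_ : (fun w => _) = fun w => driver w (grid n i) + driver_step n i w).
  exact: (real_measurableD (level_sigma n) (IH (ltnW ni)) (driver_step_level ni)).
by apply/funext => w; rewrite /driver_step addrC subrK.
Qed.

Lemma level_mono m n : (m <= n)%N -> level m `<=` level n.
Proof.
move=> /subnK <-; elim: (n - m)%N => [//|k IH] A /IH; rewrite addSn.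
move: (k + m)%N => {}n; apply: smallest_sub; first exact: level_sigma.
move=> X [B mB ->]; apply: rectangle_mem; first exact: level_sigma.
move=> i ni; apply: (@real_measurableB _ _ _ (level_sigma n.+1)) => //.
  rewrite -grid_half; apply: driver_level.
  by rewrite expnS mul2n leq_double.
rewrite -grid_half; apply: driver_level.
by rewrite expnS mul2n leq_double ltnW.
Qed.

Definition driver_events : set (set Omega) := <<s \bigcup_n level n >>.

Lemma driver_events_sigma : sigma_algebra setT driver_events.
Proof. exact: smallest_sigma_algebra. Qed.

Lemma driver_events_measurable : driver_events `<=` measurable.
Proof.
apply: smallest_sub; first exact: sigma_algebra_measurable.
by move=> X [n _]; exact: level_measurable.
Qed.

(** The sigma-algebras of the dyadic levels increase, so that their union is a
    pi-system. *)
Lemma driver_events_independent : independent_sys P (F 0) driver_events.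
Proof.
apply: independent_sigma.
- exact: (filtration_sub fF (mem0 T0)).
- by move=> X [n _]; exact: level_measurable.
- move=> X Y [m _ LX] [n _ LY]; exists (maxn m n) => //.
  apply: (sigmaI (level_sigma _)).
    by apply: level_mono LX; exact: leq_maxl.
  by apply: level_mono LY; exact: leq_maxr.
- by move=> A X FA [n _ LX]; exact: level_independent LX.
Qed.

(** Closeness to f at the dyadic times only, which makes it a countable
    intersection of events; half the precision leaves room for comparing two
    drivers with each other. *)
Definition driver_near (k : nat) (f : R -> R) : set Omega :=
  [set w | forall n i, (i <= 2 ^ n)%N ->
    `|driver w (grid n i) - f (grid n i)| <= 2^-1 * k.+1%:R^-1].

Lemma driver_near_event k f : driver_events (driver_near k f).
Proof.
pose A (ni : nat * nat) : set Omega := if (ni.2 <= 2 ^ ni.1)%N then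
  [set w | `|driver w (grid ni.1 ni.2) - f (grid ni.1 ni.2)| <= 2^-1 * k.+1%:R^-1] else setT.
rewrite (_ : driver_near k f = \bigcap_ni A ni); last first.
  apply/seteqP; split => [w Hw [n i] _|w Hw n i ni].
    by rewrite /A/=; case: ifP => // ni; exact: Hw.
  by have := Hw (n, i) I; rewrite /A/= ni.
apply: sigma_bigcap; first exact: driver_events_sigma.
move=> [n i]; rewrite /A/=; case: ifP => ni; last first.
  by have [G0 GC _] := driver_events_sigma; rewrite -setC0 -setTD; exact: GC.
apply: sub_sigma_algebra; exists n => //.
pose B := `[f (grid n i) - 2^-1 * k.+1%:R^-1, f (grid n i) + 2^-1 * k.+1%:R^-1]%classic.
rewrite (_ : [set w | _] = (fun w => driver w (grid n i)) @^-1` B).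
  by apply: driver_level => //; exact: measurable_itv.
by apply/seteqP; split => w /=; rewrite /B/= in_itv/= ler_distl.
Qed.

Definition driver_cell (k n : nat) : set Omega :=
  if unpickle n is Some ms then driver_near k (step_path T ms) else set0.

Lemma driver_cell_event k n : driver_events (driver_cell k n).
Proof.
rewrite /driver_cell; case: unpickle => [ms|]; first exact: driver_near_event.
by case: driver_events_sigma.
Qed.

Lemma driver_cell_cover k w : exists n, driver_cell k n w.
Proof.
have k0 : 0 < 2^-1 * k.+1%:R^-1 :> R by rewrite mulr_gt0 ?invr_gt0.
have [ms hms] := step_path_dense T0 (@driver_cont w) k0.
exists (pickle ms); rewrite /driver_cell pickleK => n i ni.
by apply: hms; exact: grid_in.
Qed.

Lemma driver_cell_small k n w w' : driver_cell k n w -> driver_cell k n w' ->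
  forall t : R, t \in `[0, T] -> `|driver w t - driver w' t| <= k.+1%:R^-1.
Proof.
rewrite /driver_cell; case: unpickle => [ms|//] h h'.
apply: cont_grid_le => //; first exact: contB (@driver_cont w) (@driver_cont w').
move=> m i mi; have := h m i mi; have := h' m i mi.
set f := step_path T ms _; move: (driver w _) (driver w' _) => a b.
move: (k.+1%:R^-1 : R) => r hb ha.
rewrite (_ : a - b = (a - f) - (b - f)); last by ring.
by apply: le_trans (ler_normB _ _) _; lra.
Qed.

End Driver.

(** * Stationary solutions of the system *)

Section SamplePaths.
Variables (R : realType) (T sigma c : R).
Hypotheses (T0 : 0 < T) (c13 : 1 <= c < 3).

(** The fourth root of 2^c, the rate of growth in the energy estimates. *)
Definition gamma_of : R := 2 `^ (c / 4).

Lemma gamma_of_ge1 : 1 <= gamma_of.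
Proof.
rewrite -[leLHS](powRr0 2) ler_powR ?ler1n//.
by move: c13 => /andP[h1 _]; lra.
Qed.

Lemma gamma_of_lt2 : gamma_of < 2.
Proof.
rewrite /gamma_of /powR pnatr_eq0/= -[ltRHS](@lnK _ 2) ?posrE// ltr_expR.
by rewrite gtr_pMl ?ln_gt0 ?ltr1n//; move: c13 => /andP[_ h1]; lra.
Qed.

Lemma gamma_of_pow j : 2 `^ (c * j%:R) = (gamma_of ^+ 4) ^+ j.
Proof.
rewrite /gamma_of -!powR_mulrn ?powR_ge0// -!powRrM; congr (_ `^ _).
by field.
Qed.

Lemma solves_system_sol (w : R -> R) (u : R -> nat -> R) :
  cont T w -> w 0 = 0 -> (forall j, cont T (fun t => u t j)) ->
  (forall t : R, t \in `[0, T] -> Hplus (u t)) ->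
  solves_system T sigma c w u -> sol T sigma gamma_of w u.
Proof.
move=> cw w0 cu Hu Su; split.
- exact: cu.
- by move=> t j tT; have [_] := Hu t tT; exact.
- apply: prim_int => //.
  + by apply: contB => //; exact: contZ.
  + by apply: contN; exact: contM.
  + move=> t tT; have [-> _] := Su t tT.
    rewrite w0 mulr0 subr0 addrK; congr (_ + _).
    under [RHS]eq_Rintegral do rewrite -mulN1r.
    rewrite RintegralZl ?mulN1r//.
    exact: (cont_integrable tT (contM (cu 1%N) (cu 0%N))).
- move=> j; apply: prim_int => //.
  + apply: contD; last by apply: contZ; exact: contX.
    by apply: contM => //; exact: contZ.
  + move=> t tT; have [_ /(_ j.+1 isT) ->] := Su t tT; congr (_ + _).
    by apply: eq_Rintegral => s _ /=; rewrite !gamma_of_pow mulNr.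
- by apply: Hplus_square_summable; apply: Hu; exact: mem0.
Qed.

End SamplePaths.

(** Almost surely the driver is the Brownian path, and the sample path then
    solves the system along it. *)
Lemma strong_solution_pair (R : realType) d (Omega : measurableType d)
    (P : probability Omega R) (T sigma c : R) (F : R -> set (set Omega))
    (W : R -> Omega -> R) (C : set Omega) (u : R -> Omega -> nat -> R) :
  0 < T -> filtration T F -> brownian_motion P T F W ->
  measurable C -> P (~` C) = 0 ->
  (forall w, C w -> W 0 w = 0 /\ cont T (fun t => W t w)) ->
  strong_stationary_solution P T sigma c F W u ->
  stationary_pair P T sigma (gamma_of c) (driver W C) (F 0) (u 0) (u T).
Proof.
move=> T0 fF bW mC PC HC [[ubar Su] stat].
have m0 := mem0 T0; have mT := memT T0.
have u0 : u 0 = ubar by apply/funext => w; exact: (sol_initial Su).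
split.
- by move=> w; exact: (sol_Hplus Su).
- by move=> A hA; rewrite u0; apply: (sol_initial_measurable Su); exists A => //; rewrite setTI.
- by move=> w; exact: (sol_Hplus Su).
- move=> A hA; have : generated_filtration W ubar T (u T @^-1` A).
    by apply: (sol_adapted Su mT); exists A => //; rewrite setTI.
  move: (u T @^-1` A); apply: smallest_sub; first exact: sigma_algebra_measurable.
  move=> X [h|[s sT h]].
    by apply: (filtration_sub fF m0); exact: (sol_initial_measurable Su).
  have sT' : s \in `[0, T] by [].
  by apply: (filtration_sub fF sT'); exact: (bm_adapted bW sT').
- exact: stat.
- have dae := driver_ae W mC PC.
  apply: (filterS _ (filterI (sol_system Su) dae)) => w [sw dw].
  exists (fun t => u t w); split => //.
  apply: solves_system_sol => //.
  + exact: (driver_cont HC).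
  + exact: (driver0 HC).
  + by move=> j; exact: (sol_continuous Su).
  + by move=> t tT; exact: (sol_Hplus Su).
  + by rewrite dw.
Qed.

Theorem theorem3p3 (R : realType) (d : measure_display)
    (Omega : measurableType d) (P : probability Omega R)
    (T sigma c : R) (F : R -> set (set Omega)) (W : R -> Omega -> R)
    (u1 u2 : R -> Omega -> nat -> R) :
  0 < T -> 0 <= sigma -> 1 <= c < 3 ->
  filtration T F ->
  brownian_motion P T F W ->
  strong_stationary_solution P T sigma c F W u1 ->
  strong_stationary_solution P T sigma c F W u2 ->
  in_L2_Hplus P T u1 ->
  in_L2_Hplus P T u2 ->
  forall t : R, t \in `[0, T] -> same_law P (u1 t) (u2 t).
Proof.
move=> T0 _ c13 fF bW S1 S2 _ _ t tT.
have m0 := mem0 T0.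
have [C [mC PC HC]] := regular_event bW.
have main : same_law P (u1 0) (u2 0).
  apply: (stationary_pair_unique T0 (gamma_of_ge1 c13) (gamma_of_lt2 c13)
    (filtration_sub fF m0) (driver_events_measurable T0 fF bW mC)
    (filtration_sigma fF m0) (driver_events_sigma T W C)
    (driver_events_independent T0 fF bW mC PC HC)
    (driver0 HC) (@driver_cont _ _ _ _ _ _ HC)
    (driver_cell_event HC) (driver_cell_cover T0 HC) (@driver_cell_small _ _ _ _ _ T0 _ HC)).
    exact: (strong_solution_pair T0 fF bW mC PC HC S1).
  exact: (strong_solution_pair T0 fF bW mC PC HC S2).
move=> A hA; have [_ st1] := S1; have [_ st2] := S2.
by rewrite (st1 t 0 tT m0 A hA) (st2 t 0 tT m0 A hA); exact: main.
Qed.
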